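(* (a) Let $\mathbf{V}$ be an operator space, let $\mathbf{W}\subsetneq\mathbf{V}$ be a complete $M$-ideal, and let $Q:\mathbf{V}\to\mathbf{V}/\mathbf{W}$ be the canonical quotient map. If $v\in\mathbf{V}$ satisfies $\|v\|=1$ and $n_{\mathrm{cb}}(\mathbf{V};v)>0$, then $\|Q(v)\|=1$ and $n_{\mathrm{cb}}(\mathbf{V};v)\le n_{\mathrm{cb}}(\mathbf{V}/\mathbf{W};Q(v))$. (b) Let $\mathbf{V}$ be an operator system and $\mathbf{W}$ a proper complete $M$-ideal of $\mathbf{V}$. Then $\mathbf{V}/\mathbf{W}$ is also an operator system.
   Context: All vector spaces are complex. $M_{m,n}$ is the space of complex $m\times n$ matrices with the operator norm and $M_n=M_{n,n}$. A matricially normed space $\mathbf{V}$ is a vector space with a norm on each $M_k(\mathbf{V})$ ($k\in\mathbb{N}$) such that $\|\alpha x\beta\|\le\|\alpha\|\|x\|\|\beta\|$ for all $x\in M_m(\mathbf{V})$, $\alpha\in M_{n,m}$, $\beta\in M_{m,n}$; it is an operator space if moreover $\|x\oplus y\|=\max\{\|x\|,\|y\|\}$ for $x\in M_m(\mathbf{V})$, $y\in M_n(\mathbf{V})$. For a closed subspace $\mathbf{W}$ of an operator space $\mathbf{V}$, $\mathbf{V}/\mathbf{W}$ carries the quotient operator space structure $M_n(\mathbf{V}/\mathbf{W})=M_n(\mathbf{V})/M_n(\mathbf{W})$. For Hilbert space $H$, $M_k(\mathcal{L}(H))=\mathcal{L}(H^k)$. For linear $\varphi:\mathbf{V}\to\mathbf{W}$,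 $\varphi_k:M_k(\mathbf{V})\to M_k(\mathbf{W})$ denotes entrywise application, $\|\varphi\|_{\mathrm{cb}}=\sup_k\|\varphi_k\|$, and $\mathrm{CB}(\mathbf{V},\mathbf{W})$ is the set of $\varphi$ with $\|\varphi\|_{\mathrm{cb}}<\infty$; $\varphi$ is a complete isometry if every $\varphi_k$ is isometric. Complete $M$-ideals: a complete $M$-projection on an operator space $\mathbf{X}$ is a linear idempotent $P:\mathbf{X}\to\mathbf{X}$ with $\|x\|=\max\{\|P_n(x)\|,\|x-P_n(x)\|\}$ for all $n$ and $x\in M_n(\mathbf{X})$; its range is a complete $M$-summand of $\mathbf{X}$. A closed subspace $\mathbf{W}$ of $\mathbf{V}$ is a complete $M$-ideal if $\mathbf{W}^{\perp\perp}$ is a complete $M$-summand of the operator space bidual $\mathbf{V}^{**}$. For $u\in\mathbf{V}$ with $\|u\|=1$ put $\mathcal{S}_n(\mathbf{V};u)=\{\varphi\in\mathrm{CB}(\mathbf{V},M_n):\|\varphi\|_{\mathrm{cb}}\le1,\ \varphi(u)=I_n\}$, $\gamma^u_k(x)=\sup\{\|\varphi_k(x)\|:\varphi\in\mathcal{S}_n(\mathbf{V};u),\ n\in\mathbb{N}\}$ for $x\in M_k(\mathbf{V})$, and $n_{\mathrm{cb}}(\mathbf{V};u)=\inf\{\gamma^u_k(x):x\in M_k(\mathbf{V}),\ \|x\|=1,\ k\in\mathbb{N}\}$. Operator systems: a matricially normed space $\mathbf{W}$ with cones $\mathbf{W}_n^+\subseteq M_n(\mathbf{W})$ $(n\in\mathbb{N})$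 (a matrix order structure) is an operator system with order unit $e\in\mathbf{W}$ if there are a Hilbert space $K$ and a complete isometry $\Phi:\mathbf{W}\to\mathcal{L}(K)$ such that $\Phi(\mathbf{W})$ is self-adjoint, $\Phi(e)=\mathrm{id}_K$ and $\Phi_n(\mathbf{W}_n^+)=\Phi_n(M_n(\mathbf{W}))\cap\mathcal{L}(K^n)_+$ for all $n$. In (b), operator systems are taken to be nonzero, and the conclusion means that, for the quotient matrix norms, there exist a matrix order structure and an order unit making $\mathbf{V}/\mathbf{W}$ an operator system. *)

(* Defs.v *)
From HB Require Import structures.
From mathcomp Require Import all_boot all_order all_algebra.
From mathcomp Require Import sesquilinear ring_quotient generic_quotient.
From mathcomp Require Import complex lra.
From mathcomp Require Import boolp classical_sets functions.
From mathcomp Require Import reals constructive_ereal ereal.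

Set Implicit Arguments.
Unset Strict Implicit.
Unset Printing Implicit Defensive.

Import Order.TTheory GRing.Theory Num.Theory.
Import ComplexField.

Local Open Scope ring_scope.
Local Open Scope complex_scope.
Local Open Scope classical_set_scope.

Section MatrixNorms.
Variable R : realType.
Local Notation C := R[i].

Definition l2norm n (x : 'cV[C]_n) : R :=
  Num.sqrt (\sum_i Normc.normc (x i 0) ^+ 2).

Definition opnorm m n (A : 'M[C]_(m, n)) : R :=
  sup [set l2norm (A *m x) | x in [set x : 'cV[C]_n | l2norm x <= 1]].

(* A family of norms on all the M_k(V).  The size k = 0 is included: the axioms
   of [matricially_normed] force the norm to be 0 there. *)
Definition mxnorm (V : lmodType C) := forall k, 'M[V]_k -> R.

(* V is identified with M_1(V). *)
Definition vnorm (V : lmodType C) (nV : mxnorm V) (v : V) : R :=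
  nV 1%N (const_mx v).

Definition bimodmx (V : lmodType C) m n
    (a : 'M[C]_(n, m)) (x : 'M[V]_m) (b : 'M[C]_(m, n)) : 'M[V]_n :=
  \matrix_(i, j) \sum_k \sum_l (a i k * b l j) *: x k l.

Definition matricially_normed (V : lmodType C) (nV : mxnorm V) : Prop :=
  [/\ forall k (x y : 'M[V]_k), nV k (x + y) <= nV k x + nV k y,
      forall k c (x : 'M[V]_k),
        nV k (map_mx ( *:%R c) x) = Normc.normc c * nV k x,
      forall k (x : 'M[V]_k), nV k x = 0 -> x = 0 &
      forall m n (a : 'M[C]_(n, m)) (x : 'M[V]_m) (b : 'M[C]_(m, n)),
        nV n (bimodmx a x b) <= opnorm a * nV m x * opnorm b].

Definition operator_space (V : lmodType C) (nV : mxnorm V) : Prop :=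
  matricially_normed nV /\
  forall m n (x : 'M[V]_m) (y : 'M[V]_n),
    nV (m + n)%N (block_mx x 0 0 y) = Num.max (nV m x) (nV n y).

(* M_k(M_n) is M_(kn): x is read as a k x k block matrix. *)
Definition Mn_norm n : mxnorm 'M[C]_n :=
  fun k x => opnorm (\mxblock_(i < k, j < k) (x i j)).

Definition amp_norm (V W : lmodType C) (nV : mxnorm V) (nW : mxnorm W)
    (f : V -> W) k : \bar R :=
  ereal_sup [set (nW k (map_mx f x))%:E | x in [set x : 'M[V]_k | nV k x <= 1]].

Definition cb_norm (V W : lmodType C) (nV : mxnorm V) (nW : mxnorm W)
    (f : V -> W) : \bar R :=
  ereal_sup (range (amp_norm nV nW f)).

Definition complete_isometry (V W : lmodType C) (nV : mxnorm V)
    (nW : mxnorm W) (f : V -> W) : Prop :=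
  forall k (x : 'M[V]_k), nW k (map_mx f x) = nV k x.

End MatrixNorms.

Arguments Mn_norm {R} n k x : rename.

Section BoundedMaps.
Variables (R : realType) (U V : lmodType R[i]) (p : U -> R) (q : V -> R).

Definition bounded_linear : {pred U -> V} :=
  mem [set f : U -> V | linear f /\ exists M, forall u, q (f u) <= M * p u].

Lemma bounded_linear_submod_closed :
    q 0 = 0 ->
    (forall a, exists c, forall u v, q (a *: u + v) <= c * (q u + q v)) ->
    (forall v, 0 <= q v) ->
  submod_closed bounded_linear.
Proof.
move=> q0 qD qge0; split.
  rewrite inE /=; split; first by move=> a u v; rewrite scaler0 addr0.
  by exists 0 => u; rewrite mul0r q0.
move=> a f g; rewrite !inE => -[fl [M fM]] [gl [N gN]]; split.
  move=> b u v; have fgE w : (a *: f + g) w = a *: f w + g w by [].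
  by rewrite !fgE fl gl !scalerDr !scalerA (mulrC a) addrACA.
have [c qc] := qD a.
exists (`|c| * (M + N)) => u.
apply: (le_trans (qc _ _)); rewrite -mulrA mulrDl.
apply: (@le_trans _ _ (`|c| * (q (f u) + q (g u)))).
  by rewrite ler_wpM2r ?addr_ge0 ?ler_norm.
by rewrite ler_wpM2l // lerD.
Qed.

End BoundedMaps.

Section Dual.
Variables (R : realType) (V : lmodType R[i]) (nV : mxnorm V).

Definition bounded_functional : {pred V -> R[i]^o} :=
  bounded_linear (vnorm nV) (@Normc.normc R).

Record dual := Dual
  { dual_fun :> V -> R[i]^o; _ : dual_fun \in bounded_functional }.

HB.instance Definition _ := [isSub for dual_fun].
HB.instance Definition _ := [Choice of dual by <:].

Lemma bounded_functional_submod_closed : submod_closed bounded_functional.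
Proof.
apply: bounded_linear_submod_closed; first exact: Normc.normc0.
  move=> a; exists (Num.max (Normc.normc a) 1) => u v.
  apply: (le_trans (le_normcD _ _)); rewrite mulrDr lerD //.
    by rewrite Normc.normcM ler_wpM2r ?le_max ?lexx //; case: (u) => ? ?;
      exact: sqrtr_ge0.
  by rewrite ler_peMl ?le_max ?lexx ?orbT //; case: (v) => ? ?; exact: sqrtr_ge0.
by case=> ? ?; exact: sqrtr_ge0.
Qed.

HB.instance Definition _ := GRing.isSubmodClosed.Build _ _ bounded_functional
  bounded_functional_submod_closed.
HB.instance Definition _ := [SubChoice_isSubLmodule of dual by <:].

(* M_n of the dual is CB(V, M_n): f is read as the map v |-> [f_ij(v)], whose cb
   norm is finite on an operator space. *)
Definition dual_norm : mxnorm dual := fun n f =>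
  fine (cb_norm nV (Mn_norm n)
    (fun v => \matrix_(i, j) (f i j : V -> R[i]) v)).

Definition annihilator (S : set V) : set dual :=
  [set f : dual | forall v, S v -> f v = 0].

End Dual.

Arguments dual_norm {R V} nV n f : rename.
Arguments annihilator {R V} nV S.

Section CompleteMIdeals.
Variables (R : realType) (V : lmodType R[i]) (nV : mxnorm V).
Arguments nV : clear implicits.

Definition complete_M_projection (P : {linear V -> V}) : Prop :=
  (forall x, P (P x) = P x) /\
  forall n (x : 'M[V]_n),
    nV n x = Num.max (nV n (map_mx P x)) (nV n (x - map_mx P x)).

Definition complete_M_summand (J : set V) : Prop :=
  exists2 P : {linear V -> V}, complete_M_projection P & range P = J.

Definition norm_closed (S : set V) : Prop :=
  forall v, (forall e, 0 < e -> exists2 w, S w & vnorm nV (v - w) < e) -> S v.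

End CompleteMIdeals.

Definition biannihilator (R : realType) (V : lmodType R[i]) (nV : mxnorm V)
    (S : set V) : set (dual (dual_norm nV)) :=
  annihilator (dual_norm nV) (annihilator nV S).

Arguments biannihilator {R V} nV S.

Definition complete_M_ideal (R : realType) (V : lmodType R[i]) (nV : mxnorm V)
    (W : submodClosed V) : Prop :=
  norm_closed nV [set` W] /\
  complete_M_summand (dual_norm (dual_norm nV)) (biannihilator nV [set` W]).

Section Quotient.
Local Open Scope quotient_scope.
Variables (R : realType) (V : lmodType R[i]) (W : submodClosed V).

(* MathComp's quotient expects a [zmodClosed], which [submodClosed] is not
   declared to be. *)
Definition submod_pred : {pred V} := [pred v | v \in W].

HB.instance Definition _ := GRing.isZmodClosed.Build V submod_pred
  (GRing.submod_closedB (GRing.submodClosedP W)).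

Definition quot_space := @Quotient.quot V submod_pred.

HB.instance Definition _ := GRing.Zmodule.on quot_space.

Definition quot_map (v : V) : quot_space := \pi_(@Quotient.quot V submod_pred) v.

Definition quot_scale (a : R[i]) (q : quot_space) : quot_space :=
  quot_map (a *: repr q).

Lemma quot_mapP u v : quot_map u = quot_map v <-> u - v \in W.
Proof. by rewrite (Quotient.idealrBE submod_pred); split => /eqP. Qed.

Lemma quot_map_repr (q : quot_space) : quot_map (repr q) = q.
Proof. exact: reprK. Qed.

Lemma quot_mapD : {morph quot_map : u v / u + v}.
Proof. by move=> u v; rewrite /quot_map !piE. Qed.

Lemma quot_scaleE a v : quot_scale a (quot_map v) = quot_map (a *: v).
Proof.
apply/quot_mapP; rewrite -scalerBr rpredZ //; apply/quot_mapP.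
exact: quot_map_repr.
Qed.

Fact quot_scaleA a b q : quot_scale a (quot_scale b q) = quot_scale (a * b) q.
Proof. by rewrite -[q]quot_map_repr !quot_scaleE scalerA. Qed.

Fact quot_scale1 : left_id 1 quot_scale.
Proof. by move=> q; rewrite -[q]quot_map_repr quot_scaleE scale1r. Qed.

Fact quot_scaleDr : right_distributive quot_scale +%R.
Proof.
move=> a p q; rewrite -[p]quot_map_repr -[q]quot_map_repr.
by rewrite -quot_mapD !quot_scaleE scalerDr quot_mapD.
Qed.

Fact quot_scaleDl q : {morph quot_scale^~ q : a b / a + b}.
Proof.
by move=> a b; rewrite -[q]quot_map_repr !quot_scaleE scalerDl quot_mapD.
Qed.

HB.instance Definition _ := GRing.Zmodule_isLmodule.Build R[i] quot_space
  quot_scaleA quot_scale1 quot_scaleDr quot_scaleDl.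

Fact quot_map_linear : linear quot_map.
Proof. by move=> a u v; rewrite quot_mapD -quot_scaleE. Qed.

HB.instance Definition _ :=
  GRing.isLinear.Build R[i] V quot_space *:%R quot_map quot_map_linear.

Definition quot_norm (nV : mxnorm V) : mxnorm quot_space := fun n y =>
  inf [set nV n x | x in [set x : 'M[V]_n | map_mx quot_map x = y]].

End Quotient.

Arguments quot_norm {R V} W nV n y : rename.

Section CompleteNumericalIndex.
Variables (R : realType) (V : lmodType R[i]) (nV : mxnorm V) (u : V).
Arguments nV : clear implicits.

Definition mxstate n (f : {linear V -> 'M[R[i]]_n}) : Prop :=
  (cb_norm nV (Mn_norm n) f <= 1)%E /\ f u = 1%:M.

Definition mxstate_norm k (x : 'M[V]_k) : \bar R :=
  ereal_sup [set r | exists n (f : {linear V -> 'M[R[i]]_n}),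
    [/\ (0 < n)%N, mxstate f & r = (Mn_norm n k (map_mx f x))%:E]].

Definition n_cb : \bar R :=
  ereal_inf [set r | exists k (x : 'M[V]_k),
    nV k x = 1 /\ r = mxstate_norm x].

End CompleteNumericalIndex.

Section HilbertSpaces.
Variable R : realType.
Local Notation C := R[i].

Definition dot_norm (H : lmodType C) (ip : {dot H for Num.conj}) (x : H) : R :=
  Num.sqrt (complex.Re (ip x x)).

(* The inner product is linear in its first argument. *)
Record hilbertSpace := HilbertSpace {
  hilbert_sort :> lmodType C;
  hdot : {dot hilbert_sort for Num.conj};
  hilbert_complete : forall x : nat -> hilbert_sort,
    (forall e, 0 < e -> exists N, forall m n, (N <= m)%N -> (N <= n)%N ->
       dot_norm hdot (x m - x n) < e) ->
    exists l, forall e, 0 < e -> exists N, forall n, (N <= n)%N ->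
       dot_norm hdot (x n - l) < e }.

Variable H : hilbertSpace.

Definition hnorm (x : H) : R := dot_norm (hdot H) x.

Definition bounded_operator : {pred H -> H} := bounded_linear hnorm hnorm.

Record bop := Bop { bop_fun :> H -> H; _ : bop_fun \in bounded_operator }.

HB.instance Definition _ := [isSub for bop_fun].
HB.instance Definition _ := [Choice of bop by <:].

Lemma hnorm_sq x : hnorm x ^+ 2 = complex.Re (hdot H x x).
Proof.
by rewrite sqr_sqrtr //; have := dnorm_ge0 (hdot H) x; rewrite lecE => /andP[].
Qed.

Lemma hnormZ a x : hnorm (a *: x) = Normc.normc a * hnorm x.
Proof.
apply/eqP; rewrite -(eqrXn2 (n := 2)) ?mulr_ge0 ?sqrtr_ge0 //; last first.
  by case: a => ? ?; exact: sqrtr_ge0.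
have -> : Normc.normc a = complex.Re `|a| by [].
rewrite exprMn !hnorm_sq dnormZ; case: (hdot H x x) => b c.
rewrite normc_def -rmorphXn.
by rewrite /GRing.mul /= mul0r subr0.
Qed.

Lemma hnormD_le x y : hnorm (x + y) <= 2 * (hnorm x + hnorm y).
Proof.
rewrite -(ler_pXn2r (n := 2)) ?nnegrE ?mulr_ge0 ?addr_ge0 ?sqrtr_ge0 //.
have ReD : {morph @complex.Re R : u v / u + v} by case=> ? ? [].
have ReN : {morph @complex.Re R : u / - u} by case.
have := congr1 (@complex.Re R) (dnormD (hdot H) x y).
have := congr1 (@complex.Re R) (dnormB (hdot H) x y).
rewrite /= (ReD _ (- _)) ReN -hnorm_sq (ReD (hdot H x x)) -!hnorm_sq => hB.
rewrite (ReD (_ + _)) (ReD (hdot H x x)) -!hnorm_sq => hD.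
have := sqr_ge0 (hnorm (x - y)).
have : 0 <= hnorm x by exact: sqrtr_ge0.
have : 0 <= hnorm y by exact: sqrtr_ge0.
nra.
Qed.

Lemma bounded_operator_submod_closed : submod_closed bounded_operator.
Proof.
apply: bounded_linear_submod_closed => [|a|x]; last exact: sqrtr_ge0.
  by rewrite /hnorm /dot_norm linear0l sqrtr0.
exists (2 * Num.max (Normc.normc a) 1) => x y.
apply: (le_trans (hnormD_le _ _)); rewrite -mulrA ler_wpM2l // mulrDr lerD //.
  by rewrite hnormZ ler_wpM2r ?le_max ?lexx ?sqrtr_ge0.
by rewrite ler_peMl ?le_max ?lexx ?orbT ?sqrtr_ge0.
Qed.

HB.instance Definition _ := GRing.isSubmodClosed.Build _ _ bounded_operator
  bounded_operator_submod_closed.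
HB.instance Definition _ := [SubChoice_isSubLmodule of bop by <:].

Definition hdotk k (x y : 'cV[H]_k) : C := \sum_i hdot H (x i 0) (y i 0).

Definition hnormk k (x : 'cV[H]_k) : R := Num.sqrt (complex.Re (hdotk x x)).

Definition bopmx_app k (T : 'M[bop]_k) (x : 'cV[H]_k) : 'cV[H]_k :=
  \col_i \sum_j T i j (x j 0).

(* M_k(L(H)) is L(H^k). *)
Definition bop_norm : mxnorm bop := fun k T =>
  sup [set hnormk (bopmx_app T x) | x in [set x : 'cV[H]_k | hnormk x <= 1]].

Definition bop_positive k : set 'M[bop]_k :=
  [set T : 'M[bop]_k | forall x, 0 <= hdotk (bopmx_app T x) x].

Definition is_adjoint (S T : bop) : Prop :=
  forall x y, hdot H (T x) y = hdot H x (S y).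

End HilbertSpaces.

Arguments bop_norm {R} H k T : rename.
Arguments bop_positive {R} H k : rename.

Definition operator_system (R : realType) (V : lmodType R[i]) (nV : mxnorm V)
    (cone : forall n, set 'M[V]_n) (e : V) : Prop :=
  [/\ matricially_normed nV, exists v : V, v != 0 &
      exists (K : hilbertSpace R) (Phi : {linear V -> bop K}),
        [/\ complete_isometry nV (bop_norm K) Phi,
            forall v, exists w, is_adjoint (Phi w) (Phi v),
            forall x, Phi e x = x &
            forall n, map_mx Phi @` cone n =
              range (map_mx Phi : 'M[V]_n -> 'M[bop K]_n)
                `&` bop_positive K n]].

(* Main.v *)
(* A matrix state at v, compressed by finitely many vectors, is a map f with
   2 Re <f_j(x) xi, eta> <= |x| (<f(v) xi, xi> + <f(v) eta, eta>); call such maps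
   dominated.  Given an M-projection P of V** onto the bidual of W, a dominated
   f splits as f P + f (1 - P), and the second part factors through V/W.  Since
   |P y + (1 - P) x| <= max(|y|, |x|), it is dominated for the quotient norm up
   to the error <f P(v) (xi - eta), xi - eta>; the 2 x 2 matrix [[0, x], [v, 0]]
   tested on midpoints halves this error, so it vanishes.

   Let y have norm 1 in M_k(V/W) and let c <= n_cb(V; v).  Every lift of y + w
   has norm at least 1, so some matrix state takes a value of at least c - e on
   it.  A Hahn-Banach mean of compressed matrix states yields one dominated map
   that takes the value c on the lift and whose relevant entries vanish on W;
   its part on V/W is a matrix state norming y up to c.  This gives (a), the
   case k = 1 bounding |v + W| from below.

   For (b), vectors of the Hilbert space of V give compressed matrix states, so
   n_cb(V; e) >= 1, and the matrix states of V/W at e + W norm it completely.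
   Their l2 direct sum is a unital complete isometry; it preserves adjoints, as
   a functional with |s| <= s(e) is real on selfadjoint elements. *)
Require Import Defs.
From HB Require Import structures.
From mathcomp Require Import all_boot all_order all_algebra.
From mathcomp Require Import sesquilinear.
From mathcomp Require Import complex lra ring.
From mathcomp Require Import boolp classical_sets functions.
From mathcomp Require Import reals constructive_ereal ereal.

Set Implicit Arguments.
Unset Strict Implicit.
Unset Printing Implicit Defensive.

Import Order.TTheory GRing.Theory Num.Theory.
Import ComplexField.

Local Open Scope ring_scope.
Local Open Scope complex_scope.
Local Open Scope classical_set_scope.

(** Matrix states that nearly attain the index may have any size. Keeping only the 2k vectors that
    witness a value at a k x k matrix brings them all into M_2k, with uniformly bounded entries,
    where one mean can act entrywise. The price is that [f v] is no longer the identity but a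
    positive matrix, possibly singular. The quadratic terms of the domination inequality are added,
    not multiplied, so both sides are linear in [f] and the inequality survives averaging;
    Gram-Schmidt for [f v] recovers a matrix state afterwards. The same factorization carries a
    dominated map to the bidual, where the M-projection lives. After the splitting, the values of
    the two parts at [v] are positive matrices with sum [f v], but nothing makes their ranges
    orthogonal: no compression isolates the part on V/W, and the estimate starts with an error term.
    Vanishing on W is asked of the corner entries only: such an entry has no component along P and
    keeps its value in the quotient. *)

Local Notation Re := complex.Re.
Local Notation Im := complex.Im.
Local Notation mxconj := (map_mx Num.conj).

(** * Linear minorants of sublinear functionals (Hahn-Banach) *)

Section Sublinear.
Variables (R : realType) (E : lmodType R).
Implicit Types (p q : E -> R) (x y a : E).

Definition sublinear q :=
  (forall x y, q (x + y) <= q x + q y) /\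
  (forall c x, 0 < c -> q (c *: x) <= c * q x).

Lemma sublinear0 q : sublinear q -> q 0 = 0.
Proof.
move=> [_ qZ]; apply/eqP; rewrite eq_le.
have := qZ 2 0 ltac:(lra); have := qZ 2^-1 0 ltac:(lra).
rewrite !scaler0 => h1 h2; apply/andP; split; lra.
Qed.

Lemma sublinearZ q c x : sublinear q -> 0 <= c -> q (c *: x) = c * q x.
Proof.
move=> sq; rewrite le_eqVlt => /orP[/eqP<-|c0].
  by rewrite scale0r mul0r sublinear0.
have [_ qZ] := sq; apply/eqP; rewrite eq_le qZ //=.
have := qZ c^-1 (c *: x); rewrite invr_gt0 => /(_ c0).
by rewrite scalerA mulVf ?gt_eqF // scale1r ler_pdivlMl.
Qed.

Lemma sublinear_ge q x : sublinear q -> - q (- x) <= q x.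
Proof.
move=> sq; have [qD _] := sq; have := qD x (- x).
rewrite subrr sublinear0 //; lra.
Qed.

(** The bound [- p (- x)], common to all sublinear minorants of [p], keeps the infimum finite.
    Subadditivity needs a chain: of two members used at [x] and at [y], the smaller one serves at
    both points. *)
Lemma sublinear_chain_inf p (A : set (E -> R)) : A !=set0 ->
  (forall q, A q -> sublinear q /\ forall x, q x <= p x) ->
  (forall q q', A q -> A q' -> (forall x, q x <= q' x) \/ forall x, q' x <= q x) ->
  exists2 q0, sublinear q0 & forall q, A q -> forall x, q0 x <= q x.
Proof.
move=> [q1 Aq1] Ap Atot; pose V x := [set q x | q in A].
have lb x : has_lbound (V x).
  exists (- p (- x)) => _ [q Aq <-]; have [sq qp] := Ap _ Aq.
  by apply: le_trans (sublinear_ge x sq); rewrite lerN2.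
have ne x : V x !=set0 by exists (q1 x), q1.
have infl q x : A q -> inf (V x) <= q x by move=> Aq; apply: ge_inf => //; exists q.
exists (fun x => inf (V x)); last by move=> q Aq x; exact: infl.
split=> [x y|c x c0].
  rewrite -lerBlDr; apply: lb_le_inf => // _ [q Aq <-].
  rewrite lerBlDr -lerBlDl; apply: lb_le_inf => // _ [q' Aq' <-].
  rewrite lerBlDl.
  have [/(_ y)|/(_ x)] := Atot _ _ Aq Aq'.
  - move=> le; apply: le_trans (infl _ _ Aq) _; have [[qD _] _] := Ap _ Aq.
    apply: le_trans (qD _ _) _; lra.
  - move=> le; apply: le_trans (infl _ _ Aq') _; have [[qD _] _] := Ap _ Aq'.
    apply: le_trans (qD _ _) _; lra.
rewrite -ler_pdivrMl //; apply: lb_le_inf => // _ [q Aq <-].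
rewrite ler_pdivrMl //; apply: le_trans (infl _ _ Aq) _.
by have [[_ qZ] _] := Ap _ Aq; exact: qZ.
Qed.

Lemma sublinear_minimal p : sublinear p ->
  exists q, [/\ sublinear q, forall x, q x <= p x &
    forall q', sublinear q' -> (forall x, q' x <= q x) -> q' = q].
Proof.
move=> sp; pose P q := sublinear q /\ forall x, q x <= p x.
pose T := {q | P q}; pose r (s t : T) := `[< forall x, sval t x <= sval s x >].
have [||||[q [sq qp]] qmin] := @Zorn T r.
- by move=> t; apply/asboolP.
- move=> a b c /asboolP ab /asboolP bc; apply/asboolP => x.
  exact: le_trans (bc x) (ab x).
- move=> [a Pa] [b Pb] /asboolP /= ab /asboolP /= ba.
  by apply: eq_exist; apply/funext => x; apply/eqP; rewrite eq_le ab ba.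
- move=> A Atot; have [[a Aa]|A0] := pselect (A !=set0); last first.
    by exists (exist P p (conj sp (fun x => lexx _))) => s As; case: A0; exists s.
  have [|_ [b Ab <-]|_ _ [b Ab <-] [c Ac <-]|q0 sq0 q0A] :=
    @sublinear_chain_inf p (sval @` A).
  - by exists (sval a), a.
  - exact: (proj2_sig b).
  - by have [/asboolP|/asboolP] := Atot _ _ Ab Ac; [right|left].
  have Pq0 : P q0.
    split=> // x; have [_ /(_ x)] := proj2_sig a; apply: le_trans.
    by apply: q0A; exists a.
  exists (exist P q0 Pq0) => s As; apply/asboolP => x /=.
  by apply: q0A; exists s.
exists q; split=> // q' sq' q'q.
have Pq' : P q' by split=> // x; exact: le_trans (q'q x) (qp x).
by have /(congr1 sval) := qmin (exist P q' Pq') (asboolT q'q).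
Qed.

(* The perturbation x |-> inf_(t >= 0) (q (x + t a) - t q a) of a minimal
   sublinear q is q itself, and evaluating it at - a gives q (- a) = - q a. *)
Lemma sublinear_dominates_linear p : sublinear p ->
  exists2 L : E -> R, (forall c x y, L (c *: x + y) = c * L x + L y) &
    forall x, L x <= p x.
Proof.
move=> /sublinear_minimal[q [sq qp qmin]].
have [qD _] := sq.
have qN a : q (- a) = - q a.
  apply/eqP; rewrite eq_le; apply/andP; split; last first.
    by have := sublinear_ge (- a) sq; rewrite opprK.
  pose V x := [set q (x + t *: a) - t * q a | t in [set t | 0 <= t]].
  have lb x : has_lbound (V x).
    exists (- q (- x)) => _ [t /= t0 <-].
    by have := qD (x + t *: a) (- x); rewrite addrC addKr sublinearZ //; lra.
  have ne x : V x !=set0 by exists (q (x + 0 *: a) - 0 * q a), 0 => //=.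
  have infl x t : 0 <= t -> inf (V x) <= q (x + t *: a) - t * q a.
    by move=> t0; apply: ge_inf => //; exists t.
  have qE : (fun x => inf (V x)) = q.
    apply: qmin; last first.
      by move=> x; have := infl x 0 (lexx _); rewrite scale0r addr0 mul0r subr0.
    split=> [x y|c x c0].
      rewrite -lerBlDr; apply: lb_le_inf => // _ [t /= t0 <-].
      rewrite lerBlDr -lerBlDl; apply: lb_le_inf => // _ [s /= s0 <-].
      rewrite lerBlDl.
      apply: le_trans (infl _ (t + s) (addr_ge0 t0 s0)) _.
      have := qD (x + t *: a) (y + s *: a).
      rewrite addrACA -scalerDl mulrDl; lra.
    rewrite -ler_pdivrMl //; apply: lb_le_inf => // _ [t /= t0 <-].
    rewrite ler_pdivrMl //.
    apply: le_trans (infl _ (c * t) (mulr_ge0 (ltW c0) t0)) _.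
    by rewrite -scalerA -scalerDr sublinearZ // ?(ltW c0) //; lra.
  rewrite -[X in X <= _](congr1 (fun f => f (- a)) qE) /=.
  apply: le_trans (infl _ 1 ler01) _.
  by rewrite scale1r addNr sublinear0 // mul1r sub0r.
exists q => // c x y.
have qA u v : q (u + v) = q u + q v.
  apply/eqP; rewrite eq_le qD /=.
  have := qD (u + v) (- v); rewrite addrK qN; lra.
rewrite qA; congr (_ + _); have [c0|c0] := leP 0 c; first exact: sublinearZ.
have := sublinearZ (c := - c) x sq; rewrite scaleNr qN => H.
by have := H ltac:(lra); lra.
Qed.

End Sublinear.

(** * Means on bounded functions *)

Section Mean.
Variables (R : realType) (T : Type).

Definition bounded_fun (h : T -> R) := exists M, forall t, `|h t| <= M.

Lemma bounded_funD f g : bounded_fun f -> bounded_fun g ->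
  bounded_fun (fun t => f t + g t).
Proof.
move=> [M fM] [M' gM]; exists (M + M') => t.
by apply: le_trans (ler_normD _ _) _; rewrite lerD.
Qed.

Lemma bounded_funZ c f : bounded_fun f -> bounded_fun (fun t => c * f t).
Proof.
by move=> [M fM]; exists (`|c| * M) => t; rewrite normrM ler_wpM2l.
Qed.

Definition bounded_pred : {pred T -> R^o} := mem [set h : T -> R^o | bounded_fun h].

Lemma bounded_pred_submod_closed : submod_closed bounded_pred.
Proof.
split; first by rewrite inE; exists 0 => t; rewrite normr0.
move=> a f g; rewrite !inE => -[M fM] [N gN]; exists (`|a| * M + N) => t.
rewrite (le_trans (ler_normD _ _)) // lerD //.
by rewrite normrM ler_wpM2l.
Qed.

HB.instance Definition _ := GRing.isSubmodClosed.Build R (T -> R^o) bounded_pred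
  bounded_pred_submod_closed.

Record bfun := BFun { bfun_fun :> T -> R^o; _ : bfun_fun \in bounded_pred }.
HB.instance Definition _ := [isSub for bfun_fun].
HB.instance Definition _ := [Choice of bfun by <:].
HB.instance Definition _ := [SubChoice_isSubLmodule of bfun by <:].

Lemma bfunP (h : bfun) : bounded_fun h.
Proof. by case: h => h hb /=; have := hb; rewrite inE. Qed.

(** The integral against a finitely additive probability on [T]. It is a function of arbitrary maps,
    but its laws speak of bounded ones only. *)
Record mean (L : (T -> R) -> R) : Prop := Mean {
  meanD : forall f g, bounded_fun f -> bounded_fun g ->
    L (fun t => f t + g t) = L f + L g;
  meanZ : forall c f, bounded_fun f -> L (fun t => c * f t) = c * L f;
  mean_cst : forall c, L (fun=> c) = c;
  mean_le : forall f g, bounded_fun f -> bounded_fun g ->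
    (forall t, f t <= g t) -> L f <= L g }.

(* The mean is linear below h |-> inf_(g in G) sup (h + g). *)
Lemma mean_exists (G : set (T -> R)) :
  (forall g, G g -> bounded_fun g) -> G (fun=> 0) ->
  (forall g h, G g -> G h -> G (fun t => g t + h t)) ->
  (forall c g, 0 < c -> G g -> G (fun t => c * g t)) ->
  (forall g e, G g -> 0 < e -> exists t, - e < g t) ->
  exists2 L, mean L & forall g, G g -> 0 <= L g.
Proof.
move=> Gb G0 GD GZ Gpos.
have [t0 _] := Gpos _ 1 G0 ltr01.
pose S (h : T -> R) := sup (range h).
have ubS (h : T -> R) : bounded_fun h -> has_ubound (range h).
  by move=> [M hM]; exists M => _ [t _ <-]; exact: le_trans (ler_norm _) (hM t).
have leS (h : T -> R) t : bounded_fun h -> h t <= S h.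
  by move=> /ubS hb; apply: ub_le_sup => //; exists t.
have Sle (h : T -> R) M : (forall t, h t <= M) -> S h <= M.
  by move=> hM; apply: ge_sup; [exists (h t0), t0|move=> _ [t _ <-]].
pose V (h : bfun) := [set S (fun t => h t + g t) | g in G].
have ne h : V h !=set0 by exists (S (fun t => h t + 0)), (fun=> 0).
(* As [h >= - M] everywhere and [g > - e] somewhere, [sup (h + g)] is at least [- M - e]: the
   near-nonnegativity of [G] makes the infimum finite. *)
have lb h : has_lbound (V h).
  have [M hM] := bfunP h.
  exists (- M) => _ [g Gg <-]; apply/ler_addgt0Pl => e e0.
  have [t gt] := Gpos _ _ Gg e0.
  have := leS _ t (bounded_funD (bfunP h) (Gb _ Gg)).
  have := hM t; rewrite ler_norml => /andP[]; lra.
have infl (h : bfun) g : G g -> inf (V h) <= S (fun t => h t + g t).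
  by move=> Gg; apply: ge_inf => //; exists g.
have sV : sublinear (fun h => inf (V h)).
  split=> [x y|c x c0].
    rewrite -lerBlDr; apply: lb_le_inf => // _ [f Gf <-].
    rewrite lerBlDr -lerBlDl; apply: lb_le_inf => // _ [g Gg <-].
    rewrite lerBlDl; apply: le_trans (infl _ _ (GD _ _ Gf Gg)) _.
    apply: Sle => t; rewrite /= [X in X + _]/(x t + y t) addrACA lerD //.
      exact: (leS (fun t => x t + f t) t (bounded_funD (bfunP x) (Gb _ Gf))).
    exact: (leS (fun t => y t + g t) t (bounded_funD (bfunP y) (Gb _ Gg))).
  rewrite -ler_pdivrMl //; apply: lb_le_inf => // _ [f Gf <-].
  rewrite ler_pdivrMl //; apply: le_trans (infl _ _ (GZ _ _ c0 Gf)) _.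
  apply: Sle => t; rewrite /= [X in X + _]/(c * x t) -mulrDr ler_pM2l //.
  exact: (leS (fun t => x t + f t) t (bounded_funD (bfunP x) (Gb _ Gf))).
have [L Llin Lle] := sublinear_dominates_linear sV.
(* Each [g] in [G] is a certificate: an upper bound of [h + g] bounds [L h]. With [h = - g] this
   gives [L g >= 0]. *)
have Lub (h : bfun) g M : G g -> (forall t, h t + g t <= M) -> L h <= M.
  move=> Gg hM; apply: le_trans (Lle _) _; apply: le_trans (infl _ _ Gg) _.
  exact: Sle.
have L0 : L 0 = 0.
  by have := Llin 1 0 0; rewrite scaler0 addr0; lra.
have LZ c h : L (c *: h) = c * L h by rewrite -[_ *: _]addr0 Llin L0 addr0.
have LN h : L (- h) = - L h by rewrite -scaleN1r LZ mulN1r.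
have inb (h : T -> R) : bounded_fun h -> (h : T -> R^o) \in bounded_pred.
  by rewrite inE.
(* Extension by the default value 0 to the unbounded functions. *)
pose L' (h : T -> R) := if pselect (bounded_fun h) is left hb
  then L (BFun (inb h hb)) else 0.
have L'E (h : bfun) : L' h = L h.
  rewrite /L'; case: pselect => [hb|]; last by case; exact: bfunP.
  by congr L; apply: val_inj.
have bE (h : T -> R) : bounded_fun h -> exists k : bfun, h = k.
  by move=> hb; exists (BFun (inb h hb)).
have L'cst c : L' (fun=> c) = c.
  have [|k kE] := bE (fun=> c); first by exists `|c|.
  rewrite kE L'E; apply/eqP; rewrite eq_le; apply/andP; split.
    by apply: (Lub _ _ _ G0) => t; rewrite addr0 -(congr1 (fun f => f t) kE).
  rewrite -lerN2 -LN; apply: (Lub _ _ _ G0) => t.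
  by rewrite addr0 [X in X <= _]/(- k t) -(congr1 (fun f => f t) kE).
exists L'; first split=> //.
- move=> f g /bE[f' ->] /bE[g' ->].
  have -> : (fun t => f' t + g' t) = (f' + g' : bfun) :> (T -> R) by [].
  by rewrite !L'E -[f']scale1r Llin mul1r scale1r.
- move=> c f /bE[f' ->].
  have -> : (fun t => c * f' t) = (c *: f' : bfun) :> (T -> R) by [].
  by rewrite !L'E LZ.
- move=> f g /bE[f' ->] /bE[g' ->] fg; rewrite !L'E -subr_le0.
  have -> : L f' - L g' = L (1 *: f' + - g') by rewrite Llin mul1r LN.
  apply: (Lub _ _ _ G0) => t; rewrite scale1r addr0 [X in X <= _]/(f' t - g' t).
  by rewrite subr_le0; exact: fg.
- move=> g Gg; have /bE[g' gE] := Gb _ Gg; rewrite gE L'E -oppr_le0 -LN.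
  apply: (Lub _ _ _ Gg) => t; rewrite gE [X in X + _]/(- g' t).
  by rewrite addNr.
Qed.

End Mean.

(** * Real parts, moduli and phases of complex numbers *)

Section ComplexNumbers.
Variable R : realType.
Local Notation C := R[i].
Implicit Types (z w : C) (r : R).

Lemma ReMr r z : Re (r%:C * z) = r * Re z.
Proof. by case: z => a b /=; rewrite mul0r subr0. Qed.

Lemma ReN z : Re (- z) = - Re z.
Proof. exact: raddfN. Qed.

Lemma ReD z w : Re (z + w) = Re z + Re w.
Proof. exact: raddfD. Qed.

Lemma Re_conj z : Re (Num.conj z) = Re z.
Proof. by case: z. Qed.

Lemma Re_Mi z : Re ('i * z) = - Im z.
Proof. by case: z => a b /=; rewrite mul0r mul1r sub0r. Qed.

Lemma conj_real r : Num.conj (r%:C) = r%:C.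
Proof. by rewrite /Num.conj /= oppr0. Qed.

Lemma conj_realM r z : Num.conj (r%:C * z) = r%:C * Num.conj z.
Proof. by rewrite rmorphM /= -[X in X * _]/(Num.conj r%:C) conj_real. Qed.

Lemma normc_ge0 z : 0 <= Normc.normc z.
Proof. by case: z => a b; exact: sqrtr_ge0. Qed.

Lemma normc_sq z : Normc.normc z ^+ 2 = Re (Num.conj z * z).
Proof.
case: z => a b; rewrite /Num.conj /= sqr_sqrtr ?addr_ge0 ?sqr_ge0 //.
by rewrite !expr2; ring.
Qed.

Lemma normc_conjM z : (Normc.normc z ^+ 2)%:C = Num.conj z * z.
Proof.
rewrite normc_sq; case: z => a b; rewrite /Num.conj /=; congr (_ +i* _) => /=.
by ring.
Qed.

Lemma normc_real r : Normc.normc (r%:C) = `|r|.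
Proof. by rewrite /Normc.normc /= expr0n /= addr0 sqrtr_sqr. Qed.

Lemma normc_real_sq r : Normc.normc (r%:C) ^+ 2 = r ^+ 2.
Proof. by rewrite normc_sq conj_real ReMr. Qed.

Lemma Re_le_normc z : Re z <= Normc.normc z.
Proof.
case: z => a b; apply: le_trans (ler_norm _) _ => /=.
by rewrite -sqrtr_sqr ler_sqrt ?lerDl ?addr_ge0 ?sqr_ge0.
Qed.

(* The unimodular scalar [exp(- i arg z)]. *)
Lemma exists_phase z :
  exists2 u : C, Normc.normc u = 1 & u * z = (Normc.normc z)%:C.
Proof.
have [->|z0] := eqVneq z 0.
  by exists 1; rewrite ?Normc.normc1 // Normc.normc0 mulr0.
have n0 : Normc.normc z != 0 by apply: contraNN z0 => /eqP/Normc.eq0_normc ->.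
exists ((Normc.normc z)^-1%:C * Num.conj z).
  rewrite Normc.normcM normc_real ger0_norm ?invr_ge0 ?normc_ge0 //.
  have -> : Normc.normc (Num.conj z) = Normc.normc z.
    by case: (z) => a b /=; rewrite sqrrN.
  by rewrite mulVf.
rewrite -mulrA -normc_conjM -rmorphM expr2 /=.
by congr (_%:C); rewrite mulrA mulVf // mul1r.
Qed.

(** The [u] with [u * z = |z|] gives [|z| <= Re z], which leaves no room for an imaginary part. It
    shows that forms at [v] are real, because the unimodular multiples of [v] obey the same norm
    bound as [v]. *)
Lemma Im0_of_phase z :
  (forall u, Normc.normc u = 1 -> Re (u * z) <= Re z) -> Im z = 0 /\ 0 <= Re z.
Proof.
move=> H; have [u u1 uz] := exists_phase z.
have := H u u1; rewrite uz /= => le.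
have ge0 : 0 <= Re z by apply: le_trans (normc_ge0 z) le.
split=> //; apply/eqP; rewrite -sqrf_eq0 eq_le sqr_ge0 andbT.
have := normc_ge0 z; move: le (normc_sq z); case: z {H uz} ge0 => a b /=.
rewrite /Num.conj /=; nra.
Qed.

End ComplexNumbers.

(** * Hilbert-Schmidt geometry, forms of matrices over M_N, operator norms *)

Section Forms.
Variable R : realType.
Local Notation C := R[i].

(** The square of the Hilbert-Schmidt norm; squares keep roots out of the estimates. *)
Definition hs m n (A : 'M[C]_(m, n)) : R :=
  \sum_i \sum_j Normc.normc (A i j) ^+ 2.

Definition mxip m n (A B : 'M[C]_(m, n)) : C := \tr (mxconj B *m A^T).

Lemma hs_ge0 m n (A : 'M[C]_(m, n)) : 0 <= hs A.
Proof. by do 2!apply: sumr_ge0 => ? _; rewrite sqr_ge0. Qed.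

Lemma mxip_hs m n (A : 'M[C]_(m, n)) : mxip A A = (hs A)%:C.
Proof.
rewrite /mxip /mxtrace /hs rmorph_sum; apply: eq_bigr => i _.
rewrite mxE rmorph_sum; apply: eq_bigr => j _.
by rewrite !mxE -normc_conjM.
Qed.

Lemma hsE m n (A : 'M[C]_(m, n)) : hs A = Re (mxip A A).
Proof. by rewrite mxip_hs. Qed.

Lemma mxipDl m n (A B D : 'M[C]_(m, n)) : mxip (A + B) D = mxip A D + mxip B D.
Proof. by rewrite /mxip linearD mulmxDr mxtraceD. Qed.

Lemma mxipZl m n c (A B : 'M[C]_(m, n)) : mxip (c *: A) B = c * mxip A B.
Proof. by rewrite /mxip linearZ -scalemxAr mxtraceZ. Qed.

Lemma mxip_conj m n (A B : 'M[C]_(m, n)) : mxip B A = Num.conj (mxip A B).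
Proof.
rewrite /mxip -trace_map_mx map_mxM -mxtrace_tr trmx_mul trmxK map_trmx.
rewrite -map_mx_comp; congr (\tr (_ *m _)); apply/matrixP => i j.
by rewrite !mxE /= conjCK.
Qed.

Lemma mxipDr m n (A B D : 'M[C]_(m, n)) : mxip D (A + B) = mxip D A + mxip D B.
Proof. by rewrite mxip_conj mxipDl rmorphD /= -(mxip_conj A) -(mxip_conj B). Qed.

Lemma mxipZr m n c (A B : 'M[C]_(m, n)) :
  mxip A (c *: B) = Num.conj c * mxip A B.
Proof. by rewrite mxip_conj mxipZl rmorphM /= -(mxip_conj B). Qed.

Lemma hsZ m n c (A : 'M[C]_(m, n)) : hs (c *: A) = Normc.normc c ^+ 2 * hs A.
Proof.
rewrite /hs mulr_sumr; apply: eq_bigr => i _; rewrite mulr_sumr.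
by apply: eq_bigr => j _; rewrite mxE Normc.normcM exprMn.
Qed.

Lemma hs0 m n : hs (0 : 'M[C]_(m, n)) = 0.
Proof. by rewrite -(scale0r 0) hsZ Normc.normc0 expr0n mul0r. Qed.

Lemma hsT m n (A : 'M[C]_(m, n)) : hs A^T = hs A.
Proof.
rewrite /hs exchange_big; do 2!(apply: eq_bigr => ? _).
by rewrite mxE.
Qed.

Lemma hs_col_mx m1 m2 n (A : 'M[C]_(m1, n)) (B : 'M[C]_(m2, n)) :
  hs (col_mx A B) = hs A + hs B.
Proof.
rewrite /hs big_split_ord; congr (_ + _); do 2!(apply: eq_bigr => ? _).
  by rewrite col_mxEu.
by rewrite col_mxEd.
Qed.

Lemma hs_delta m n (i : 'I_m) (l : 'I_n) : hs (delta_mx i l : 'M[C]_(m, n)) = 1.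
Proof.
rewrite /hs (bigD1 i) //= [X in _ + X]big1 => [|i' ni].
  rewrite addr0 (bigD1 l) //= [X in _ + X]big1 => [|l' nl].
    by rewrite addr0 mxE !eqxx Normc.normc1 expr1n.
  by rewrite mxE (negPf nl) andbF Normc.normc0 expr0n.
by apply: big1 => l' _; rewrite mxE (negPf ni) Normc.normc0 expr0n.
Qed.

Lemma hs_eq0 m n (A : 'M[C]_(m, n)) : hs A = 0 -> A = 0.
Proof.
move=> /eqP; rewrite psumr_eq0; last first.
  by move=> i _; apply: sumr_ge0 => j _; rewrite sqr_ge0.
move=> /allP h; apply/matrixP => i j; rewrite mxE.
have /= := h i (mem_index_enum i); rewrite psumr_eq0; last first.
  by move=> k _; rewrite sqr_ge0.
move=> /allP /(_ j (mem_index_enum j)) /=.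
by rewrite sqrf_eq0 => /eqP/Normc.eq0_normc.
Qed.

(** Cauchy-Schwarz in additive form, from [0 <= hs (A - s D)]. In this form it can be summed over
    blocks and averaged. *)
Lemma Re_mxip_le m n (A D : 'M[C]_(m, n)) s b : 0 <= s ->
  hs A <= s ^+ 2 * b -> 2 * Re (mxip A D) <= s * (b + hs D).
Proof.
rewrite le_eqVlt => /orP[/eqP<-|s0] AB.
  rewrite mul0r; move: AB; rewrite expr0n mul0r => AB.
  have -> : A = 0 by apply: hs_eq0; apply/eqP; rewrite eq_le AB hs_ge0.
  by rewrite -(scale0r 0) mxipZl mul0r mulr0.
have : 0 <= hs (A + (- s)%:C *: D) by exact: hs_ge0.
rewrite hsE mxipDl !mxipDr !mxipZl !mxipZr conj_real !mxip_hs !ReD !ReMr.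
rewrite (mxip_conj A D) Re_conj /= => H.
rewrite -(ler_pM2l s0); move: H AB; rewrite !expr2; nra.
Qed.

(* The value at [al (x) be^*] of a [j x j] matrix [X] with entries in M_N: rows
   of [al], [be] are the components in C^N of vectors of (C^N)^j. *)
Definition form N j (X : 'M['M[C]_N]_j) (al be : 'M[C]_(j, N)) : C :=
  \sum_i \sum_l (mxconj be *m X i l *m al^T) i l.

Lemma form_entryE N j (M : 'M[C]_N) (al be : 'M[C]_(j, N)) i l :
  (mxconj be *m M *m al^T) i l =
  \sum_a \sum_b Num.conj (be i a) * M a b * al l b.
Proof.
rewrite exchange_big mxE; apply: eq_bigr => b _.
by rewrite !mxE mulr_suml; apply: eq_bigr => a _; rewrite !mxE.
Qed.

Lemma formE N j (X : 'M['M[C]_N]_j) al be : form X al be =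
  \sum_i \sum_l \sum_a \sum_b Num.conj (be i a) * X i l a b * al l b.
Proof. by do 2!(apply: eq_bigr => ? _); rewrite form_entryE. Qed.

Lemma form_delta N (X : 'M['M[C]_N]_1) a b :
  form X (delta_mx 0 b) (delta_mx 0 a) = X 0 0 a b.
Proof.
rewrite formE !big_ord1 (bigD1 a) //= [X in _ + X]big1 => [|a' na].
  rewrite addr0 (bigD1 b) //= [X in _ + X]big1 => [|b' nb].
    by rewrite addr0 !mxE !eqxx rmorph1 mul1r mulr1.
  by rewrite !mxE (negPf nb) andbF mulr0.
by apply: big1 => b' _; rewrite !mxE (negPf na) andbF rmorph0 !mul0r.
Qed.

Section FormTheory.
Variables N j : nat.
Implicit Types (X Y : 'M['M[C]_N]_j) (al be : 'M[C]_(j, N)).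

Lemma formDl X al1 al2 be : form X (al1 + al2) be = form X al1 be + form X al2 be.
Proof.
rewrite /form -big_split; apply: eq_bigr => i _; rewrite -big_split.
by apply: eq_bigr => l _; rewrite [(al1 + al2)^T]linearD mulmxDr mxE.
Qed.

Lemma formZl X c al be : form X (c *: al) be = c * form X al be.
Proof.
rewrite /form mulr_sumr; apply: eq_bigr => i _; rewrite mulr_sumr.
by apply: eq_bigr => l _; rewrite [(c *: al)^T]linearZ -scalemxAr mxE.
Qed.

Lemma formDr X al be1 be2 : form X al (be1 + be2) = form X al be1 + form X al be2.
Proof.
rewrite /form -big_split; apply: eq_bigr => i _; rewrite -big_split.
by apply: eq_bigr => l _; rewrite map_mxD !mulmxDl mxE.
Qed.

Lemma formZr X c al be : form X al (c *: be) = Num.conj c * form X al be.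
Proof.
rewrite /form mulr_sumr; apply: eq_bigr => i _; rewrite mulr_sumr.
by apply: eq_bigr => l _; rewrite map_mxZ -!scalemxAl mxE.
Qed.

Lemma form0l X be : form X 0 be = 0.
Proof. by rewrite -(scale0r 0) formZl mul0r. Qed.

Lemma formNl X al be : form X (- al) be = - form X al be.
Proof. by rewrite -scaleN1r formZl mulN1r. Qed.

Lemma formNr X al be : form X al (- be) = - form X al be.
Proof. by rewrite -scaleN1r formZr rmorphN rmorph1 mulN1r. Qed.

Lemma formD X Y al be : form (X + Y) al be = form X al be + form Y al be.
Proof.
rewrite /form -big_split; apply: eq_bigr => i _; rewrite -big_split.
by apply: eq_bigr => l _; rewrite [(X + Y) i l]mxE mulmxDr mulmxDl mxE.
Qed.

Lemma formZ c X al be : form (map_mx ( *:%R c) X) al be = c * form X al be.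
Proof.
rewrite /form mulr_sumr; apply: eq_bigr => i _; rewrite mulr_sumr.
by apply: eq_bigr => l _; rewrite [map_mx _ X i l]mxE -scalemxAr -scalemxAl mxE.
Qed.

(* Polarization of a form whose diagonal is real. *)
Lemma form_real_sym X : (forall al, Im (form X al al) = 0) ->
  forall al be, Re (form X al be) = Re (form X be al).
Proof.
move=> H al be; have := H (al + 'i *: be).
rewrite formDl !formDr !formZl !formZr.
have := H al; have := H be.
case: (form X al al) => a0 a1; case: (form X be be) => b0 b1.
case: (form X al be) => c0 c1; case: (form X be al) => d0 d1.
rewrite /Num.conj /=; lra.
Qed.

End FormTheory.

(** The compression of [M] to the rows of [Y]: entry [(a, b)] is the sesquilinear form of [M] at row
    [b] and row [a]. *)
Definition mxconj_by N' N (Y : 'M[C]_(N', N)) (M : 'M[C]_N) : 'M[C]_N' :=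
  mxconj Y *m M *m Y^T.

Lemma mxconj_byE N' N (B : 'M[C]_(N', N)) M a b :
  mxconj_by B M a b = \sum_c \sum_d (Num.conj (B a c) * B b d) * M c d.
Proof.
rewrite /mxconj_by mxE exchange_big; apply: eq_bigr => d _.
rewrite mxE mulr_suml; apply: eq_bigr => c _.
by rewrite !mxE mulrAC.
Qed.

Lemma form_conj_by N' N j (Y : 'M[C]_(N', N)) (X : 'M['M[C]_N]_j) al be :
  form (map_mx (mxconj_by Y) X) al be = form X (al *m Y) (be *m Y).
Proof.
do 2!(apply: eq_bigr => ? _).
by rewrite [map_mx _ X _ _]mxE /mxconj_by trmx_mul map_mxM !mulmxA.
Qed.

Lemma form_block N j (X11 X12 X21 X22 : 'M['M[C]_N]_j) al1 al2 be1 be2 :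
  form (block_mx X11 X12 X21 X22) (col_mx al1 al2) (col_mx be1 be2) =
  form X11 al1 be1 + form X12 al2 be1 + form X21 al1 be2 + form X22 al2 be2.
Proof.
rewrite !formE big_split_ord /= -addrA; congr (_ + _).
  rewrite -big_split; apply: eq_bigr => i _; rewrite big_split_ord.
  congr (_ + _); do 3!(apply: eq_bigr => ? _).
    by rewrite block_mxEul !col_mxEu.
  by rewrite block_mxEur col_mxEu col_mxEd.
rewrite -big_split; apply: eq_bigr => i _; rewrite big_split_ord.
congr (_ + _); do 3!(apply: eq_bigr => ? _).
  by rewrite block_mxEdl col_mxEu col_mxEd.
by rewrite block_mxEdr !col_mxEd.
Qed.

Lemma l2norm_sq n (x : 'cV[C]_n) : l2norm x ^+ 2 = hs x.
Proof.
rewrite /l2norm sqr_sqrtr ?sumr_ge0 // => [|i _]; last exact: sqr_ge0.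
by rewrite /hs; apply: eq_bigr => i _; rewrite big_ord1.
Qed.

Lemma l2norm_ge0 n (x : 'cV[C]_n) : 0 <= l2norm x.
Proof. exact: sqrtr_ge0. Qed.

Lemma l2norm_le n (x : 'cV[C]_n) c : 0 <= c -> (l2norm x <= c) = (hs x <= c ^+ 2).
Proof. by move=> c0; rewrite -l2norm_sq ler_pXn2r // nnegrE ?l2norm_ge0. Qed.

Definition opnorm_set m n (A : 'M[C]_(m, n)) :=
  [set l2norm (A *m x) | x in [set x : 'cV[C]_n | l2norm x <= 1]].

Lemma normc_sum (I : Type) (r : seq I) (F : I -> C) :
  Normc.normc (\sum_(i <- r) F i) <= \sum_(i <- r) Normc.normc (F i).
Proof.
elim: r => [|i r IH]; first by rewrite !big_nil Normc.normc0.
rewrite !big_cons; apply: le_trans (le_normcD _ _) _.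
by rewrite lerD2l.
Qed.

Lemma has_ubound_opnorm m n (A : 'M[C]_(m, n)) : has_ubound (opnorm_set A).
Proof.
exists (Num.sqrt (\sum_i (\sum_j Normc.normc (A i j)) ^+ 2)) => _ [x /= x1 <-].
rewrite /l2norm ler_sqrt; last by apply: sumr_ge0 => i _; rewrite sqr_ge0.
apply: ler_sum => i _; rewrite ler_pXn2r ?nnegrE ?normc_ge0 //; last first.
  by apply: sumr_ge0 => j _; rewrite normc_ge0.
rewrite mxE; apply: le_trans (normc_sum _ _) _; apply: ler_sum => j _.
rewrite Normc.normcM -[leRHS]mulr1 ler_wpM2l ?normc_ge0 //.
apply: le_trans x1; rewrite -(ger0_norm (normc_ge0 _)) -sqrtr_sqr ler_sqrt.
  by rewrite (bigD1 j) //= lerDl; apply: sumr_ge0 => k _; rewrite sqr_ge0.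
by apply: sumr_ge0 => k _; rewrite sqr_ge0.
Qed.

Lemma opnorm_ge0 m n (A : 'M[C]_(m, n)) : 0 <= opnorm A.
Proof.
apply: le_trans (l2norm_ge0 (A *m 0)) _; apply: ub_le_sup.
  exact: has_ubound_opnorm.
by exists 0 => //=; rewrite l2norm_le // hs0.
Qed.

Lemma hs_mulmx_le m n (A : 'M[C]_(m, n)) (x : 'cV[C]_n) :
  hs (A *m x) <= opnorm A ^+ 2 * hs x.
Proof.
have [hx|] := leP (hs x) 0.
  have -> : x = 0 by apply: hs_eq0; apply/eqP; rewrite eq_le hx hs_ge0.
  by rewrite mulmx0 !hs0 mulr0.
move=> hx; pose s := Num.sqrt (hs x).
have s0 : 0 < s by rewrite sqrtr_gt0.
have sE : s ^+ 2 = hs x by rewrite sqr_sqrtr // ltW.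
have : l2norm (A *m (s^-1%:C *: x)) <= opnorm A.
  apply: ub_le_sup; first exact: has_ubound_opnorm.
  exists (s^-1%:C *: x) => //=; rewrite l2norm_le // hsZ normc_real_sq.
  by rewrite expr1n exprVn sE mulVf // gt_eqF.
rewrite l2norm_le ?opnorm_ge0 // -scalemxAr hsZ normc_real_sq exprVn sE.
by rewrite ler_pdivrMl // mulrC.
Qed.

Lemma mxip_colE n (u y : 'cV[C]_n) : mxip u y = ((mxconj y)^T *m u) 0 0.
Proof.
rewrite /mxip /mxtrace mxE; apply: eq_bigr => i _.
by rewrite !mxE big_ord1 !mxE.
Qed.

Lemma opnorm_ge_form m n (A : 'M[C]_(m, n)) x (y : 'cV[C]_m) :
  2 * Re (mxip (A *m x) y) <= opnorm A * (hs x + hs y).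
Proof. by apply: Re_mxip_le; [exact: opnorm_ge0|exact: hs_mulmx_le]. Qed.

(** For [|x| <= 1], testing against [y = A x / |A x|] gives [2 |A x| <= c (|x|^2 + 1) <= 2 c].
    Together with [opnorm_ge_form], the operator norm is the least constant in this quadratic
    bound. *)
Lemma opnorm_le m n (A : 'M[C]_(m, n)) c : 0 <= c ->
  (forall (x : 'cV[C]_n) (y : 'cV[C]_m),
    2 * Re (mxip (A *m x) y) <= c * (hs x + hs y)) -> opnorm A <= c.
Proof.
move=> c0 H; apply: ge_sup.
  by exists (l2norm (A *m 0)), 0 => //=; rewrite l2norm_le // hs0.
move=> _ [x /= x1 <-]; set u := A *m x.
have [|n0] := leP (l2norm u) 0; first by move/le_trans; exact.
have := H x ((l2norm u)^-1%:C *: u).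
rewrite -/u mxipZr mxip_hs conj_real ReMr /= hsZ normc_real_sq -!l2norm_sq.
have -> : (l2norm u)^-1 * l2norm u ^+ 2 = l2norm u.
  by rewrite expr2 mulrA mulVf ?gt_eqF // mul1r.
rewrite exprVn mulVf ?sqrf_eq0 ?gt_eqF //.
have : l2norm x ^+ 2 <= 1 by rewrite expr_le1 // l2norm_ge0.
have := sqr_ge0 (l2norm x); nra.
Qed.

End Forms.

Section MatrixAlgebraNorm.
Variables (R : realType) (N k : nat).
Local Notation C := R[i].
Implicit Types (X : 'M['M[C]_N]_k) (al be : 'M[C]_(k, N)).

(** Identifies k x N matrices with the columns on which a k x k block matrix with N x N blocks acts;
    row [i] becomes block [i]. *)
Definition stack al : 'cV[C]_(\sum_(i < k) N) := \mxcol_i (row i al)^T.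

Lemma stack_surj (x : 'cV[C]_(\sum_(i < k) N)) : exists al, x = stack al.
Proof.
exists (\matrix_(i, a) submxcol x i a 0); rewrite -[LHS]submxcolK.
by apply: eq_mxcol => i; apply/matrixP => a b; rewrite !mxE ord1.
Qed.

Lemma mxconj_stackT al : (mxconj (stack al))^T = \mxrow_i mxconj (row i al).
Proof. by apply/matrixP => i j; rewrite !mxE. Qed.

Lemma hs_stack al : hs (stack al) = hs al.
Proof.
rewrite !hsE mxip_colE mxconj_stackT mul_mxrow_mxcol summxE; congr Re.
apply: eq_bigr => i _; rewrite !mxE; apply: eq_bigr => a _.
by rewrite !mxE.
Qed.

Lemma mxip_mxblock X al be :
  mxip (\mxblock_(i < k, j < k) X i j *m stack al) (stack be) = form X al be.
Proof.
rewrite mxip_colE mxconj_stackT mulmxA mul_mxrow_mxblock mul_mxrow_mxcol.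
rewrite summxE /form exchange_big; apply: eq_bigr => l _.
rewrite mulmx_suml summxE; apply: eq_bigr => i _.
rewrite form_entryE exchange_big mxE; apply: eq_bigr => b _.
by rewrite !mxE mulr_suml; apply: eq_bigr => a _; rewrite !mxE.
Qed.

Lemma Mn_norm_ge_form X al be :
  2 * Re (form X al be) <= Mn_norm N k X * (hs al + hs be).
Proof. by rewrite -mxip_mxblock -2!hs_stack opnorm_ge_form. Qed.

Lemma Mn_norm_le X c : 0 <= c ->
  (forall al be, 2 * Re (form X al be) <= c * (hs al + hs be)) ->
  Mn_norm N k X <= c.
Proof.
move=> c0 H; apply: opnorm_le => // x y.
have [al ->] := stack_surj x; have [be ->] := stack_surj y.
by rewrite mxip_mxblock !hs_stack.
Qed.

Lemma Mn_norm_ge0 X : 0 <= Mn_norm N k X.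
Proof. exact: opnorm_ge0. Qed.

End MatrixAlgebraNorm.

(** * Completely bounded maps through quadratic bounds *)

Section CompressibleNorms.
Variables (R : realType) (V : lmodType R[i]).
Local Notation C := R[i].

Definition compress (j : nat) (x : 'M[V]_j) (u w : 'cV[C]_j) : V :=
  \sum_i \sum_l (Num.conj (w i 0) * u l 0) *: x i l.

(* The properties of a matricially normed space that its dual inherits without
   further work, enough to bound functionals completely. *)
Definition compressible (nV : mxnorm V) : Prop :=
  [/\ forall k x, 0 <= nV k x,
      forall k c (x : 'M[V]_k), 0 < c -> nV k (map_mx ( *:%R c%:C) x) <= c * nV k x &
      forall k (x : 'M[V]_k) u w, hs u <= 1 -> hs w <= 1 ->
        vnorm nV (compress x u w) <= nV k x].

Variable nV : mxnorm V.
Arguments nV : clear implicits.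
Hypothesis cV : compressible nV.

Lemma compressible_ge0 k (x : 'M[V]_k) : 0 <= nV k x.
Proof. by case: cV. Qed.

Lemma compressibleZ k c (x : 'M[V]_k) : 0 < c ->
  nV k (map_mx ( *:%R c%:C) x) = c * nV k x.
Proof.
have [_ nZ _] := cV => c0; apply/eqP; rewrite eq_le nZ //=.
have := nZ k c^-1 (map_mx ( *:%R c%:C) x); rewrite invr_gt0 => /(_ c0).
rewrite -map_mx_comp (_ : map_mx _ x = x); last first.
  apply/matrixP => i l; rewrite mxE /= scalerA -rmorphM /= mulVf ?gt_eqF //.
  by rewrite scale1r.
by rewrite ler_pdivlMl.
Qed.

(* Homogeneity in [x] makes a bound on the unit ball a bound everywhere. *)
Lemma unit_ball_bound k (F : 'M[V]_k -> R) M : 0 <= M ->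
  (forall c x, 0 < c -> F (map_mx ( *:%R c%:C) x) = c * F x) ->
  (forall x, nV k x <= 1 -> F x <= M) -> forall x, F x <= M * nV k x.
Proof.
move=> M0 FZ FM x; have := compressible_ge0 x.
rewrite le_eqVlt => /orP[/eqP x0|x0].
  rewrite -x0 mulr0 leNgt; apply/negP => Fx.
  have c0 : 0 < (M + 1) / F x by rewrite divr_gt0 // ltr_wpDl.
  have := FM (map_mx ( *:%R ((M + 1) / F x)%:C) x).
  rewrite compressibleZ // FZ // -x0 mulr0 divfK ?gt_eqF //.
  by move=> /(_ ler01); rewrite gerDl ler10.
have c0 : 0 < (nV k x)^-1 by rewrite invr_gt0.
have := FM (map_mx ( *:%R (nV k x)^-1%:C) x).
rewrite compressibleZ // FZ // mulVf ?gt_eqF // => /(_ (lexx _)).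
by rewrite ler_pdivrMl // mulrC.
Qed.

(** The bound [M] on the cb norm, tested on vectors ([cb_norm_leP]); it is free of suprema and
    extended reals. *)
Definition cb_bound N (f : V -> 'M[C]_N) (M : R) :=
  forall j (x : 'M[V]_j) al be,
    2 * Re (form (map_mx f x) al be) <= M * nV j x * (hs al + hs be).

Lemma linear_map_mxZ N (f : {linear V -> 'M[C]_N}) j c (x : 'M[V]_j) :
  map_mx f (map_mx ( *:%R c) x) = map_mx ( *:%R c) (map_mx f x).
Proof. by apply/matrixP => i l; rewrite !mxE linearZ. Qed.

Lemma cb_norm_leP N (f : {linear V -> 'M[C]_N}) M : 0 <= M ->
  (cb_norm nV (Mn_norm N) f <= M%:E)%E <-> cb_bound f M.
Proof.
move=> M0; split=> [cbM j x al be|fM].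
  pose F (x : 'M[V]_j) := 2 * Re (form (map_mx f x) al be).
  have FZ c y : 0 < c -> F (map_mx ( *:%R c%:C) y) = c * F y.
    by move=> _; rewrite /F linear_map_mxZ formZ ReMr mulrCA.
  have hh : 0 <= hs al + hs be by rewrite addr_ge0 ?hs_ge0.
  rewrite mulrAC; apply: (@unit_ball_bound j F) => // [|y y1].
    exact: mulr_ge0.
  apply: le_trans (Mn_norm_ge_form _ _ _) _; rewrite ler_wpM2r //.
  rewrite -lee_fin; apply: le_trans cbM.
  apply: (@le_trans _ _ (amp_norm nV (Mn_norm N) f j)).
    by apply: ereal_sup_ubound; exists y.
  by apply: ereal_sup_ubound; exists j.
apply: ge_ereal_sup => _ [j _ <-]; apply: ge_ereal_sup => _ [x /= x1 <-].
rewrite lee_fin; apply: Mn_norm_le => // al be; apply: le_trans (fM _ _ _ _) _.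
by rewrite ler_wpM2r ?addr_ge0 ?hs_ge0 // ler_piMr.
Qed.

Lemma cb_norm_ge0 N (f : {linear V -> 'M[C]_N}) :
  (0 <= cb_norm nV (Mn_norm N) f)%E.
Proof.
apply: (@le_trans _ _ (amp_norm nV (Mn_norm N) f 0)); last first.
  by apply: ereal_sup_ubound; exists 0%N.
apply: (@le_trans _ _ (Mn_norm N 0 (map_mx f 0))%:E).
  by rewrite lee_fin Mn_norm_ge0.
apply: ereal_sup_ubound; exists 0 => //=.
(* The only 0 x 0 matrix equals its double, so its norm is 0 and it lies in the unit ball. *)
have : map_mx ( *:%R 2%:C) 0 = 0 :> 'M[V]_0 by exact: flatmx0.
have := @compressibleZ 0 2 0 ltac:(lra).
by move=> + E0; rewrite E0; lra.
Qed.

Lemma mxstate_bound N v (f : {linear V -> 'M[C]_N}) :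
  mxstate nV v f <-> cb_bound f 1 /\ f v = 1%:M.
Proof.
have [le bd] := @cb_norm_leP N f 1 ler01.
by split=> -[h fv]; split=> //; [exact: le|exact: bd].
Qed.

End CompressibleNorms.

Section Contractions.
Variable R : realType.
Local Notation C := R[i].

Lemma Re_mxip_le_hs m n (A B : 'M[C]_(m, n)) : 2 * Re (mxip A B) <= hs A + hs B.
Proof.
by rewrite -[leRHS]mul1r; apply: Re_mxip_le => //; rewrite expr1n mul1r.
Qed.

Lemma mxip_mulmx m n (A : 'M[C]_(m, n)) (x : 'cV[C]_n) (y : 'cV[C]_m) :
  mxip (A *m x) y = mxip x ((mxconj A)^T *m y).
Proof.
rewrite !mxip_colE mulmxA map_mxM trmx_mul -map_trmx trmxK -map_mx_comp.
congr ((_ *m _ *m _) 0 0); apply/matrixP => i j.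
by rewrite !mxE /= conjCK.
Qed.

Lemma opnorm_le1 m n (A : 'M[C]_(m, n)) :
  (forall x : 'cV_n, hs (A *m x) <= hs x) -> opnorm A <= 1.
Proof.
move=> H; apply: opnorm_le => // x y; rewrite mul1r.
by apply: le_trans (Re_mxip_le_hs _ _) _; rewrite lerD2r.
Qed.

Lemma opnorm_le1_adj m n (A : 'M[C]_(m, n)) :
  (forall y : 'cV_m, hs ((mxconj A)^T *m y) <= hs y) -> opnorm A <= 1.
Proof.
move=> H; apply: opnorm_le => // x y; rewrite mul1r mxip_mulmx.
by apply: le_trans (Re_mxip_le_hs _ _) _; rewrite lerD2l.
Qed.

Lemma hs_mul_outer m n (x : 'cV[C]_m) (y : 'rV[C]_n) :
  hs (x *m y) = hs x * hs y.
Proof.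
rewrite /hs mulr_suml; apply: eq_bigr => i _; rewrite big_ord1 big_ord1 mulr_sumr.
by apply: eq_bigr => j _; rewrite mxE big_ord1 Normc.normcM exprMn.
Qed.

End Contractions.

Section MatriciallyNormed.
Variables (R : realType) (V : lmodType R[i]) (nV : mxnorm V).
Arguments nV : clear implicits.
Hypothesis mV : matricially_normed nV.
Local Notation C := R[i].

Lemma matricial_norm0 k : nV k 0 = 0.
Proof.
have [_ nZ _ _] := mV; have := nZ k 0 0.
rewrite Normc.normc0 mul0r => <-; congr nV.
by apply/matrixP => i j; rewrite !mxE scale0r.
Qed.

Lemma matricial_normN k x : nV k (- x) = nV k x.
Proof.
have [_ nZ _ _] := mV; have := nZ k (-1) x.
have -> : Normc.normc (-1) = 1 :> R.
  by rewrite -(rmorph1 (real_complex R)) -rmorphN normc_real normrN1.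
rewrite mul1r => <-; congr nV.
by apply/matrixP => i j; rewrite !mxE scaleN1r.
Qed.

Lemma matricial_norm_ge0 k x : 0 <= nV k x.
Proof.
have [nD _ _ _] := mV; have := nD k x (- x).
rewrite subrr matricial_norm0 matricial_normN; lra.
Qed.

Lemma matricial_norm_bimod m n (a : 'M[C]_(n, m)) x (b : 'M[C]_(m, n)) :
  opnorm a <= 1 -> opnorm b <= 1 -> nV n (bimodmx a x b) <= nV m x.
Proof.
move=> a1 b1; have [_ _ _ nB] := mV; apply: le_trans (nB _ _ _ _ _) _.
have := opnorm_ge0 a; have := opnorm_ge0 b; have := matricial_norm_ge0 x.
move=> x0 b0 a0; apply: (@le_trans _ _ (opnorm a * nV m x)).
  by rewrite ler_piMr ?mulr_ge0.
by rewrite ler_piMl.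
Qed.

(** A compression is [w^* x u], the bimodule action of a row and a column of norm at most 1. *)
Lemma matricially_normed_compressible : compressible nV.
Proof.
split=> [|k c x c0|k x u w u1 w1]; first exact: matricial_norm_ge0.
  by have [_ -> _ _] := mV; rewrite normc_real gtr0_norm.
rewrite /vnorm; have -> : const_mx (compress x u w) = bimodmx (mxconj w)^T x u.
  apply/matrixP => i j; rewrite !mxE !ord1.
  by do 2!(apply: eq_bigr => ? _); rewrite !mxE.
apply: matricial_norm_bimod.
  apply: opnorm_le1_adj => y; rewrite (_ : (mxconj _)^T = w).
    by rewrite hs_mul_outer ler_piMl ?hs_ge0.
  by apply/matrixP => i j; rewrite !mxE conjCK.
by apply: opnorm_le1 => y; rewrite hs_mul_outer ler_piMl ?hs_ge0.
Qed.

End MatriciallyNormed.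

(** * Matrix norms on the dual and the bidual *)

Section DualNorm.
Variables (R : realType) (V : lmodType R[i]) (nV : mxnorm V).
Arguments nV : clear implicits.
Hypothesis cV : compressible nV.
Local Notation C := R[i].
Implicit Types (f g : dual nV).

Lemma compressible_norm0 k : nV k 0 = 0.
Proof.
have := compressibleZ cV (0 : 'M[V]_k) (c := 2) ltac:(lra).
rewrite (_ : map_mx _ 0 = 0) => [|]; first by lra.
by apply/matrixP => i j; rewrite !mxE scaler0.
Qed.

(** Dividing both vectors by the root of [hs u + hs w] brings them into the unit ball at once; when
    this sum is 0, so is the compression. *)
Lemma vnorm_compress_le k (x : 'M[V]_k) u w :
  vnorm nV (compress x u w) <= (hs u + hs w) * nV k x.
Proof.
have [s0|] := leP (hs u + hs w) 0.
  have u0 : u = 0.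
    by apply: hs_eq0; have := hs_ge0 u; have := hs_ge0 w; lra.
  have -> : compress x u w = 0.
    rewrite /compress; do 2!(apply: big1 => ? _).
    by rewrite u0 mxE mulr0 scale0r.
  have -> : vnorm nV 0 = 0.
    by rewrite /vnorm (_ : const_mx 0 = 0) ?compressible_norm0.
  have := hs_ge0 u; have := hs_ge0 w => hw hu.
  by rewrite mulr_ge0 ?addr_ge0 ?compressible_ge0.
move=> p0; set p := hs u + hs w in p0 *; pose s := Num.sqrt p.
have s0 : 0 < s by rewrite sqrtr_gt0.
have sE : s ^+ 2 = p by rewrite sqr_sqrtr // ltW.
have hle z : hs z <= p -> hs (s^-1%:C *: z : 'cV[C]_k) <= 1.
  by move=> zp; rewrite hsZ normc_real_sq exprVn sE ler_pdivrMl // mulr1.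
have [_ _ nC] := cV.
have := nC _ x (s^-1%:C *: u) (s^-1%:C *: w).
have hw := hs_ge0 w; have hu := hs_ge0 u.
rewrite !hle ?lerDl ?lerDr // => /(_ isT isT).
suff -> : compress x (s^-1%:C *: u) (s^-1%:C *: w) = p^-1%:C *: compress x u w.
  rewrite /vnorm (_ : const_mx _ = map_mx ( *:%R p^-1%:C) (const_mx (compress x u w))).
    by rewrite compressibleZ ?invr_gt0 // ler_pdivrMl.
  by apply/matrixP => i j; rewrite !mxE.
rewrite /compress scaler_sumr; apply: eq_bigr => i _; rewrite scaler_sumr.
apply: eq_bigr => l _; rewrite scalerA !mxE conj_realM mulrACA.
by rewrite -sE -exprVn expr2 rmorphM.
Qed.

Definition dual_map N (f : 'M[dual nV]_N) (v : V) : 'M[C]_N :=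
  \matrix_(i, j) (f i j : V -> C) v.

Lemma dual_fun_linear f : linear (dual_fun f).
Proof. by case: f => f fP; have := fP; rewrite inE => -[]. Qed.

Lemma dual_fun_bounded f :
  exists2 M, 0 <= M & forall v, Normc.normc (f v) <= M * vnorm nV v.
Proof.
case: f => f fP; have := fP; rewrite inE => -[_ [M fM]].
exists `|M| => // v; apply: le_trans (fM v) _.
by rewrite ler_wpM2r ?ler_norm // compressible_ge0.
Qed.

HB.instance Definition _ f :=
  GRing.isLinear.Build C V C^o *:%R (dual_fun f) (dual_fun_linear f).

Lemma dual_map_linear N (f : 'M[dual nV]_N) : linear (dual_map f).
Proof. by move=> c u v; apply/matrixP => i j; rewrite !mxE linearP. Qed.

HB.instance Definition _ N (f : 'M[dual nV]_N) :=
  GRing.isLinear.Build C V 'M[C]_N *:%R (dual_map f) (dual_map_linear f).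

Lemma dual_formE N j (f : 'M[dual nV]_N) (x : 'M[V]_j) al be :
  form (map_mx (dual_map f) x) al be =
  \sum_a \sum_b f a b (compress x (col b al) (col a be)).
Proof.
rewrite formE; under eq_bigr do rewrite exchange_big; rewrite exchange_big.
apply: eq_bigr => a _.
under eq_bigr do rewrite exchange_big; rewrite exchange_big /=.
apply: eq_bigr => b _; rewrite /compress linear_sum exchange_big.
rewrite exchange_big; apply: eq_bigr => i _; rewrite linear_sum.
apply: eq_bigr => l _; rewrite linearZ !mxE.
by rewrite [RHS]mulrAC.
Qed.

(** A functional sees a matrix only through its compressions, so the bounds of the entries add up to
    a complete bound. What counts is that the bound is finite: [fine] in [dual_norm] then loses
    nothing. *)
Lemma dual_map_cb N (f : 'M[dual nV]_N) : exists2 M, 0 <= M & cb_bound nV (dual_map f) M.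
Proof.
have /choice[M HM] : forall p : 'I_N * 'I_N, exists M,
    0 <= M /\ forall v, Normc.normc (f p.1 p.2 v) <= M * vnorm nV v.
  by move=> p; have [M M0 H] := dual_fun_bounded (f p.1 p.2); exists M.
exists (\sum_a \sum_b 2 * M (a, b)).
  apply: sumr_ge0 => a _; apply: sumr_ge0 => b _; rewrite mulr_ge0 //.
  by have [] := HM (a, b).
move=> j x al be; rewrite dual_formE -mulrA mulr_suml raddf_sum mulr_sumr.
apply: ler_sum => a _; rewrite mulr_suml raddf_sum mulr_sumr.
apply: ler_sum => b _; have [M0 {}HM] := HM (a, b).
rewrite -mulrA ler_pM2l //; apply: le_trans (Re_le_normc _) _.
apply: le_trans (HM _) _; rewrite ler_wpM2l // mulrC.
apply: le_trans (vnorm_compress_le _ _ _) _; rewrite ler_wpM2r ?compressible_ge0 //.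
have hs_col m n (A : 'M[C]_(m, n)) c : hs (col c A) <= hs A.
  rewrite /hs; apply: ler_sum => i _; rewrite big_ord1 mxE (bigD1 c) //= lerDl.
  by apply: sumr_ge0 => ? _; rewrite sqr_ge0.
by rewrite lerD.
Qed.

Lemma dual_cb_fin N (f : 'M[dual nV]_N) :
  cb_norm nV (Mn_norm N) (dual_map f) = (dual_norm nV N f)%:E.
Proof.
have [M M0 fM] := dual_map_cb f.
have [_ /(_ fM) le] := cb_norm_leP cV (dual_map f) M0.
have fin : cb_norm nV (Mn_norm N) (dual_map f) \is a fin_num.
  rewrite ge0_fin_numE; last exact: cb_norm_ge0.
  exact: le_lt_trans le (ltry M).
exact: esym (fineK fin).
Qed.

Lemma dual_norm_ge0 N (f : 'M[dual nV]_N) : 0 <= dual_norm nV N f.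
Proof. by rewrite -lee_fin -dual_cb_fin; exact: cb_norm_ge0. Qed.

Lemma dual_norm_bound N (f : 'M[dual nV]_N) :
  cb_bound nV (dual_map f) (dual_norm nV N f).
Proof.
have [H _] := cb_norm_leP cV (dual_map f) (dual_norm_ge0 f).
by apply: H; rewrite dual_cb_fin.
Qed.

Lemma dual_norm_le N (f : 'M[dual nV]_N) M : 0 <= M ->
  cb_bound nV (dual_map f) M -> dual_norm nV N f <= M.
Proof.
move=> M0 fM; rewrite -lee_fin -dual_cb_fin.
by have [_ H] := cb_norm_leP cV (dual_map f) M0; exact: H.
Qed.

Lemma dual_fun_sum (I : Type) (r : seq I) (F : I -> dual nV) v :
  (\sum_(i <- r) F i) v = \sum_(i <- r) F i v.
Proof.
elim: r => [|i r IH]; first by rewrite !big_nil.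
by rewrite !big_cons -IH.
Qed.

(** Compressing [f] by [u] and [w] gives the functional [v |-> w^* f(v) u], whose forms are those of
    [f] at matrices of rank at most one. The theory of the dual thus applies to the dual again. *)
Lemma dual_compressible : compressible (dual_norm nV).
Proof.
split=> [|k c f c0|k f u w u1 w1]; first exact: dual_norm_ge0.
  apply: dual_norm_le => [|j x al be]; first exact: mulr_ge0 (ltW c0) (dual_norm_ge0 f).
  have -> : map_mx (dual_map (map_mx ( *:%R c%:C) f)) x =
      map_mx ( *:%R c%:C) (map_mx (dual_map f) x).
    by do 2!(apply/matrixP => ? ?; rewrite !mxE).
  rewrite formZ ReMr mulrCA -!mulrA ler_pM2l // mulrA.
  exact: dual_norm_bound.
apply: dual_norm_le => [|j x al be]; first exact: dual_norm_ge0.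
have -> : form (map_mx (dual_map (const_mx (compress f u w))) x) al be =
    form (map_mx (dual_map f) x) (al *m u^T) (be *m w^T).
  have E v : dual_map (const_mx (compress f u w)) v =
      mxconj w^T *m dual_map f v *m u.
    rewrite -mulmxA; apply/matrixP => a b; rewrite !ord1 !mxE dual_fun_sum.
    apply: eq_bigr => i _; rewrite dual_fun_sum !mxE mulr_sumr.
    by apply: eq_bigr => l _; rewrite !mxE [f i l _ * _]mulrC mulrA.
  do 2!(apply: eq_bigr => ? _).
  by rewrite trmx_mul trmxK map_mxM ![map_mx _ x _ _]mxE E !mulmxA.
apply: le_trans (dual_norm_bound _ _ _ _) _.
rewrite ler_wpM2l ?mulr_ge0 ?dual_norm_ge0 ?compressible_ge0 //.
by rewrite !hs_mul_outer !hsT lerD // ler_piMr // hs_ge0.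
Qed.

End DualNorm.

Local Opaque dual_norm.

Section Bidual.
Variables (R : realType) (V : lmodType R[i]) (nV : mxnorm V).
Arguments nV : clear implicits.
Hypothesis cV : compressible nV.
Local Notation C := R[i].
Local Notation nD := (dual_norm nV).
Local Notation nDD := (dual_norm nD).

Definition bidual_mx N j (F : 'M[dual nD]_j) (f : 'M[dual nV]_N) : 'M['M[C]_N]_j :=
  \matrix_(i, l) \matrix_(a, b) F i l (f a b).

(** The shuffle of M_N(M_j) onto M_j(M_N); on vectors it is transposition. *)
Lemma bidual_formE N j (F : 'M[dual nD]_j) (f : 'M[dual nV]_N) al be :
  form (map_mx (dual_map F) f) al be = form (bidual_mx F f) al^T be^T.
Proof.
rewrite !formE; under eq_bigr do rewrite exchange_big; rewrite exchange_big.
apply: eq_bigr => i _.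
under eq_bigr do rewrite exchange_big; rewrite exchange_big.
by do 3!(apply: eq_bigr => ? _); rewrite !mxE.
Qed.

Lemma bidual_bound N j (F : 'M[dual nD]_j) (f : 'M[dual nV]_N) al be :
  2 * Re (form (bidual_mx F f) al be) <= nDD j F * nD N f * (hs al + hs be).
Proof.
have := dual_norm_bound (dual_compressible cV) F f al^T be^T.
by rewrite bidual_formE !trmxK !hsT.
Qed.

Lemma dual_fun_le (f : dual nV) v :
  Normc.normc (f v) <= vnorm nD f * vnorm nV v.
Proof.
have [u u1 uE] := exists_phase (f v).
have := dual_norm_bound cV (const_mx f : 'M_1) (const_mx v : 'M_1)
  (const_mx u) (const_mx 1).
have -> : form (map_mx (dual_map (const_mx f : 'M_1)) (const_mx v : 'M_1))
    (const_mx u) (const_mx 1) = u * f v.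
  by rewrite formE !big_ord1 !mxE rmorph1 mul1r mulrC.
rewrite uE /= /hs !big_ord1 !mxE u1 Normc.normc1 expr1n -/(vnorm _ _).
by rewrite -/(vnorm _ _); lra.
Qed.

Lemma evaluation_bounded v :
  (fun f : dual nV => f v : C^o) \in bounded_functional nD.
Proof.
rewrite inE; split=> //; exists (vnorm nV v) => f.
by rewrite mulrC dual_fun_le.
Qed.

Definition evaluation v : dual nD := Dual (evaluation_bounded v).

Lemma evaluation_linear : linear evaluation.
Proof.
move=> c u v; apply: val_inj; apply/funext => f /=.
by rewrite linearP.
Qed.

HB.instance Definition _ :=
  GRing.isLinear.Build C V (dual nD) *:%R evaluation evaluation_linear.

Lemma evaluation_norm_le j (x : 'M[V]_j) : nDD j (map_mx evaluation x) <= nV j x.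
Proof.
apply: (dual_norm_le (dual_compressible cV)); first exact: compressible_ge0.
move=> N f al be; rewrite bidual_formE.
have -> : bidual_mx (map_mx evaluation x) f = map_mx (dual_map f) x.
  by apply/matrixP => i l; apply/matrixP => a b; rewrite !mxE.
apply: le_trans (dual_norm_bound cV _ _ _ _) _.
by rewrite !hsT mulrAC [nV _ _ * _]mulrC mulrAC.
Qed.

End Bidual.

(** * Quadratic forms of one matrix; dominated maps and their factorization *)

Section UnitMatrix.
Variables (R : realType).
Local Notation C := R[i].

Definition unit_mx (M : zmodType) (g : M) j : 'M[M]_j :=
  \matrix_(i, l) (g *+ (i == l)).

Lemma map_unit_mx (M M' : zmodType) (f : {additive M -> M'}) g j :
  map_mx f (unit_mx g j) = unit_mx (f g) j.
Proof. by apply/matrixP => i l; rewrite !mxE raddfMn. Qed.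

Lemma form_unitE N j (G : 'M[C]_N) (al be : 'M[C]_(j, N)) :
  form (unit_mx G j) al be = \tr (mxconj be *m G *m al^T).
Proof.
rewrite /form /mxtrace; apply: eq_bigr => i _.
rewrite (bigD1 i) //= big1 ?addr0 => [|l li].
  by rewrite [X in _ *m X *m _]mxE eqxx mulr1n.
by rewrite [X in _ *m X *m _]mxE eq_sym (negPf li) mulr0n mulmx0 mul0mx mxE.
Qed.

Lemma form_unit1 N j (al be : 'M[C]_(j, N)) :
  form (unit_mx 1%:M j) al be = mxip al be.
Proof. by rewrite form_unitE mulmx1. Qed.

Lemma form_unitZ N j c (G : 'M[C]_N) (al be : 'M[C]_(j, N)) :
  form (unit_mx (c *: G) j) al be = c * form (unit_mx G j) al be.
Proof. by rewrite !form_unitE -scalemxAr -scalemxAl mxtraceZ. Qed.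

Definition qform N j (G : 'M[C]_N) (al : 'M[C]_(j, N)) : R :=
  Re (form (unit_mx G j) al al).

Lemma qformZ N j (G : 'M[C]_N) c (al : 'M[C]_(j, N)) :
  qform G (c *: al) = Normc.normc c ^+ 2 * qform G al.
Proof.
by rewrite /qform formZl formZr mulrA [c * _]mulrC -normc_conjM ReMr.
Qed.

Lemma qform1 N j (al : 'M[C]_(j, N)) : qform 1%:M al = hs al.
Proof. by rewrite /qform form_unit1 mxip_hs. Qed.

Lemma map_unit_conj_by N' N j (Y : 'M[C]_(N', N)) G :
  map_mx (mxconj_by Y) (unit_mx G j) = unit_mx (mxconj_by Y G) j.
Proof.
apply/matrixP => i l; rewrite !mxE; case: eqP => // _.
by rewrite !mulr0n /mxconj_by mulmx0 mul0mx.
Qed.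

Lemma qform_conj_by N' N j (Y : 'M[C]_(N', N)) G (al : 'M[C]_(j, N')) :
  qform (mxconj_by Y G) al = qform G (al *m Y).
Proof. by rewrite /qform -form_conj_by map_unit_conj_by. Qed.

Lemma qformD N j (G H : 'M[C]_N) (al : 'M[C]_(j, N)) :
  qform (G + H) al = qform G al + qform H al.
Proof. by rewrite /qform !form_unitE mulmxDr mulmxDl mxtraceD ReD. Qed.

Lemma qform_row N j (G : 'M[C]_N) (al : 'M[C]_(j, N)) :
  qform G al = \sum_i qform G (row i al).
Proof.
rewrite /qform form_unitE /mxtrace raddf_sum; apply: eq_bigr => i _.
rewrite form_unitE /mxtrace big_ord1 !form_entryE.
by congr Re; do 2!(apply: eq_bigr => ? _); rewrite !mxE.
Qed.

Lemma formBB N j (X : 'M['M[C]_N]_j) al be : form X (al - be) (al - be) =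
  form X al al + form X be be - form X al be - form X be al.
Proof.
rewrite formDl 2!formDr 2!formNl 2!formNr opprK.
by move: (form X _ _) (form X _ _) (form X _ _) (form X _ _) => p q r s; ring.
Qed.

Lemma qformB N j (G : 'M[C]_N) (al be : 'M[C]_(j, N)) : qform G (al - be) =
  qform G al + qform G be - Re (form (unit_mx G j) al be)
   - Re (form (unit_mx G j) be al).
Proof. by rewrite /qform formBB 2!raddfB raddfD. Qed.

Lemma qformB_sym N j (G : 'M[C]_N) (al be : 'M[C]_(j, N)) :
  Re (form (unit_mx G j) al be) = Re (form (unit_mx G j) be al) ->
  qform G (al - be) =
  qform G al + qform G be - 2 * Re (form (unit_mx G j) al be).
Proof.
move=> sym; rewrite [LHS]qformB -sym.
by move: (Re (form _ al be)) (qform G al) (qform G be) => p q r; lra.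
Qed.

Lemma qform_col_mx N j G (al be : 'M[C]_(j, N)) :
  qform G (col_mx al be) = qform G al + qform G be.
Proof.
rewrite [LHS]qform_row [qform G al]qform_row [qform G be]qform_row big_split_ord.
have -> : \sum_(i < j) qform G (row (lshift j i) (col_mx al be)) =
    \sum_(i < j) qform G (row i al) by apply: eq_bigr => i _; rewrite rowKu.
by congr (_ + _); apply: eq_bigr => i _; rewrite rowKd.
Qed.

(** If [z] were not 0, a large multiple of the [u] with [u * z = |z|] would exceed any bound. *)
Lemma eq0_of_Re_le (z : C) K : (forall c, 2 * Re (c * z) <= K) -> z = 0.
Proof.
move=> H; have [u u1 uE] := exists_phase z.
apply: Normc.eq0_normc; apply/eqP; rewrite eq_le normc_ge0 andbT.
rewrite leNgt; apply/negP => z0.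
have := H (((`|K| + 1) / Normc.normc z)%:C * u).
rewrite -mulrA uE -rmorphM /= divfK ?gt_eqF //.
have := ler_norm K; have := normr_ge0 K; lra.
Qed.

End UnitMatrix.

Section Dominated.
Variables (R : realType) (V : lmodType R[i]) (nV : mxnorm V) (v : V).
Arguments nV : clear implicits.
Local Notation C := R[i].

(* For linear [f] and [v] of norm at most 1, this means [f x = B^* g(x) B] for a
   matrix state [g] at [v] ([dominated_factor]); unlike matrix states, such
   maps are closed under means. *)
Definition dominated N (f : V -> 'M[C]_N) : Prop :=
  forall j (x : 'M[V]_j) al be,
    2 * Re (form (map_mx f x) al be) <= nV j x * (qform (f v) al + qform (f v) be).

Definition unital_norm :=
  forall j (c : C), Normc.normc c = 1 -> nV j (unit_mx (c *: v) j) <= 1.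

Hypothesis cV : compressible nV.
Hypothesis v1 : unital_norm.
Variables (N : nat) (f : {linear V -> 'M[C]_N}).
Hypothesis fdom : dominated f.

Let G := f v.

(** Let [z] be the form at [al], [al]. Domination at the diagonal matrix of [u v], with [|u| = 1],
    bounds [Re (u z)] by [Re z] times a number in [0, 1]. The case [u = - 1] gives [Re z >= 0], and
    then all [u] together give [Im z = 0]. *)
Lemma dominated_qform_real j (al : 'M[C]_(j, N)) :
  Im (form (unit_mx G j) al al) = 0 /\ 0 <= qform G al.
Proof.
have le u : Normc.normc u = 1 -> Re (u * form (unit_mx G j) al al) <=
    nV j (unit_mx (u *: v) j) * qform G al.
  move=> _; have := fdom (unit_mx (u *: v) j) al al.
  by rewrite map_unit_mx /= linearZ /= form_unitZ -/G; lra.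
have n1 u : Normc.normc u = 1 -> 0 <= nV j (unit_mx (u *: v) j) <= 1.
  by move=> u1; rewrite compressible_ge0 ?v1.
have N11 : Normc.normc (-1) = 1 :> R.
  by rewrite -(rmorph1 (real_complex R)) -rmorphN normc_real normrN1.
have q0 : 0 <= qform G al.
  have := le (-1) N11; have := n1 _ N11; rewrite mulN1r ReN -/(qform G al).
  by move=> /andP[]; nra.
split=> //; apply: (proj1 (Im0_of_phase _)) => u u1; apply: le_trans (le u u1) _.
have /andP[_ h] := n1 u u1.
by rewrite -/(qform G al) ler_piMl.
Qed.

Lemma dominated_herm : (mxconj G)^T = G.
Proof.
have sym := form_real_sym (fun al => proj1 (@dominated_qform_real 1 al)).
have entry a b : form (unit_mx G 1) (delta_mx 0 b) (delta_mx 0 a) = G a b.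
  by rewrite form_delta mxE eqxx.
apply/matrixP => a b; rewrite !mxE.
have := sym (delta_mx 0 b) (delta_mx 0 a).
have := sym ('i *: delta_mx 0 b) (delta_mx 0 a).
rewrite formZl formZr !entry.
case: (G a b) => x y; case: (G b a) => z t; rewrite /Num.conj /= => h1 h2.
by congr (_ +i* _); lra.
Qed.

(** When [qform G al = 0], scaling [al] leaves the dominating side fixed, so the side that scales
    must vanish. Null vectors of [f v] are null for every [f x]. *)
Lemma dominated_nulll j (x : 'M[V]_j) al be :
  qform G al = 0 -> form (map_mx f x) al be = 0.
Proof.
move=> q0; apply: (@eq0_of_Re_le _ _ (nV j x * qform G be)) => c.
rewrite -formZl; apply: le_trans (fdom _ _ _) _.
by rewrite -/G qformZ q0 mulr0 add0r.
Qed.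

Lemma dominated_nullr j (x : 'M[V]_j) al be :
  qform G be = 0 -> form (map_mx f x) al be = 0.
Proof.
move=> q0; apply: (@eq0_of_Re_le _ _ (nV j x * qform G al)) => c.
rewrite -[c]conjCK -formZr; apply: le_trans (fdom _ _ _) _.
by rewrite -/G qformZ q0 mulr0 addr0.
Qed.

Let orthonormal m (A : 'M[C]_(m, N)) := mxconj_by A G = 1%:M.

(** The row [z *m coords A] lists the [G]-inner products of [z] with the rows of [A]. *)
Let coords m (A : 'M[C]_(m, N)) := G^T *m (mxconj A)^T.

Lemma orthonormal_size m (A : 'M[C]_(m, N)) : orthonormal A -> (m <= N)%N.
Proof.
move=> oA; rewrite -[m](mxrank1 C) -oA /mxconj_by.
by apply: leq_trans (mxrankM_maxr _ _) _; rewrite mxrank_tr rank_leq_col.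
Qed.

(** A Gram-Schmidt step: [w] is the component of [z] orthogonal to the rows of [A] for the form of
    [G]; normalized, it becomes a new row. *)
Lemma orthonormal_extend m (A : 'M[C]_(m, N)) (z : 'rV[C]_N) : orthonormal A ->
  qform G (z - z *m coords A *m A) != 0 ->
  exists A' : 'M[C]_(m + 1, N), orthonormal A'.
Proof.
move=> oA; set w := z - _ => w0.
have qw : 0 < qform G w by rewrite lt_def w0; case: (dominated_qform_real w).
pose s := Num.sqrt (qform G w).
have s0 : 0 < s by rewrite sqrtr_gt0.
have Aw : mxconj A *m G *m w^T = 0.
  rewrite /w linearB /= !trmx_mul mulmxBr !trmxK !mulmxA.
  rewrite -[X in _ - X *m _ *m _]/(mxconj_by A G *m mxconj A).
  by rewrite [mxconj_by A G]oA mul1mx subrr.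
have wA : mxconj w *m G *m A^T = 0.
  have /(congr1 (fun M => (mxconj M)^T)) := Aw.
  rewrite map_mx0 trmx0 => <-; rewrite !map_mxM !trmx_mul dominated_herm.
  rewrite map_trmx trmxK mulmxA; congr (_ *m _ *m _^T).
  by apply/matrixP => i j; rewrite !mxE /= conjCK.
exists (col_mx A (s^-1%:C *: w)); rewrite /orthonormal /mxconj_by.
rewrite map_col_mx tr_col_mx mul_col_mx mul_col_row.
rewrite -[mxconj A *m G *m A^T]/(mxconj_by A G) oA.
rewrite map_mxZ linearZ /= -!scalemxAl -!scalemxAr Aw wA !scaler0.
rewrite scalar_mx_block; congr block_mx.
apply/matrixP => i j; rewrite !ord1 mxE [in RHS]mxE mxE conj_real.
have [im _] := dominated_qform_real w.
have : form (unit_mx G 1) w w = (qform G w)%:C.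
  by rewrite /qform; case: (form _ _ _) im => a b /= ->.
rewrite form_unitE /mxtrace big_ord1 => ->.
rewrite -!rmorphM /= mulrA -expr2 exprVn sqr_sqrtr ?ltW // mulVf ?gt_eqF //.
Qed.

(** An orthonormal family has at most [N] rows, so the extension stops; [d] counts the rows that
    remain possible. The residue of every vector is then null for [G]. *)
Lemma orthonormal_complete :
  exists m, exists2 A : 'M[C]_(m, N), orthonormal A &
      forall j (al : 'M[C]_(j, N)), qform G (al - al *m coords A *m A) = 0.
Proof.
suff H d m (A : 'M[C]_(m, N)) : (N <= m + d)%N -> orthonormal A ->
    exists m, exists2 A : 'M[C]_(m, N), orthonormal A &
      forall z : 'rV[C]_N, qform G (z - z *m coords A *m A) = 0.
  have [||m [A oA cA]] := H N 0%N 0; rewrite ?add0n //.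
    by apply/matrixP => -[].
  exists m, A => // j al; rewrite qform_row big1 // => i _.
  by rewrite linearB /= !row_mul cA.
elim: d m A => [|d IH] m A mN oA.
  exists m, A => // z; apply/eqP; apply: contraT => z0.
  have [A' /orthonormal_size] := orthonormal_extend oA z0.
  by move: mN; rewrite addn0 addn1 => mN lt; have := leq_trans lt mN; rewrite ltnn.
have [cA|] := pselect (forall z : 'rV[C]_N, qform G (z - z *m coords A *m A) = 0).
  by exists m, A.
move=> /existsNP[z /eqP z0]; have [A' oA'] := orthonormal_extend oA z0.
by apply: IH oA'; rewrite addn1 addSnnS.
Qed.

(* [A] is a maximal orthonormal family of vectors for the form [f v], [B]
   gives the coordinates in it. *)
Lemma dominated_factor : exists m (A : 'M[C]_(m, N)) (B : 'M[C]_(N, m)),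
  [/\ mxconj_by A (f v) = 1%:M,
      cb_bound nV (mxconj_by A \o f) 1,
      forall j (x : 'M[V]_j) al be, form (map_mx f x) al be =
        form (map_mx (mxconj_by A \o f) x) (al *m B) (be *m B) &
      forall j (al : 'M[C]_(j, N)), qform (f v) al = hs (al *m B)].
Proof.
have [m [A oA cA]] := orthonormal_complete.
exists m, A, (coords A); rewrite -/G.
have fE j (x : 'M[V]_j) al be : form (map_mx f x) al be =
    form (map_mx (mxconj_by A \o f) x) (al *m coords A) (be *m coords A).
  rewrite map_mx_comp form_conj_by.
  (* The residue of [al] is null for [G], hence for [f]; only the projection onto the rows of [A]
     contributes. *)
  rewrite -{1}[al](subrK (al *m coords A *m A)) formDl dominated_nulll // add0r.
  by rewrite -{1}[be](subrK (be *m coords A *m A)) formDr dominated_nullr // add0r.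
split=> // [j x al be|j al].
  rewrite map_mx_comp form_conj_by mul1r; apply: le_trans (fdom _ _ _) _.
  by rewrite -/G -!qform_conj_by oA !qform1.
rewrite /qform -map_unit_mx fE map_mx_comp map_unit_mx map_unit_conj_by.
by rewrite -/G oA form_unit1 mxip_hs.
Qed.

End Dominated.

Local Opaque form.

Section ConjByLinear.
Variables (R : realType) (N' N : nat) (Y : 'M[R[i]]_(N', N)).
Lemma mxconj_by_linear : linear (mxconj_by Y).
Proof.
move=> c A B; rewrite /mxconj_by mulmxDr mulmxDl -scalemxAr -scalemxAl.
by [].
Qed.
HB.instance Definition _ := GRing.isLinear.Build _ _ _ _ (mxconj_by Y) mxconj_by_linear.
End ConjByLinear.

(** * Operator spaces and their quotients *)

Section OperatorSpace.
Variables (R : realType) (V : lmodType R[i]) (nV : mxnorm V).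
Arguments nV : clear implicits.
Hypothesis oV : operator_space nV.
Local Notation C := R[i].

Let mV : matricially_normed nV. Proof. by case: oV. Qed.

Lemma unit_mx_norm_le (u : V) j : nV j (unit_mx u j) <= vnorm nV u.
Proof.
have v0 : 0 <= vnorm nV u by exact: matricial_norm_ge0.
elim: j => [|j IH].
  by rewrite (_ : unit_mx u 0 = 0) ?matricial_norm0 // flatmx0.
have [_ nS] := oV; have := nS 1%N j (const_mx u) (unit_mx u j).
rewrite -/(vnorm nV u) [RHS]max_l // => <-.
rewrite (_ : block_mx _ _ _ _ = unit_mx u (1 + j)) //.
apply/matrixP => i l.
case: (split_ordP i) => i' ->; case: (split_ordP l) => l' ->.
- by rewrite block_mxEul !mxE eq_lshift !ord1 eqxx.
- by rewrite block_mxEur !mxE eq_lrshift.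
- by rewrite block_mxEdl !mxE eq_rlshift.
- by rewrite block_mxEdr !mxE eq_rshift.
Qed.

Lemma operator_space_unital (v : V) : vnorm nV v <= 1 -> unital_norm nV v.
Proof.
move=> v1 j c c1; apply: le_trans (unit_mx_norm_le _ _) _.
rewrite /vnorm (_ : const_mx (c *: v) = map_mx ( *:%R c) (const_mx v)).
  by have [_ -> _ _] := mV; rewrite c1 mul1r.
by apply/matrixP => i l; rewrite !mxE.
Qed.

(** The block permutation [S] is a contraction and turns the antidiagonal matrix into a direct
    sum. *)
Lemma antidiag_norm_le j (x y : 'M[V]_j) :
  nV (j + j)%N (block_mx 0 x y 0) <= Num.max (nV j x) (nV j y).
Proof.
have [_ nS] := oV; rewrite maxC -nS.
pose S : 'M[C]_(j + j) := block_mx 0 1%:M 1%:M 0.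
have -> : block_mx 0 x y 0 = bimodmx S (block_mx y 0 0 x) 1%:M.
  have bim1 i l (X : 'M[V]_(j + j)) :
      bimodmx S X 1%:M i l = \sum_k S i k *: X k l.
    rewrite mxE; apply: eq_bigr => k _; rewrite (bigD1 l) //= big1 => [|l' ll'].
      by rewrite [1%:M _ _]mxE eqxx mulr1 addr0.
    by rewrite [1%:M _ _]mxE (negPf ll') mulr0 scale0r.
  apply/matrixP => i l; rewrite bim1 big_split_ord /=.
  case: (split_ordP i) => i' ->.
    rewrite big1 ?add0r => [|k _]; last by rewrite block_mxEul mxE scale0r.
    rewrite (bigD1 i') //= [X in _ + X]big1 => [|k ki]; last first.
      by rewrite block_mxEur [1%:M _ _]mxE eq_sym (negPf ki) scale0r.
    rewrite addr0 [S _ _]block_mxEur [1%:M _ _]mxE eqxx scale1r.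
    by case: (split_ordP l) => l' ->; rewrite ?block_mxEul ?block_mxEur
      ?block_mxEdl ?block_mxEdr.
  rewrite [X in _ + X]big1 ?addr0 => [|k _]; last by rewrite block_mxEdr mxE scale0r.
  rewrite (bigD1 i') //= [X in _ + X]big1 => [|k ki]; last first.
    by rewrite block_mxEdl [1%:M _ _]mxE eq_sym (negPf ki) scale0r.
  rewrite addr0 [S _ _]block_mxEdl [1%:M _ _]mxE eqxx scale1r.
  by case: (split_ordP l) => l' ->; rewrite ?block_mxEul ?block_mxEur
    ?block_mxEdl ?block_mxEdr.
apply: matricial_norm_bimod => //; apply: opnorm_le1 => z; last by rewrite mul1mx.
rewrite -[z]vsubmxK /S (mul_block_col 0) !mul0mx !mul1mx add0r addr0.
by rewrite !hs_col_mx addrC.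
Qed.

End OperatorSpace.

Section QuotientNorm.
Variables (R : realType) (V : lmodType R[i]) (nV : mxnorm V) (W : submodClosed V).
Arguments nV : clear implicits.
Hypothesis mV : matricially_normed nV.
Local Notation C := R[i].
Local Notation Q := (quot_map W).
Local Notation nQ := (quot_norm W nV).

Lemma quot_lift k (y : 'M[quot_space W]_k) : exists x, map_mx Q x = y.
Proof.
exists (map_mx repr y); apply/matrixP => i j; rewrite !mxE.
exact: quot_map_repr.
Qed.

Lemma quot_norm_lb k (y : 'M[quot_space W]_k) :
  has_lbound [set nV k x | x in [set x | map_mx Q x = y]].
Proof. by exists 0 => _ [x _ <-]; exact: matricial_norm_ge0. Qed.

Lemma quot_norm_le k x : nQ k (map_mx Q x) <= nV k x.
Proof. by apply: ge_inf; [exact: quot_norm_lb|exists x]. Qed.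

Lemma le_quot_norm k y r :
  (forall x, map_mx Q x = y -> r <= nV k x) -> r <= nQ k y.
Proof.
move=> H; apply: lb_le_inf; last by move=> _ [x /= xy <-]; exact: H.
by have [x xy] := quot_lift y; exists (nV k x), x.
Qed.

Lemma quot_norm_ge0 k y : 0 <= nQ k y.
Proof. by apply: le_quot_norm => x _; exact: matricial_norm_ge0. Qed.

Lemma quot_norm_mul k y z K : 0 <= K ->
  (forall x, map_mx Q x = y -> z <= nV k x * K) -> z <= nQ k y * K.
Proof.
rewrite le_eqVlt => /orP[/eqP<-|K0] H.
  by have [x xy] := quot_lift y; have := H x xy; rewrite !mulr0.
rewrite -ler_pdivrMr //; apply: le_quot_norm => x xy.
by rewrite ler_pdivrMr // H.
Qed.

Lemma quot_map_bimod m n (a : 'M[C]_(n, m)) x (b : 'M[C]_(m, n)) :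
  map_mx Q (bimodmx a x b) = bimodmx a (map_mx Q x) b.
Proof.
apply/matrixP => i j; rewrite !mxE linear_sum; apply: eq_bigr => k _.
by rewrite linear_sum; apply: eq_bigr => l _; rewrite mxE linearZ.
Qed.

Lemma entry_norm_le k (x : 'M[V]_k) i l : vnorm nV (x i l) <= nV k x.
Proof.
have [_ _ nC] := matricially_normed_compressible mV.
have -> : x i l = compress x (delta_mx l 0) (delta_mx i 0).
  rewrite /compress (bigD1 i) //= [X in _ + X]big1 => [|i' ni]; last first.
    by apply: big1 => l' _; rewrite !mxE (negPf ni) rmorph0 mul0r scale0r.
  rewrite addr0 (bigD1 l) //= big1 => [|l' nl]; last first.
    by rewrite !mxE (negPf nl) mulr0 scale0r.
  by rewrite addr0 !mxE !eqxx rmorph1 mulr1 scale1r.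
by apply: nC; rewrite hs_delta.
Qed.

Lemma quot_matricially_normed : norm_closed nV [set` W] -> matricially_normed nQ.
Proof.
have [nD nZ _ nB] := mV => Wcl; split.
- move=> k y z; rewrite -lerBlDr; apply: le_quot_norm => x xy.
  rewrite lerBlDr -lerBlDl; apply: le_quot_norm => x' xz; rewrite lerBlDl.
  apply: le_trans (nD _ _ _).
  by rewrite -xy -xz -raddfD /= quot_norm_le.
- move=> k c y.
  have le d z : nQ k (map_mx ( *:%R d) z) <= Normc.normc d * nQ k z.
    rewrite mulrC; apply: quot_norm_mul; first exact: normc_ge0.
    move=> x <-; rewrite mulrC -nZ.
    rewrite (_ : map_mx _ (map_mx _ _) = map_mx Q (map_mx ( *:%R d) x)).
      exact: quot_norm_le.
    by apply/matrixP => i j; rewrite !mxE linearZ.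
  apply/eqP; rewrite eq_le le /=; have [->|c0] := eqVneq c 0.
    by rewrite Normc.normc0 mul0r quot_norm_ge0.
  have n0 : 0 < Normc.normc c.
    by rewrite lt_def normc_ge0 andbT; apply: contraNN c0 => /eqP/Normc.eq0_normc ->.
  have := le c^-1 (map_mx ( *:%R c) y); rewrite Normc.normcV ler_pdivlMl //.
  rewrite (_ : map_mx _ (map_mx _ _) = y) //.
  by apply/matrixP => i j; rewrite !mxE scalerA mulVf // scale1r.
(* A [y] of norm 0 has lifts of arbitrarily small norm, so every entry of a given lift is a limit of
   elements of [W], and [W] is closed. *)
- move=> k y y0; have [x xy] := quot_lift y; rewrite -xy.
  apply/matrixP => i l; rewrite !mxE -[0](linear0 Q).
  apply/quot_mapP; rewrite subr0; apply: (Wcl (x i l)) => e e0.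
  have [_ [x' /= x'y <-]] : exists2 r, [set nV k x | x in [set x | map_mx Q x = y]] r &
      r < nQ k y + e.
    by apply: inf_adherent => //; split; [exists (nV k x), x|exact: quot_norm_lb].
  rewrite y0 add0r => x'e; exists (x i l - x' i l).
    have /matrixP/(_ i l) : map_mx Q x = map_mx Q x' by rewrite xy x'y.
    by rewrite !mxE => /quot_mapP.
  by rewrite opprB addrCA subrr addr0; apply: le_lt_trans (entry_norm_le _ _ _) x'e.
- move=> m n a y b; rewrite -mulrA mulrCA; apply: quot_norm_mul.
    by rewrite mulr_ge0 ?opnorm_ge0.
  move=> x <-; rewrite -quot_map_bimod; apply: le_trans (quot_norm_le _) _.
  by apply: le_trans (nB _ _ _ _ _) _; rewrite mulrCA mulrA.
Qed.

Lemma quot_unital (v : V) : unital_norm nV v -> unital_norm nQ (Q v).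
Proof.
move=> v1 j c c1; apply: le_trans (v1 j c c1).
rewrite -linearZ -(map_unit_mx Q); exact: quot_norm_le.
Qed.

End QuotientNorm.

(** * Extension to the bidual and splitting along the M-projection *)

Section DualMatrix.
Variables (R : realType) (V : lmodType R[i]) (nV : mxnorm V).
Arguments nV : clear implicits.
Hypothesis cV : compressible nV.
Local Notation C := R[i].
Local Notation nD := (dual_norm nV).
Local Notation nDD := (dual_norm nD).

Lemma cb_bound_entry N (f : {linear V -> 'M[C]_N}) M (a b : 'I_N) x :
  cb_bound nV f M -> Normc.normc (f x a b) <= M * vnorm nV x.
Proof.
move=> fM; have [u u1 uE] := exists_phase (f x a b).
have := fM 1%N (const_mx x) (u *: delta_mx 0 b) (delta_mx 0 a).
rewrite formZl form_delta mxE [const_mx _ _ _]mxE uE hsZ !hs_delta u1 expr1n -/(vnorm nV x) /=.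
by lra.
Qed.

Lemma cb_bound_dual_map N (f : {linear V -> 'M[C]_N}) M : cb_bound nV f M ->
  exists g : 'M[dual nV]_N, dual_map g =1 f.
Proof.
move=> fM.
have P a b : (fun x => f x a b : C^o) \in bounded_functional nV.
  rewrite inE; split; first by move=> c x y; rewrite linearP !mxE.
  by exists M => x; exact: cb_bound_entry.
exists (\matrix_(a, b) Dual (P a b)) => x.
by apply/matrixP => a b; rewrite !mxE.
Qed.

(** In the factorization of [f] through [B], the inner map is completely contractive, hence given by
    a matrix [p] of functionals of norm at most 1, on which [F] acts with norm at most that of [F].
    Conjugating by [B] restores the quadratic forms of [f v]. *)
Lemma dominated_bidual (v : V) N (f : {linear V -> 'M[C]_N}) :
  unital_norm nV v -> dominated nV v f ->
  exists2 g : 'M[dual nV]_N, dual_map g =1 f &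
    forall j (F : 'M[dual nD]_j) al be, 2 * Re (form (bidual_mx F g) al be) <=
      nDD j F * (qform (f v) al + qform (f v) be).
Proof.
move=> v1 fdom; have [m [A [B [_ cbA fE qE]]]] := dominated_factor cV v1 fdom.
pose h : {linear V -> 'M[C]_m} := mxconj_by A \o f.
have [p pE] := @cb_bound_dual_map m h _ cbA.
exists (\matrix_(a, b) \sum_c \sum_d (Num.conj (B a c) * B b d) *: p c d).
  move=> x; apply/matrixP => a b; rewrite !mxE dual_fun_sum.
  have := fE 1%N (const_mx x) (delta_mx 0 b) (delta_mx 0 a).
  rewrite -form_conj_by !map_const_mx !form_delta ![const_mx _ _ _]mxE.
  rewrite -[(_ \o _) x]/(h x) -pE mxconj_byE => ->.
  apply: eq_bigr => c _; rewrite dual_fun_sum; apply: eq_bigr => d _.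
  by rewrite mxE.
move=> j F al be; set g := \matrix_(a, b) _.
have -> : bidual_mx F g = map_mx (mxconj_by B) (bidual_mx F p).
  apply/matrixP => i l; apply/matrixP => a b.
  rewrite [map_mx _ _ i l]mxE mxconj_byE !mxE linear_sum.
  apply: eq_bigr => c _; rewrite linear_sum; apply: eq_bigr => d _.
  by rewrite linearZ !mxE.
rewrite form_conj_by !qE; apply: le_trans (bidual_bound cV _ _ _ _) _.
rewrite ler_wpM2r ?addr_ge0 ?hs_ge0 // ler_piMr //.
  by rewrite (dual_norm_ge0 (dual_compressible cV)).
apply: (dual_norm_le cV ler01) => i x al' be'.
by rewrite (eq_map_mx _ pE); exact: cbA.
Qed.

End DualMatrix.

Lemma M_projection_max (R : realType) (X : lmodType R[i]) (nX : mxnorm X)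
    (P : {linear X -> X}) j (F G : 'M[X]_j) : complete_M_projection nX P ->
  nX j (map_mx P F + (G - map_mx P G)) <= Num.max (nX j F) (nX j G).
Proof.
move=> [PP PMn]; rewrite PMn.
have le1 H : nX j (map_mx P H) <= nX j H by rewrite [leRHS]PMn le_max lexx.
have le2 H : nX j (H - map_mx P H) <= nX j H.
  by rewrite [leRHS]PMn le_max lexx orbT.
set H := _ + _.
have PH : map_mx P H = map_mx P F.
  by apply/matrixP => i l; rewrite !mxE linearD linearB /= !PP subrr addr0.
have -> : H - map_mx P H = G - map_mx P G by rewrite PH addrC addKr.
by rewrite PH ge_max !le_max le1 le2 orbT.
Qed.

Lemma le_of_halving (R : realType) (A z D : R) : 0 <= A ->
  (forall n, z <= D + 2^-1 ^+ n * A) -> z <= D.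
Proof.
move=> A0 claim; rewrite leNgt; apply/negP => zD.
have zD0 : 0 < z - D by rewrite subr_gt0.
(* For [n > A / (z - D)], the inequality [2^n > n] pushes the error below [z - D]. *)
have := archi_boundP (divr_ge0 A0 (ltW zD0)); set n := Num.bound _ => lt.
have := claim n; rewrite exprVn => cl.
have : n%:R < 2 ^+ n :> R by rewrite -natrX ltr_nat ltn_expl.
have p0 : 0 < 2 ^+ n :> R by rewrite exprn_gt0.
move: lt cl; rewrite ltr_pdivrMr // -lerBlDl ler_pdivlMl //; nra.
Qed.

Section Halving.
Variables (R : realType) (V : lmodType R[i]) (nV : mxnorm V).
Arguments nV : clear implicits.
Hypothesis oV : operator_space nV.
Local Notation C := R[i].
Variables (v : V) (N : nat) (fA fB : {linear V -> 'M[C]_N}).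
Hypothesis v1 : vnorm nV v <= 1.
Local Notation a := (qform (fA v)).
Local Notation d := (qform (fB v)).
Hypothesis q_ge0 : forall j (al : 'M[C]_(j, N)), 0 <= a al + d al.
Hypothesis parts_bound : forall j (y x : 'M[V]_j) al be,
  nV j y <= 1 -> nV j x <= 1 ->
  2 * Re (form (map_mx fA y) al be) + 2 * Re (form (map_mx fB x) al be) <=
    a al + d al + (a be + d be).

Let unitn j (c : C) : Normc.normc c = 1 -> nV j (unit_mx (c *: v) j) <= 1.
Proof. exact: (operator_space_unital oV v1). Qed.

Let unitn1 j : nV j (unit_mx v j) <= 1.
Proof. by rewrite -[v]scale1r unitn // Normc.normc1. Qed.

(** At [y = u v] and [x = v] the terms of [fB] cancel, which leaves [Re (u z) <= Re z] for the form
    [z] of [fA v]. *)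
Lemma fA_real j (al : 'M[C]_(j, N)) :
  Im (form (unit_mx (fA v) j) al al) = 0 /\ 0 <= a al.
Proof.
apply: Im0_of_phase => u u1.
have := parts_bound al al (unitn j u1) (unitn1 j).
have -> : map_mx fA (unit_mx (u *: v) j) = unit_mx (u *: fA v) j.
  by rewrite map_unit_mx /= linearZ.
rewrite (map_unit_mx fB) form_unitZ /qform.
move: (form (unit_mx (fA v) j) al al) (form (unit_mx (fB v) j) al al) => zA zB.
move: (u * zA) => z le; lra.
Qed.

(** The choice [y = v] subtracts twice the real form of [fA v] at [xi], [eta] from [a xi + a eta];
    as that form is symmetric, the result is [a (xi - eta)], the error term with coefficient 1. *)
Lemma fB_base j (x : 'M[V]_j) xi eta : nV j x <= 1 ->
  2 * Re (form (map_mx fB x) xi eta) <= d xi + d eta + a (xi - eta).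
Proof.
move=> x1; have := parts_bound xi eta (unitn1 j) x1.
rewrite map_unit_mx.
have sym := form_real_sym (fun al => proj1 (fA_real al)).
have := qformB_sym (sym _ xi eta).
move: (form (map_mx fB x) xi eta) (form (unit_mx (fA v) j) xi eta) => z w.
by move: (a xi) (a eta) (d xi) (d eta) (a (xi - eta)) => p q r s t -> le; lra.
Qed.

(* Applying the bound to the matrix [[0, x], [v, 0]] and to vectors with the
   midpoint of [xi] and [eta] as a component halves the error term. *)
Lemma fB_halve e :
  (forall j (x : 'M[V]_j) xi eta, nV j x <= 1 ->
    2 * Re (form (map_mx fB x) xi eta) <=
      d xi + d eta + e * a (xi - eta)) ->
  forall j (x : 'M[V]_j) xi eta, nV j x <= 1 ->
    2 * Re (form (map_mx fB x) xi eta) <=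
      d xi + d eta + e / 2 * a (xi - eta).
Proof.
move=> H j x xi eta x1.
have [m mE Em] : exists2 m, m - eta = (2^-1)%:C *: (xi - eta) &
    xi - m = (2^-1)%:C *: (xi - eta).
  have half : 2^-1%:C + 2^-1%:C = 1 :> C.
    by rewrite -rmorphD /= (_ : 2^-1 + 2^-1 = 1) //; lra.
  exists ((2^-1)%:C *: (xi + eta)).
    rewrite -{2}[eta]scale1r -half scalerDr scalerBr scalerDl.
    by rewrite opprD addrA addrK.
  rewrite -{1}[xi]scale1r -half scalerDr scalerBr scalerDl.
  by rewrite opprD addrA addrK.
have X1 : nV (j + j)%N (block_mx 0 x (unit_mx v j) 0) <= 1.
  by apply: le_trans (antidiag_norm_le oV _ _) _; rewrite ge_max x1 unitn1.
(* Here [x] is paired with [xi], [eta] and [v] with [m], [m]. The latter contributes [2 d m] on both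
   sides and cancels; the two differences are both [(xi - eta) / 2], with total error
   [2 * (e / 4) * a (xi - eta)]. *)
have := H _ _ (col_mx m xi) (col_mx eta m) X1.
rewrite map_block_mx !map_mx0 form_block map_unit_mx.
rewrite opp_col_mx add_col_mx !qform_col_mx mE Em !qformZ normc_real_sq.
have form0 (al be : 'M[C]_(j, N)) : form 0 al be = 0.
  have -> : 0 = unit_mx 0 j :> 'M['M[C]_N]_j.
    by apply/matrixP => i l; rewrite !mxE mul0rn.
  by rewrite form_unitE mulmx0 mul0mx mxtrace0.
have : Re (form (unit_mx (fB v) j) m m) = d m by [].
rewrite !form0; move: (form (map_mx fB x) xi eta) (form _ m m) (d m).
move: (d xi) (d eta) (a (xi - eta)) => p q A z w r <-.
rewrite add0r addr0 ReD => le.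
have : e / 2 * A = e * (2^-1 ^+ 2 * A + 2^-1 ^+ 2 * A) by field.
lra.
Qed.

Lemma fB_bound j (x : 'M[V]_j) xi eta : nV j x <= 1 ->
  2 * Re (form (map_mx fB x) xi eta) <= d xi + d eta.
Proof.
have claim n : forall j (x : 'M[V]_j) xi eta, nV j x <= 1 ->
    2 * Re (form (map_mx fB x) xi eta) <=
      d xi + d eta + 2^-1 ^+ n * a (xi - eta).
  elim: n => [|n IH]; first by move=> *; rewrite expr0 mul1r; exact: fB_base.
  by rewrite exprSr; exact: fB_halve.
move=> x1; have {}claim n := claim n _ _ xi eta x1.
have [_ A0] := fA_real (xi - eta).
exact: le_of_halving A0 claim.
Qed.

End Halving.

Section MIdeal.
Variables (R : realType) (V : lmodType R[i]) (nV : mxnorm V) (W : submodClosed V).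
Arguments nV : clear implicits.
Hypothesis oV : operator_space nV.
Local Notation C := R[i].
Local Notation nD := (dual_norm nV).
Local Notation nDD := (dual_norm nD).
Local Notation Q := (quot_map W).
Local Notation nQ := (quot_norm W nV).

Let mV : matricially_normed nV. Proof. by case: oV. Qed.
Let cV := matricially_normed_compressible mV.

Variable P : {linear dual nD -> dual nD}.
Hypothesis PM : complete_M_projection nDD P.
Hypothesis PW : range P = biannihilator nV [set` W].

Local Notation ev := (evaluation cV).

Lemma M_projection_fix w : w \in W -> P (ev w) = ev w.
Proof.
move=> wW; have : biannihilator nV [set` W] (ev w) by move=> g; exact.
by rewrite -PW => -[F _ <-]; rewrite (proj1 PM).
Qed.

Lemma M_projection_ann F (g : dual nV) : (forall w, w \in W -> g w = 0) -> P F g = 0.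
Proof.
move=> gW; have : biannihilator nV [set` W] (P F) by rewrite -PW; exists F.
by apply => w; exact: gW.
Qed.

Lemma evaluation_M_projection_max j (y x : 'M[V]_j) :
  nDD j (\matrix_(i, l) (P (ev (y i l)) + (ev (x i l) - P (ev (x i l)))))
  <= Num.max (nV j y) (nV j x).
Proof.
have -> : (\matrix_(i, l) (P (ev (y i l)) + (ev (x i l) - P (ev (x i l))))) =
    map_mx P (map_mx ev y) + (map_mx ev x - map_mx P (map_mx ev x)).
  by apply/matrixP => i l; rewrite !mxE.
apply: le_trans (M_projection_max _ _ PM) _.
exact: le_max2 (evaluation_norm_le cV y) (evaluation_norm_le cV x).
Qed.

Variables (v : V) (N : nat) (f : {linear V -> 'M[C]_N}).
Hypothesis v1 : vnorm nV v <= 1.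
Hypothesis fdom : dominated nV v f.
Variable g : 'M[dual nV]_N.
Hypothesis gf : dual_map g =1 f.
Hypothesis gdom : forall j (F : 'M[dual nD]_j) al be,
  2 * Re (form (bidual_mx F g) al be) <=
    nDD j F * (qform (f v) al + qform (f v) be).

Definition ideal_part (x : V) : 'M[C]_N := \matrix_(a, b) P (ev x) (g a b).
Definition coideal_part (x : V) : 'M[C]_N := dual_map g x - ideal_part x.

Lemma ideal_part_linear : linear ideal_part.
Proof. by move=> c x y; apply/matrixP => a b; rewrite !mxE !linearP. Qed.

Lemma coideal_part_linear : linear coideal_part.
Proof.
move=> c x y; rewrite /coideal_part linearP ideal_part_linear.
by rewrite scalerBr opprD addrACA.
Qed.

HB.instance Definition _ := GRing.isLinear.Build C V 'M[C]_N *:%R ideal_part ideal_part_linear.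
HB.instance Definition _ := GRing.isLinear.Build C V 'M[C]_N *:%R coideal_part coideal_part_linear.

Lemma ideal_partD x : ideal_part x + coideal_part x = f x.
Proof.
by rewrite /coideal_part gf addrC subrK.
Qed.

(** Domination on the bidual is applied to [P y + (1 - P) x]: the two parts of [f] are bounded
    jointly at unrelated points [y] and [x]. *)
Lemma parts_bound j (y x : 'M[V]_j) al be : nV j y <= 1 -> nV j x <= 1 ->
  0 <= qform (f v) al + qform (f v) be ->
  2 * Re (form (map_mx ideal_part y) al be) +
    2 * Re (form (map_mx coideal_part x) al be) <= qform (f v) al + qform (f v) be.
Proof.
move=> y1 x1 q0.
pose F := \matrix_(i, l) (P (ev (y i l)) + (ev (x i l) - P (ev (x i l)))).
have E : bidual_mx F g = map_mx ideal_part y + map_mx coideal_part x.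
  by apply/matrixP => i l; apply/matrixP => a b; rewrite !mxE.
have := gdom F al be; rewrite E formD ReD mulrDr => /le_trans; apply.
rewrite ler_piMl //.
have := evaluation_M_projection_max y x; rewrite -/F => /le_trans; apply.
by rewrite ge_max y1.
Qed.

Let q_ge0 j (al : 'M[C]_(j, N)) : 0 <= qform (f v) al.
Proof. by case: (dominated_qform_real cV (operator_space_unital oV v1) fdom al). Qed.

Lemma qform_parts j (al : 'M[C]_(j, N)) :
  qform (f v) al = qform (ideal_part v) al + qform (coideal_part v) al.
Proof. by rewrite -ideal_partD qformD. Qed.

Let bound j (y x : 'M[V]_j) al be : nV j y <= 1 -> nV j x <= 1 ->
  2 * Re (form (map_mx ideal_part y) al be) +
    2 * Re (form (map_mx coideal_part x) al be) <=
  qform (ideal_part v) al + qform (coideal_part v) al +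
    (qform (ideal_part v) be + qform (coideal_part v) be).
Proof.
move=> y1 x1; have := parts_bound y1 x1 (addr_ge0 (q_ge0 al) (q_ge0 be)).
by rewrite (qform_parts al) (qform_parts be).
Qed.

(** Computed on chosen representatives; since [P] fixes [W], their choice does not matter
    ([quot_partE]). *)
Definition quot_part (y : quot_space W) : 'M[C]_N := coideal_part (repr y).

Lemma quot_partE x : quot_part (Q x) = coideal_part x.
Proof.
apply/eqP; rewrite -subr_eq0 -linearB; apply/eqP/matrixP => i l.
rewrite !mxE M_projection_fix ?subrr //.
by apply/quot_mapP; rewrite quot_map_repr.
Qed.

Lemma quot_part_linear : linear quot_part.
Proof.
move=> c y z; rewrite -[y]quot_map_repr -[z]quot_map_repr -linearP !quot_partE.
exact: linearP.
Qed.

HB.instance Definition _ := GRing.isLinear.Build C (quot_space W) 'M[C]_N *:%R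
  quot_part quot_part_linear.

Let fA : {linear V -> 'M[C]_N} := ideal_part.
Let fB : {linear V -> 'M[C]_N} := coideal_part.

Lemma quot_part_dominated : dominated nQ (Q v) quot_part.
Proof.
move=> j y al be; rewrite quot_partE.
have le : forall x : 'M[V]_j, nV j x <= 1 ->
    2 * Re (form (map_mx fB x) al be) <= qform (fB v) al + qform (fB v) be.
  by move=> x; apply: (fB_bound oV (fA := fA) v1 bound).
have q0 : 0 <= qform (fB v) al + qform (fB v) be.
  have := le 0; rewrite matricial_norm0 // => /(_ ler01).
  rewrite (_ : map_mx _ 0 = unit_mx 0 j); last first.
    by apply/matrixP => i l; rewrite mxE [in LHS]mxE (linear0 fB) !mxE mul0rn.
  by rewrite form_unitE mulmx0 mul0mx mxtrace0 mulr0.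
apply: quot_norm_mul => // x <-.
have -> : map_mx quot_part (map_mx Q x) = map_mx fB x.
  by apply/matrixP => i l; rewrite !mxE quot_partE.
rewrite [leRHS]mulrC.
apply: (unit_ball_bound cV (F := fun x => 2 * Re (form (map_mx fB x) al be)) q0 _ le).
by move=> c z c0; rewrite linear_map_mxZ formZ ReMr mulrCA.
Qed.

Lemma quot_part_qform_le j (al : 'M[C]_(j, N)) :
  qform (quot_part (Q v)) al <= qform (f v) al.
Proof.
rewrite quot_partE qform_parts lerDr.
by case: (fA_real oV (fA := fA) (fB := fB) v1 bound al).
Qed.

(** An entry of [f] that vanishes on [W] is in the annihilator of [W], where every functional in the
    range of [P] is 0; its ideal part vanishes. *)
Lemma quot_part_entry p q : (forall w, w \in W -> f w p q = 0) ->
  forall x, quot_part (Q x) p q = f x p q.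
Proof.
move=> fW x; rewrite quot_partE /coideal_part gf !mxE.
have -> : P (ev x) (g p q) = 0.
  by apply: M_projection_ann => w wW; rewrite -(fW w wW) -gf mxE.
by rewrite subr0.
Qed.

End MIdeal.

Lemma M_ideal_dominated (R : realType) (V : lmodType R[i]) (nV : mxnorm V)
    (W : submodClosed V) (v : V) N (f : {linear V -> 'M[R[i]]_N}) :
  operator_space nV -> complete_M_ideal nV W -> vnorm nV v <= 1 ->
  dominated nV v f ->
  exists h : {linear quot_space W -> 'M[R[i]]_N},
    [/\ dominated (quot_norm W nV) (quot_map W v) h,
        forall j (al : 'M_(j, N)), qform (h (quot_map W v)) al <= qform (f v) al &
        forall a b, (forall w, w \in W -> f w a b = 0) ->
          forall x, h (quot_map W x) a b = f x a b].
Proof.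
move=> oV [_ [P PM PW]] v1 fdom.
have cV := matricially_normed_compressible (proj1 oV).
have [g gf gdom] := dominated_bidual cV (operator_space_unital oV v1) fdom.
exists (quot_part oV P g); split.
- by move=> j x al be; exact: (quot_part_dominated oV PM PW v1 fdom gf gdom).
- exact: (quot_part_qform_le oV PM PW v1 fdom gf gdom).
- exact: (quot_part_entry oV PM PW gf).
Unshelve. all: by [].
Qed.

(** * Means of complex functions and of dominated maps *)

Section ComplexMean.
Variables (R : realType) (T : Type) (L : (T -> R) -> R).
Hypothesis mL : mean L.
Local Notation C := R[i].
Implicit Types h : T -> C.

Definition cbounded h := exists M, forall t, Normc.normc (h t) <= M.

Definition cmean h : C := L (fun t => Re (h t)) +i* L (fun t => Im (h t)).

Lemma bounded_Re h : cbounded h -> bounded_fun (fun t => Re (h t)).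
Proof.
move=> [M hM]; exists M => t; apply: le_trans (hM t).
by case: (h t) => a b /=; rewrite -sqrtr_sqr ler_sqrt ?lerDl ?addr_ge0 ?sqr_ge0.
Qed.

Lemma bounded_Im h : cbounded h -> bounded_fun (fun t => Im (h t)).
Proof.
move=> [M hM]; exists M => t; apply: le_trans (hM t).
by case: (h t) => a b /=; rewrite -sqrtr_sqr ler_sqrt ?lerDr ?addr_ge0 ?sqr_ge0.
Qed.

Lemma cboundedD h1 h2 : cbounded h1 -> cbounded h2 ->
  cbounded (fun t => h1 t + h2 t).
Proof.
move=> [M hM] [M' hM']; exists (M + M') => t.
by apply: le_trans (le_normcD _ _) _; rewrite lerD.
Qed.

Lemma cboundedM c h : cbounded h -> cbounded (fun t => c * h t).
Proof.
move=> [M hM]; exists (Normc.normc c * M) => t.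
by rewrite Normc.normcM ler_wpM2l ?normc_ge0.
Qed.

Lemma cmeanD h1 h2 : cbounded h1 -> cbounded h2 ->
  cmean (fun t => h1 t + h2 t) = cmean h1 + cmean h2.
Proof.
move=> b1 b2; rewrite /cmean.
rewrite -[RHS]/((_ + _) +i* (_ + _)).
rewrite -(meanD mL (bounded_Re b1) (bounded_Re b2)).
rewrite -(meanD mL (bounded_Im b1) (bounded_Im b2)); congr (L _ +i* L _).
  by apply/funext => t; case: (h1 t) => ? ?; case: (h2 t).
by apply/funext => t; case: (h1 t) => ? ?; case: (h2 t).
Qed.

Lemma cmeanM c h : cbounded h -> cmean (fun t => c * h t) = c * cmean h.
Proof.
move=> bh; rewrite /cmean; case: c => a b; have bR := bounded_Re bh.
have bI := bounded_Im bh.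
rewrite -[RHS]/((a * _ - b * _) +i* (a * _ + b * _)) -mulNr.
rewrite -!(meanZ mL _ bR) -!(meanZ mL _ bI).
rewrite -(meanD mL (bounded_funZ _ bR) (bounded_funZ _ bI)).
rewrite -(meanD mL (bounded_funZ _ bI) (bounded_funZ _ bR)).
by congr (L _ +i* L _); apply/funext => t; case: (h t) => x y /=; ring.
Qed.

Lemma cmean0 : cmean (fun=> 0) = 0.
Proof. by rewrite /cmean /= !(mean_cst mL). Qed.

Lemma cbounded_sum (I : Type) (r : seq I) (F : I -> T -> C) :
  (forall i, cbounded (F i)) -> cbounded (fun t => \sum_(i <- r) F i t).
Proof.
move=> bF; elim: r => [|i r IH].
  by exists 0 => t; rewrite big_nil Normc.normc0.
have -> : (fun t => \sum_(i <- i :: r) F i t) =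
    (fun t => F i t + \sum_(i <- r) F i t).
  by apply/funext => t; rewrite big_cons.
exact: cboundedD.
Qed.

Lemma cmean_sum (I : Type) (r : seq I) (F : I -> T -> C) :
  (forall i, cbounded (F i)) ->
  cmean (fun t => \sum_(i <- r) F i t) = \sum_(i <- r) cmean (F i).
Proof.
move=> bF; elim: r => [|i r IH].
  rewrite big_nil -[RHS]cmean0; congr cmean.
  by apply/funext => t; rewrite big_nil.
have -> : (fun t => \sum_(i <- i :: r) F i t) =
    (fun t => F i t + \sum_(i <- r) F i t).
  by apply/funext => t; rewrite big_cons.
by rewrite cmeanD // ?big_cons ?IH //; exact: cbounded_sum.
Qed.

End ComplexMean.

Section MeanOfMaps.
Variables (R : realType) (V : lmodType R[i]) (nV : mxnorm V) (v : V).
Arguments nV : clear implicits.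
Local Notation C := R[i].
Variables (N : nat) (T : Type) (F : T -> {linear V -> 'M[C]_N}).
Variables (L : (T -> R) -> R).
Hypothesis mL : mean L.
Hypothesis Fbd : forall u a b, cbounded (fun t => F t u a b).
Hypothesis Fdom : forall t, dominated nV v (F t).

Definition mean_map (u : V) : 'M[C]_N := \matrix_(a, b) cmean L (fun t => F t u a b).

Lemma mean_map_linear : linear mean_map.
Proof.
move=> c x y; apply/matrixP => a b; rewrite !mxE -(cmeanM mL) // -(cmeanD mL) //.
  by congr (cmean L _); apply/funext => t; rewrite linearP !mxE.
exact: cboundedM.
Qed.

HB.instance Definition _ :=
  GRing.isLinear.Build C V 'M[C]_N *:%R mean_map mean_map_linear.

Definition mean_linear : {linear V -> 'M[C]_N} := mean_map.

Lemma form_mean_map j (x : 'M[V]_j) al be :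
  cbounded (fun t => form (map_mx (F t) x) al be) /\
  form (map_mx mean_map x) al be = cmean L (fun t => form (map_mx (F t) x) al be).
Proof.
have bb i l a b : cbounded (fun t => Num.conj (be i a) * al l b * F t (x i l) a b).
  exact: cboundedM.
have formF t : form (map_mx (F t) x) al be = \sum_i \sum_l \sum_a \sum_b
    Num.conj (be i a) * al l b * F t (x i l) a b.
  by rewrite formE; do 4!(apply: eq_bigr => ? _); rewrite mxE mulrAC.
rewrite (funext formF); split.
  by do 4!(apply: cbounded_sum => ?).
rewrite formE (cmean_sum mL); last by move=> ?; do 3!(apply: cbounded_sum => ?).
apply: eq_bigr => i _.
rewrite (cmean_sum mL); last by move=> ?; do 2!(apply: cbounded_sum => ?).
apply: eq_bigr => l _.
rewrite (cmean_sum mL); last by move=> ?; apply: cbounded_sum => ?.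
apply: eq_bigr => a _; rewrite (cmean_sum mL) //.
by apply: eq_bigr => b _; rewrite (cmeanM mL) // !mxE mulrAC.
Qed.

Lemma Re_form_mean_map j (x : 'M[V]_j) al be :
  Re (form (map_mx mean_map x) al be) = L (fun t => Re (form (map_mx (F t) x) al be)).
Proof. by rewrite (proj2 (form_mean_map x al be)). Qed.

Lemma qform_mean_map j (al : 'M[C]_(j, N)) :
  bounded_fun (fun t => qform (F t v) al) /\
  qform (mean_map v) al = L (fun t => qform (F t v) al).
Proof.
have qE : (fun t => qform (F t v) al) =
    (fun t => Re (form (map_mx (F t) (unit_mx v j)) al al)).
  by apply/funext => t; rewrite map_unit_mx.
rewrite qE; split; first exact: bounded_Re (proj1 (form_mean_map _ _ _)).
by rewrite -Re_form_mean_map map_unit_mx.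
Qed.

Lemma mean_map_dominated : dominated nV v mean_map.
Proof.
move=> j x al be; rewrite Re_form_mean_map.
have [bal ->] := qform_mean_map al; have [bbe ->] := qform_mean_map be.
have bF := bounded_Re (proj1 (form_mean_map x al be)).
rewrite -(meanZ mL) // -(meanD mL) // -(meanZ mL); last exact: bounded_funD.
apply: (mean_le mL) => [||t]; last exact: Fdom.
  exact: bounded_funZ.
by apply: bounded_funZ; exact: bounded_funD.
Qed.

End MeanOfMaps.

(** * Norming maps and their corner values *)

Section Corner.
Variables (R : realType) (V : lmodType R[i]) (k : nat).
Local Notation C := R[i].

(* [form X corner_r corner_l] reads off the upper right k x k corners of the
   entries of [X]. *)
Definition corner_r : 'M[C]_(k, k + k) := row_mx 0 1%:M.
Definition corner_l : 'M[C]_(k, k + k) := row_mx 1%:M 0.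

Lemma form_corner (X : 'M['M[C]_(k + k)]_k) : form X corner_r corner_l =
  \sum_i \sum_l X i l (lshift k i) (rshift k l).
Proof.
rewrite formE; apply: eq_bigr => i _; apply: eq_bigr => l _.
rewrite (bigD1 (lshift k i)) //= [X in _ + X]big1 => [|a na]; last first.
  apply: big1 => b _; case: (split_ordP a) na => a' ->.
    by rewrite eq_lshift row_mxEl mxE eq_sym => /negPf ->; rewrite rmorph0 !mul0r.
  by rewrite row_mxEr mxE rmorph0 !mul0r.
rewrite addr0 (bigD1 (rshift k l)) //= [X in _ + X]big1 => [|b nb]; last first.
  case: (split_ordP b) nb => b' ->.
    by rewrite [X in _ * X]row_mxEl [X in _ * X]mxE mulr0.
  rewrite eq_rshift [X in _ * X]row_mxEr [X in _ * X]mxE eq_sym => /negPf ->.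
  by rewrite mulr0.
rewrite addr0 [X in _ * X]row_mxEr row_mxEl [X in _ * X]mxE eqxx mulr1.
by rewrite [X in Num.conj X]mxE eqxx rmorph1 mul1r.
Qed.

(** The rows of the two corner matrices are together the standard basis, so the right-hand side is
    the real trace of [G], a sum of nonnegative diagonal terms. *)
Lemma qform_corner_ge (G : 'M[C]_(k + k)) (a : 'I_(k + k)) :
  (forall j (al : 'M[C]_(j, k + k)), 0 <= qform G al) ->
  qform G (delta_mx 0 a : 'rV_(k + k)) <= qform G corner_r + qform G corner_l.
Proof.
move=> G0; rewrite (qform_row G corner_r) (qform_row G corner_l).
have rE i : row i corner_r = delta_mx 0 (rshift k i).
  apply/rowP => b; rewrite [row _ _ _ _]mxE [delta_mx _ _ _ _]mxE eqxx /=.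
  case: (split_ordP b) => b' ->.
    by rewrite row_mxEl mxE eq_lrshift.
  by rewrite row_mxEr mxE eq_rshift eq_sym.
have lE i : row i corner_l = delta_mx 0 (lshift k i).
  apply/rowP => b; rewrite [row _ _ _ _]mxE [delta_mx _ _ _ _]mxE eqxx /=.
  case: (split_ordP b) => b' ->.
    by rewrite row_mxEl mxE eq_lshift eq_sym.
  by rewrite row_mxEr mxE eq_rlshift.
have s0 (X : 'M[C]_(k, k + k)) (P : pred 'I_k) : 0 <= \sum_(i | P i) qform G (row i X).
  by apply: sumr_ge0.
case: (split_ordP a) => i ->.
  rewrite [X in _ + X](bigD1 i) //= lE addrCA lerDl.
  by apply: addr_ge0; exact: s0.
rewrite [X in X + _](bigD1 i) //= rE -addrA lerDl.
by apply: addr_ge0; exact: s0.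
Qed.

End Corner.

Section Separation.
Variables (R : realType) (V : lmodType R[i]) (nV : mxnorm V) (v : V).
Arguments nV : clear implicits.
Hypothesis mV : matricially_normed nV.
Hypothesis v1 : unital_norm nV v.
Local Notation C := R[i].
Let cV := matricially_normed_compressible mV.

Variable k : nat.
Local Notation ar := (corner_r R k).
Local Notation al := (corner_l R k).

(* The maps [x |-> B^* g(x) B] with [g] a matrix state at [v] and
   [B = [eta, xi]] of Hilbert-Schmidt norm at most sqrt 2; the corner value at
   [z] is then Re <g_k(z) xi, eta>. *)
Definition norming_map (f : {linear V -> 'M[C]_(k + k)}) :=
  dominated nV v f /\ qform (f v) ar + qform (f v) al <= 2.

Definition corner_value (f : V -> 'M[C]_(k + k)) (z : 'M[V]_k) : R :=
  Re (form (map_mx f z) ar al).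

Lemma corner_valueE f z : corner_value f z = Re (form (map_mx f z) ar al).
Proof. by []. Qed.

Lemma corner_valueD (f : {linear V -> 'M[C]_(k + k)}) z w :
  corner_value f (z + w) = corner_value f z + corner_value f w.
Proof. by rewrite /corner_value map_mxD formD ReD. Qed.

Lemma corner_valueZ (f : {linear V -> 'M[C]_(k + k)}) (r : R) z :
  corner_value f (map_mx ( *:%R r%:C) z) = r * corner_value f z.
Proof. by rewrite /corner_value linear_map_mxZ formZ ReMr. Qed.

Lemma corner_value_le f z : norming_map f -> corner_value f z <= nV k z.
Proof.
move=> [fdom f2]; have := fdom k z ar al.
have := matricial_norm_ge0 mV z; rewrite /corner_value.
move: (Re _) (qform _ ar) (qform _ al) f2 (nV k z) => p q r qr s s0 le.
by have := ler_wpM2l s0 qr; lra.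
Qed.

Lemma corner_value_bounded (T : Type) (F : T -> {linear V -> 'M[C]_(k + k)}) z :
  (forall t, norming_map (F t)) -> bounded_fun (fun t => corner_value (F t) z).
Proof.
move=> Fn; exists (nV k z) => t; rewrite ler_norml corner_value_le // andbT.
have := corner_value_le (map_mx ( *:%R (-1)%:C) z) (Fn t).
have [_ nZ _ _] := mV.
rewrite corner_valueZ nZ normc_real normrN1 mulN1r mul1r => le.
by rewrite lerNl.
Qed.

(** The state is compressed to the rows of [eta] and [xi]; the corner matrices recover these two
    blocks from [Y]. *)
Lemma mxstate_norming n (f : {linear V -> 'M[C]_n}) (xi eta : 'M[C]_(k, n)) :
  cb_bound nV f 1 -> f v = 1%:M -> hs xi + hs eta <= 2 ->
  exists2 h : {linear V -> 'M[C]_(k + k)}, norming_map h &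
    forall z, corner_value h z = Re (form (map_mx f z) xi eta).
Proof.
move=> fb fv le2; pose Y := col_mx eta xi.
have rY : ar *m Y = xi by rewrite mul_row_col mul0mx mul1mx add0r.
have lY : al *m Y = eta by rewrite mul_row_col mul0mx mul1mx addr0.
have qE j (be : 'M[C]_(j, k + k)) : qform (mxconj_by Y (f v)) be = hs (be *m Y).
  by rewrite qform_conj_by fv qform1.
exists (mxconj_by Y \o f); first split.
- move=> j x be ga; rewrite map_mx_comp form_conj_by !qE.
  by apply: le_trans (fb _ _ _ _) _; rewrite mul1r.
- by rewrite /= !qE rY lY.
by move=> z; rewrite /corner_value map_mx_comp form_conj_by rY lY.
Qed.

Lemma zero_norming : exists2 h : {linear V -> 'M[C]_(k + k)}, norming_map h &
  forall z, corner_value h z = 0.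
Proof.
have f0 j (z : 'M[V]_j) (be ga : 'M[C]_(j, k + k)) :
    form (map_mx (\0 : V -> 'M[C]_(k + k)) z) be ga = 0.
  have -> : map_mx (\0 : V -> 'M[C]_(k + k)) z = unit_mx 0 j.
    by apply/matrixP => i l; rewrite !mxE mul0rn.
  by rewrite form_unitE mulmx0 mul0mx mxtrace0.
have q0 j (be : 'M[C]_(j, k + k)) : qform (0 : 'M[C]_(k + k)) be = 0.
  by rewrite /qform form_unitE mulmx0 mul0mx mxtrace0.
exists (\0 : {linear V -> 'M[C]_(k + k)}); last by move=> z; rewrite /corner_value f0.
split; last by rewrite /= !q0 addr0.
by move=> j x be ga; rewrite f0 /= !q0 addr0 !mulr0.
Qed.

Lemma norming_exists (c e : R) (z : 'M[V]_k) : 0 <= c -> 0 < e ->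
  (c%:E <= n_cb nV v)%E ->
  exists2 h : {linear V -> 'M[C]_(k + k)}, norming_map h &
    c * nV k z - e < corner_value h z.
Proof.
move=> c0 e0 cn; have := matricial_norm_ge0 mV z; rewrite le_eqVlt.
move=> /orP[/eqP z0|z0].
  by have [h hn h0] := zero_norming; exists h; rewrite // h0 -z0 mulr0; lra.
pose y := map_mx ( *:%R (nV k z)^-1%:C) z; pose r := c - e / nV k z.
have zy : z = map_mx ( *:%R (nV k z)%:C) y.
  apply/matrixP => i l; rewrite !mxE scalerA -rmorphM /= divff ?gt_eqF //.
  by rewrite scale1r.
have y1 : nV k y = 1.
  by rewrite /y compressibleZ ?invr_gt0 // mulVf ?gt_eqF.
suff [h hn hy] : exists2 h : {linear V -> 'M[C]_(k + k)}, norming_map h &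
    r < corner_value h y.
  exists h; [exact: hn|]; have -> : corner_value h z = nV k z * corner_value h y.
    by rewrite -corner_valueZ -zy.
  rewrite [c * _]mulrC.
  rewrite -(ltr_pM2l z0) in hy; apply: le_lt_trans hy.
  by rewrite /r mulrBr [_ * (e / _)]mulrC divfK ?gt_eqF.
(* A negative target is met by the zero map; from here on [r] can serve as a bound of an operator
   norm. *)
have [r0|r0] := ltP r 0.
  by have [h hn h0] := zero_norming; exists h; rewrite // h0.
have : (r%:E < mxstate_norm nV v y)%E.
  apply: (@lt_le_trans _ _ (n_cb nV v)); last first.
    by apply: ereal_inf_lbound; exists k, y.
  apply: lt_le_trans cn; rewrite lte_fin /r gtrBl divr_gt0 //.
move=> /ereal_sup_gt[_ [n [f [n0 fst ->]]]]; rewrite lte_fin => rf.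
have [fb fv] := (proj1 (mxstate_bound cV v f)) fst.
have [/forallNP H|] := pselect (~ exists xi eta,
    r * (hs xi + hs eta) < 2 * Re (form (map_mx f y) xi eta)).
  have : Mn_norm n k (map_mx f y) <= r.
    apply: Mn_norm_le => // xi eta; rewrite leNgt; apply/negP => lt.
    by apply: (H xi); exists eta.
  by rewrite leNgt rf.
move=> /contrapT[xi [eta lt]]; set s := hs xi + hs eta in lt.
have s_ge0 : 0 <= s by rewrite addr_ge0 ?hs_ge0.
have s0 : 0 < s.
  rewrite lt_def s_ge0 andbT; apply/eqP => s0.
  have xi0 : xi = 0 by apply: hs_eq0; have := hs_ge0 xi; have := hs_ge0 eta; rewrite /s in s0; lra.
  by move: lt; rewrite s0 mulr0 xi0 form0l mulr0 ltxx.
(* This factor brings the total square norm from [s] to 2, the normalization of norming maps. *)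
pose t := Num.sqrt (2 / s).
have tE : t ^+ 2 = 2 / s by rewrite sqr_sqrtr // divr_ge0.
have [|h hn hE] := @mxstate_norming n f (t%:C *: xi) (t%:C *: eta) fb fv.
  by rewrite !hsZ normc_real_sq -mulrDr tE -/s divfK ?gt_eqF.
exists h; [exact: hn|]; rewrite hE formZl formZr conj_real mulrA -rmorphM ReMr -expr2 tE.
by rewrite mulrAC ltr_pdivlMr.
Qed.

End Separation.

Lemma norming_mxstate (R : realType) (V : lmodType R[i]) (nV : mxnorm V) (v : V)
    k (h : {linear V -> 'M[R[i]]_(k + k)}) (c : R) (y : 'M[V]_k) :
  compressible nV -> unital_norm nV v -> norming_map nV v h ->
  0 < c -> c <= corner_value h y ->
  exists n (f : {linear V -> 'M[R[i]]_n}),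
    [/\ (0 < n)%N, mxstate nV v f & c <= Mn_norm n k (map_mx f y)].
Proof.
move=> cV v1 [hdom h2] c0 hc.
have [m [A [B [fv fb fE fq]]]] := dominated_factor cV v1 hdom.
pose f : {linear V -> 'M[R[i]]_m} := mxconj_by A \o h.
have le := Mn_norm_ge_form (map_mx f y) (corner_r R k *m B) (corner_l R k *m B).
rewrite -!fq in le; rewrite corner_valueE fE in hc.
have {}le : c <= Mn_norm m k (map_mx f y).
  have N0 := Mn_norm_ge0 (map_mx f y).
  rewrite -(ler_pM2l (ltr0n _ 2)); apply: le_trans (ler_wpM2l _ hc) _ => //.
  apply: le_trans le _; rewrite mulrC; exact: ler_wpM2r.
exists m, f; split=> //; last by apply/(mxstate_bound cV).
(* In size 0 every form is 0, against the positive corner value. *)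
rewrite lt0n; apply/eqP => m0; move: (hc); subst m.
rewrite [_ *m B]thinmx0 form0l /= => /(lt_le_trans c0).
by rewrite ltxx.
Qed.

Local Opaque corner_value.

(** * Matrix states on the quotient and the numerical index *)

Section QuotientIndex.
Variables (R : realType) (V : lmodType R[i]) (nV : mxnorm V) (W : submodClosed V).
Arguments nV : clear implicits.
Local Notation C := R[i].
Hypothesis oV : operator_space nV.
Hypothesis MW : complete_M_ideal nV W.
Variable v : V.
Hypothesis v1 : vnorm nV v <= 1.
Local Notation Q := (quot_map W).
Local Notation nQ := (quot_norm W nV).

Let mV : matricially_normed nV. Proof. by case: oV. Qed.
Let cV := matricially_normed_compressible mV.
Let u1 := operator_space_unital oV v1.
Let mQ : matricially_normed nQ.
Proof. by apply: quot_matricially_normed => //; case: MW. Qed.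
Let cQ := matricially_normed_compressible mQ.

(** The diagonal entries of [f v] are at most 2, as the corner forms sum to at most 2. The bound is
    uniform in [f], so entries can be averaged over all norming maps. *)
Lemma norming_entry k (f : {linear V -> 'M[C]_(k + k)}) u a b :
  norming_map nV v f -> Normc.normc (f u a b) <= 2 * vnorm nV u.
Proof.
move=> [fdom f2]; have [c c1 cE] := exists_phase (f u a b).
have q0 j (al : 'M[C]_(j, k + k)) : 0 <= qform (f v) al.
  by case: (dominated_qform_real cV u1 fdom al).
have := fdom 1%N (const_mx u) (c *: delta_mx 0 b) (delta_mx 0 a).
rewrite formZl map_const_mx form_delta [const_mx _ _ _]mxE cE qformZ c1 expr1n mul1r.
have qd p : qform (f v) (delta_mx 0 p : 'rV_(k + k)) <= 2.
  exact: le_trans (qform_corner_ge _ q0) f2.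
have := qd a; have := qd b; rewrite -/(vnorm nV u) /=.
have : 0 <= vnorm nV u by exact: matricial_norm_ge0.
move: (vnorm nV u) (qform _ _) (qform _ _) (Normc.normc _) => n p q z n0 hp hq le.
by have := ler_wpM2l n0 (lerD hp hq); lra.
Qed.

Lemma quot_norming_exists k (c : R) (y : 'M[quot_space W]_k) :
  0 <= c -> (c%:E <= n_cb nV v)%E -> nQ k y = 1 ->
  exists2 h : {linear quot_space W -> 'M[C]_(k + k)}, norming_map nQ (Q v) h &
    c <= corner_value h y.
Proof.
move=> c0 cn y1; have [x xy] := quot_lift y.
pose T := {f : {linear V -> 'M[C]_(k + k)} | norming_map nV v f}.
pose F (t : T) := sval t; have Fn t : norming_map nV v (F t) := proj2_sig t.
pose Z := [set w : 'M[V]_k | forall i l, w i l \in W].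
pose pt (r : R) w : 'M[V]_k := map_mx ( *:%R r%:C) x + w.
(* Nonnegativity of the mean on [G] says that the averaged corner value is at least [r c] at every
   [r x + w] with [w] over [W]. Since [(r, w)] runs over a vector space, [G] is closed under sums
   and positive multiples. *)
pose G := [set g : T -> R | exists r w, Z w /\
  g = (fun t => corner_value (F t) (pt r w) - r * c)].
have ptE r w t : corner_value (F t) (pt r w) =
    r * corner_value (F t) x + corner_value (F t) w.
  by rewrite corner_valueD corner_valueZ.
have bcv w : bounded_fun (fun t => corner_value (F t) w).
  exact: (corner_value_bounded mV w Fn).
have bcst (r : R) : bounded_fun (fun _ : T => r) by exists `|r|.
(* [r x + w] lifts [r y], whose quotient norm is [|r|]. *)
have nQpt r w : Z w -> `|r| <= nV k (pt r w).
  move=> Zw; rewrite -[leLHS]mulr1 -y1 -normc_real.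
  have [_ <- _ _] := mQ.
  rewrite (_ : map_mx _ y = map_mx Q (pt r w)); first exact: quot_norm_le.
  apply/matrixP => i l; rewrite -xy !mxE linearD linearZ /=.
  have -> : Q (w i l) = 0; last by rewrite addr0.
  by rewrite -[RHS](linear0 Q); apply/quot_mapP; rewrite subr0; exact: Zw.
have [||g h|r g|g e|L mL LG] := @mean_exists R T G.
- move=> _ [r [w [_ ->]]]; apply: bounded_funD; first exact: bcv.
  exact: bcst.
- exists 0, 0; split; first by move=> i l; rewrite mxE rpred0.
  apply/funext => t; rewrite ptE !mul0r subr0 add0r.
  have := corner_valueZ (F t) 0 0; rewrite mul0r => <-; congr corner_value.
  by apply/matrixP => i l; rewrite !mxE scaler0.
- move=> [r [w [Zw ->]]] [s [z [Zz ->]]]; exists (r + s), (w + z); split.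
    by move=> i l; rewrite mxE rpredD.
  apply/funext => t; rewrite !ptE (corner_valueD (F t) w z).
  move: (corner_value (F t) x) (corner_value (F t) w) (corner_value (F t) z).
  by move=> *; ring.
- move=> r0 [s [w [Zw ->]]]; exists (r * s), (map_mx ( *:%R r%:C) w); split.
    by move=> i l; rewrite mxE rpredZ.
  apply/funext => t; rewrite !ptE (corner_valueZ (F t) r w).
  move: (corner_value (F t) x) (corner_value (F t) w) => *; ring.
- move=> [r [w [Zw ->]]] e0.
  have [h hn lt] := norming_exists mV (pt r w) c0 e0 cn.
  exists (exist _ h hn); rewrite /F /=.
  have := ler_wpM2l c0 (le_trans (ler_norm r) (nQpt r w Zw)).
  move: lt; move: (corner_value _ _) (nV k _) => p q; lra.
have Fbd u a b : cbounded (fun t => F t u a b).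
  by exists (2 * vnorm nV u) => t; exact: norming_entry.
have Fdom t : dominated nV v (F t) by case: (Fn t).
pose f : {linear V -> 'M[C]_(k + k)} := mean_linear mL Fbd.
have fdom : dominated nV v f by exact: mean_map_dominated.
have f2 : qform (f v) (corner_r R k) + qform (f v) (corner_l R k) <= 2.
  have [b1 ->] := qform_mean_map v mL Fbd (corner_r R k).
  have [b2 ->] := qform_mean_map v mL Fbd (corner_l R k).
  rewrite -(meanD mL) // -[leRHS](mean_cst mL); apply: (mean_le mL) => //.
    exact: bounded_funD.
  by move=> t; case: (Fn t).
have fE z : corner_value f z = L (fun t => corner_value (F t) z).
  have -> : (fun t => corner_value (F t) z) =
      (fun t => Re (form (map_mx (F t) z) (corner_r R k) (corner_l R k))).
    by apply/funext => t; rewrite corner_valueE.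
  by rewrite corner_valueE -(Re_form_mean_map mL Fbd).
clearbody f.
have LGr r w : Z w -> r * c <= r * corner_value f x + corner_value f w.
  move=> Zw; rewrite -corner_valueZ -corner_valueD fE -/(pt r w).
  have : 0 <= L (fun t => corner_value (F t) (pt r w) + - (r * c)).
    by apply: LG; exists r, w.
  by rewrite (meanD mL (bcv _) (bcst _)) (mean_cst mL) subr_ge0.
have fx : c <= corner_value f x.
  have Z0 : Z (map_mx ( *:%R 0%:C) x) by move=> i l; rewrite mxE scale0r rpred0.
  have := LGr 1 _ Z0; rewrite corner_valueZ.
  by rewrite !mul1r mul0r addr0.
(* At [r = 0] the lower bound 0 holds for both [w] and [- w]. *)
have fW w : Z w -> corner_value f w = 0.
  move=> Zw; have ZN : Z (map_mx ( *:%R (-1)%:C) w).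
    by move=> i l; rewrite mxE rpredZ.
  have := LGr 0 _ ZN; have := LGr 0 w Zw; rewrite corner_valueZ.
  rewrite !mul0r !add0r mulN1r oppr_ge0 => h1 h2.
  by apply/eqP; rewrite eq_le h1 h2.
have [h [hdom hq hE]] := M_ideal_dominated oV MW v1 fdom.
exists h.
  by split; [exact: hdom|exact: le_trans (lerD (hq _ _) (hq _ _)) f2].
rewrite -xy; apply: le_trans fx _.
rewrite !corner_valueE !form_corner le_eqVlt; apply/orP; left; apply/eqP; congr Re.
apply: eq_bigr => i _; apply: eq_bigr => l _; rewrite !mxE; symmetry; apply: hE => w wW.
(* A matrix with the single entry [s w] isolates one corner entry of [f w]; [s = 1] and [s = 'i]
   yield its real and imaginary parts. *)
pose D (s : C) : 'M[V]_k :=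
  \matrix_(i', l') (if (i' == i) && (l' == l) then s *: w else 0).
have corner_delta s : form (map_mx f (D s)) (corner_r R k) (corner_l R k) =
    s * f w (lshift k i) (rshift k l).
  rewrite form_corner (bigD1 i) //= [X in _ + X]big1 => [|i' ni]; last first.
    by apply: big1 => l' _; rewrite [map_mx _ _ _ _]mxE mxE (negPf ni) linear0 mxE.
  rewrite addr0 (bigD1 l) //= [X in _ + X]big1 => [|l' nl]; last first.
    by rewrite [map_mx _ _ _ _]mxE mxE (negPf nl) andbF linear0 mxE.
  by rewrite addr0 [map_mx _ _ _ _]mxE mxE !eqxx linearZ mxE.
have Zd s : Z (D s).
  by move=> i' l'; rewrite mxE; case: ifP => _; rewrite ?rpredZ ?rpred0.
have := fW _ (Zd 1); have := fW _ (Zd 'i).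
rewrite !corner_valueE !corner_delta mul1r Re_Mi.
move=> /eqP; rewrite oppr_eq0 => /eqP; case: (f w _ _) => a b /= -> ->.
by [].
Qed.

Lemma quot_mxstate_exists k (c : R) (y : 'M[quot_space W]_k) :
  0 < c -> (c%:E <= n_cb nV v)%E -> nQ k y = 1 ->
  exists n (f : {linear quot_space W -> 'M[C]_n}),
    [/\ (0 < n)%N, mxstate nQ (Q v) f & c <= Mn_norm n k (map_mx f y)].
Proof.
move=> c0 cn y1; have [h hn hc] := quot_norming_exists (ltW c0) cn y1.
exact: norming_mxstate cQ (quot_unital W mV u1) hn c0 hc.
Qed.

End QuotientIndex.

Lemma lee_pos_approx (R : realType) (a b : \bar R) : (0 < a)%E ->
  (forall c : R, 0 < c -> (c%:E <= a)%E -> (c%:E <= b)%E) -> (a <= b)%E.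
Proof.
case: a => [r| |//] a0 H; first exact: H.
case: b H => [s| |] H; rewrite ?leey //.
  have := H (`|s| + 1) _ (leey _); rewrite lee_fin => le.
  have : `|s| + 1 <= s by apply: le; exact: ltr_wpDl (normr_ge0 s) ltr01.
  by move=> /le_trans/(_ (ler_norm s)); rewrite gerDl ler10.
by have := H 1 ltr01 (leey _).
Qed.

Section QuotientVector.
Variables (R : realType) (V : lmodType R[i]) (nV : mxnorm V) (W : submodClosed V).
Arguments nV : clear implicits.
Hypothesis oV : operator_space nV.
Hypothesis MW : complete_M_ideal nV W.
Hypothesis Wproper : exists x : V, x \notin W.
Variable v : V.
Hypothesis v1 : vnorm nV v = 1.
Hypothesis n0 : (0 < n_cb nV v)%E.
Local Notation Q := (quot_map W).
Local Notation nQ := (quot_norm W nV).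

Let mQ : matricially_normed nQ.
Proof. by apply: quot_matricially_normed; case: oV; case: MW. Qed.
Let cQ := matricially_normed_compressible mQ.
Let vle1 : vnorm nV v <= 1. Proof. by rewrite v1. Qed.

Lemma quot_unit_vector : exists y : 'M[quot_space W]_1, nQ 1%N y = 1.
Proof.
have [x xW] := Wproper; pose y : 'M[quot_space W]_1 := const_mx (Q x).
have y0 : 0 < nQ 1%N y.
  rewrite lt_def matricial_norm_ge0 // andbT; apply/eqP.
  have [_ _ nQ0 _] := mQ => /nQ0/matrixP/(_ 0 0); rewrite !mxE.
  rewrite -[0](linear0 Q) => /quot_mapP; rewrite subr0.
  by apply/negP.
exists (map_mx ( *:%R (nQ 1%N y)^-1%:C) y).
by rewrite (compressibleZ cQ) ?invr_gt0 // mulVf ?gt_eqF.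
Qed.

Lemma n_cb_quot_le : (n_cb nV v <= n_cb nQ (Q v))%E.
Proof.
apply: le_ereal_inf_tmp => _ [k [y [y1 ->]]]; apply: lee_pos_approx => // c c0 cn.
have [n [f [n0' fst le]]] := quot_mxstate_exists oV MW vle1 c0 cn y1.
apply: (@le_trans _ _ (Mn_norm n k (map_mx f y))%:E); first by rewrite lee_fin.
by apply: ereal_sup_ubound; exists n, f.
Qed.

(** As [W] is proper, the quotient has a vector of norm 1, for which [quot_mxstate_exists] gives a
    state of positive size. Its value 1 at [Q v] has a diagonal entry 1, whence [1 <= |Q v|]. *)
Lemma vnorm_quot : vnorm nQ (Q v) = 1.
Proof.
apply/eqP; rewrite eq_le; apply/andP; split.
  rewrite -v1 /vnorm -(map_const_mx Q); apply: quot_norm_le.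
  by case: oV.
have [y y1] := quot_unit_vector.
have [c c0 cn] : exists2 c : R, 0 < c & (c%:E <= n_cb nV v)%E.
  move: n0; case: (n_cb nV v) => [r| |//] r0; first by exists r.
  by exists 1; rewrite ?leey.
have [n [f [n0' fst le]]] := quot_mxstate_exists oV MW vle1 c0 cn y1.
have [fb fv] := proj1 (mxstate_bound cQ _ f) fst.
case: n f n0' fst le fb fv => // n f _ _ _ fb fv.
have := cb_bound_entry 0 0 (Q v) fb.
by rewrite fv mxE eqxx Normc.normc1 mul1r.
Qed.

End QuotientVector.

(** * Operators on Hilbert spaces and their matrix norms *)

Lemma quad_nonpos (R : realType) (p q r : R) : 0 <= q -> r <= 0 ->
  (forall t, 0 <= r - 2 * t * p + t ^+ 2 * q) -> p <= 0.
Proof.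
move=> q0 r0 H; rewrite leNgt; apply/negP => p0.
have q1 : 0 < q + 1 by rewrite ltr_wpDl.
(* At this point the quadratic would be negative; the summand 1 covers [q = 0]. *)
have t0 : 0 < p / (q + 1) by rewrite divr_gt0.
have tE : p / (q + 1) * (q + 1) = p by rewrite divfK ?gt_eqF.
have := H (p / (q + 1)); move: t0 tE; set t := p / _ => t0 tE.
rewrite -{1}tE; nra.
Qed.

Section BoundedOperators.
Variables (R : realType) (H : hilbertSpace R).
Local Notation C := R[i].

Lemma hdotDl (x y z : H) : hdot H (x + y) z = hdot H x z + hdot H y z.
Proof. by rewrite linearDl. Qed.

Lemma hdotZl c (x z : H) : hdot H (c *: x) z = c * hdot H x z.
Proof. by rewrite linearZl_LR. Qed.

Lemma hdotC (x y : H) : hdot H y x = Num.conj (hdot H x y).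
Proof. by rewrite hermC expr0 mul1r. Qed.

Lemma hdotDr (x y z : H) : hdot H z (x + y) = hdot H z x + hdot H z y.
Proof. by rewrite linearDr. Qed.

Lemma hdotZr c (x z : H) : hdot H z (c *: x) = Num.conj c * hdot H z x.
Proof. by rewrite hdotC hdotZl rmorphM /= -hdotC. Qed.

Lemma hdot0l (z : H) : hdot H 0 z = 0.
Proof. by rewrite linear0l. Qed.

Lemma hdot_self (x : H) : hdot H x x = (hnorm x ^+ 2)%:C.
Proof.
rewrite hnorm_sq; have := dnorm_ge0 (hdot H) x; rewrite lecE => /andP[/eqP /= im _].
by move: im; case: (hdot H x x) => a b /= ->.
Qed.

Lemma hdot_suml (I : Type) (r : seq I) (F : I -> H) z :
  hdot H (\sum_(i <- r) F i) z = \sum_(i <- r) hdot H (F i) z.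
Proof. by rewrite linear_sumlz. Qed.

Lemma hdot_sumr (I : Type) (r : seq I) (F : I -> H) z :
  hdot H z (\sum_(i <- r) F i) = \sum_(i <- r) hdot H z (F i).
Proof. by rewrite linear_sumr. Qed.

Section Powers.
Variable k : nat.
Implicit Types (x y z : 'cV[H]_k) (T : 'M[bop H]_k).
Local Notation "c **: x" := (map_mx ( *:%R c) x) (at level 40).

Definition hsq x : R := \sum_i hnorm (x i 0) ^+ 2.

Lemma hsq_ge0 x : 0 <= hsq x.
Proof. by apply: sumr_ge0 => i _; exact: sqr_ge0. Qed.

Lemma hdotkDl x y z : hdotk (x + y) z = hdotk x z + hdotk y z.
Proof. by rewrite /hdotk -big_split; apply: eq_bigr => i _; rewrite mxE hdotDl. Qed.

Lemma hdotkZl c x z : hdotk (c **: x) z = c * hdotk x z.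
Proof. by rewrite /hdotk mulr_sumr; apply: eq_bigr => i _; rewrite mxE hdotZl. Qed.

Lemma hdotkC x y : hdotk y x = Num.conj (hdotk x y).
Proof. by rewrite /hdotk rmorph_sum; apply: eq_bigr => i _; rewrite hdotC. Qed.

Lemma hdotkDr x y z : hdotk z (x + y) = hdotk z x + hdotk z y.
Proof. by rewrite /hdotk -big_split; apply: eq_bigr => i _; rewrite mxE hdotDr. Qed.

Lemma hdotkZr c x z : hdotk z (c **: x) = Num.conj c * hdotk z x.
Proof. by rewrite /hdotk mulr_sumr; apply: eq_bigr => i _; rewrite mxE hdotZr. Qed.

Lemma hdotk_self x : hdotk x x = (hsq x)%:C.
Proof. by rewrite /hdotk rmorph_sum; apply: eq_bigr => i _; rewrite hdot_self. Qed.

Lemma hsqZ c x : hsq (c **: x) = Normc.normc c ^+ 2 * hsq x.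
Proof. by rewrite /hsq mulr_sumr; apply: eq_bigr => i _; rewrite mxE hnormZ exprMn. Qed.

Lemma hsq0 : hsq (0 : 'cV_k) = 0.
Proof.
by rewrite /hsq big1 // => i _; rewrite mxE hnorm_sq hdot0l.
Qed.

Lemma hnormkE x : hnormk x = Num.sqrt (hsq x).
Proof. by rewrite /hnormk hdotk_self. Qed.

Lemma hnormk_le x c : 0 <= c -> (hnormk x <= c) = (hsq x <= c ^+ 2).
Proof.
move=> c0; rewrite hnormkE -{2}[hsq x]sqr_sqrtr ?hsq_ge0 //.
by rewrite ler_pXn2r // nnegrE sqrtr_ge0.
Qed.

Lemma Re_hdotk_le x y s b : 0 <= s -> 0 <= b -> hsq x <= s ^+ 2 * b ->
  2 * Re (hdotk x y) <= s * (b + hsq y).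
Proof.
move=> s0 b0 xb.
have quad (t : R) : 0 <= hsq x - 2 * t * Re (hdotk x y) + t ^+ 2 * hsq y.
  have : 0 <= hsq (x + (- t)%:C **: y) by exact: hsq_ge0.
  have -> : hsq (x + (- t)%:C **: y) = Re (hdotk (x + (- t)%:C **: y) (x + (- t)%:C **: y)).
    by rewrite hdotk_self.
  rewrite hdotkDl !hdotkDr !hdotkZl !hdotkZr conj_real !hdotk_self !ReD !ReMr.
  rewrite (hdotkC x y) Re_conj /=; move: (Re _) (hsq x) (hsq y) => p q r.
  by clear; nra.
move: s0; rewrite le_eqVlt => /orP[/eqP s0|s0].
  rewrite -s0 mul0r pmulr_rle0 //; apply: quad_nonpos (hsq_ge0 y) _ quad.
  by move: xb; rewrite -s0 expr0n mul0r.
rewrite -(ler_pM2l s0) mulrCA mulrA -subr_ge0; apply: le_trans (quad s) _.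
rewrite -subr_ge0 (_ : _ - _ = s ^+ 2 * b - hsq x) ?subr_ge0 //.
by move: (Re _) (hsq x) (hsq y) => p q r; ring.
Qed.

End Powers.
End BoundedOperators.

Section OperatorNorm.
Variables (R : realType) (H : hilbertSpace R).
Local Notation C := R[i].

Lemma bop_linear (S : bop H) : linear (bop_fun S).
Proof. by case: S => S SP; have := SP; rewrite inE => -[]. Qed.

HB.instance Definition _ (S : bop H) :=
  GRing.isLinear.Build C H H *:%R (bop_fun S) (bop_linear S).

Lemma bop_bounded (S : bop H) :
  exists2 M, 0 <= M & forall x : H, hnorm (S x) <= M * hnorm x.
Proof.
case: S => S SP; have := SP; rewrite inE => -[_ [M SM]].
exists `|M| => // x; apply: le_trans (SM x) _.
by rewrite ler_wpM2r ?ler_norm // sqrtr_ge0.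
Qed.

Section Powers.
Variable k : nat.
Implicit Types (x y z : 'cV[H]_k) (T : 'M[bop H]_k).

Lemma bopmx_app0 T : bopmx_app T 0 = 0.
Proof.
apply/matrixP => i j; rewrite !mxE big1 // => l _.
by rewrite mxE linear0.
Qed.

Lemma bopmx_appZ T c x :
  bopmx_app T (map_mx ( *:%R c) x) = map_mx ( *:%R c) (bopmx_app T x).
Proof.
apply/matrixP => i j; rewrite !mxE scaler_sumr; apply: eq_bigr => l _.
by rewrite mxE linearZ.
Qed.

Lemma Re_hdotk_le_hsq x y : 2 * Re (hdotk x y) <= hsq x + hsq y.
Proof.
rewrite -[leRHS]mul1r; apply: Re_hdotk_le => //; first exact: hsq_ge0.
by rewrite expr1n mul1r.
Qed.

Lemma bopmx_app_bounded T : exists2 M, 0 <= M &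
  forall x, hsq (bopmx_app T x) <= M * hsq x.
Proof.
have /choice[m mP] : forall p : 'I_k * 'I_k, exists m,
    0 <= m /\ forall x : H, hnorm (T p.1 p.2 x) <= m * hnorm x.
  by move=> p; have [m m0 mx] := bop_bounded (T p.1 p.2); exists m.
pose M : R := \sum_i \sum_j m (i, j) ^+ 2.
have M0 : 0 <= M by do 2!(apply: sumr_ge0 => ? _); exact: sqr_ge0.
have form_le x y : 2 * Re (hdotk (bopmx_app T x) y) <= M * hsq x + k%:R * hsq y.
  have -> : M * hsq x + k%:R * hsq y =
      \sum_i \sum_j (m (i, j) ^+ 2 * hsq x + hnorm (y i 0) ^+ 2).
    under [RHS]eq_bigr do rewrite big_split sumr_const card_ord -mulr_suml -mulr_natl.
    by rewrite big_split -mulr_suml -mulr_sumr.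
  rewrite /hdotk raddf_sum mulr_sumr; apply: ler_sum => i _.
  rewrite mxE hdot_suml raddf_sum mulr_sumr; apply: ler_sum => j _.
  have [m0 mx] := mP (i, j).
  pose u : 'cV[H]_1 := const_mx (T i j (x j 0)); pose w : 'cV[H]_1 := const_mx (y i 0).
  have -> : hdot H (T i j (x j 0)) (y i 0) = hdotk u w.
    by rewrite /hdotk big_ord1 !mxE.
  have le1 (a : H) : hsq (const_mx a : 'cV_1) = hnorm a ^+ 2.
    by rewrite /hsq big_ord1 mxE.
  have le : 2 * Re (hdotk u w) <= hsq u + hsq w.
    rewrite -[leRHS]mul1r; apply: Re_hdotk_le; rewrite ?hsq_ge0 //.
    by rewrite expr1n mul1r.
  apply: le_trans le _; rewrite !le1 lerD2r.
  apply: (@le_trans _ _ ((m (i, j) * hnorm (x j 0)) ^+ 2)).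
    by rewrite ler_pXn2r ?nnegrE ?mulr_ge0 ?sqrtr_ge0.
  rewrite exprMn ler_wpM2l ?sqr_ge0 // /hsq (bigD1 j) //= lerDl.
  by apply: sumr_ge0 => *; exact: sqr_ge0.
exists (k.+1%:R * M); first by rewrite mulr_ge0.
(* With [y = T x / (k + 1)] the term [k |y|^2] is at most [|T x|^2 / (k + 1)] and is absorbed by the
   left-hand side; [k + 1] also covers [k = 0]. *)
move=> x; have := form_le x (map_mx ( *:%R (k.+1%:R)^-1%:C) (bopmx_app T x)).
rewrite hdotkZr hdotk_self conj_real ReMr hsqZ normc_real_sq /=.
set n := k.+1%:R; set q := hsq _; set p := M * _ => le.
have n0 : 0 < n :> R by rewrite ltr0n.
have kn : k%:R = n - 1 :> R by rewrite /n -natr1 addrK.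
have q0 : 0 <= q by exact: hsq_ge0.
rewrite -mulrA -/p -ler_pdivrMl //.
move: le; rewrite kn exprVn expr2 invfM => le.
have vn : n^-1 * n = 1 by rewrite mulVf // gt_eqF.
have v0 : 0 < n^-1 by rewrite invr_gt0.
have E : (n - 1) * (n^-1 * n^-1 * q) = n^-1 * q - n^-1 * n^-1 * q.
  by rewrite mulrBl mul1r mulrA mulrA [n * _]mulrC vn mul1r.
rewrite E in le; have : 0 <= n^-1 * n^-1 * q by rewrite !mulr_ge0 // ltW.
by move: le; move: (n^-1 * n^-1 * q) (n^-1 * q) => a b; lra.
Qed.

Definition bop_set T :=
  [set hnormk (bopmx_app T x) | x in [set x : 'cV[H]_k | hnormk x <= 1]].

Lemma has_ubound_bop T : has_ubound (bop_set T).
Proof.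
have [M M0 TM] := bopmx_app_bounded T.
exists (Num.sqrt M) => _ [x /= x1 <-]; rewrite hnormk_le ?sqrtr_ge0 //.
rewrite sqr_sqrtr //; apply: le_trans (TM x) _; rewrite ler_piMr //.
by move: x1; rewrite hnormk_le // expr1n.
Qed.

Lemma bop_norm_ge0 T : 0 <= bop_norm H k T.
Proof.
apply: (@le_trans _ _ (hnormk (bopmx_app T 0))); first exact: sqrtr_ge0.
apply: ub_le_sup; first exact: has_ubound_bop.
by exists 0 => //=; rewrite hnormk_le // hsq0.
Qed.

Lemma hsq_bopmx_app_le T x : hsq (bopmx_app T x) <= bop_norm H k T ^+ 2 * hsq x.
Proof.
have [M M0 TM] := bopmx_app_bounded T.
have [hx|hx] := leP (hsq x) 0.
  have x0 : hsq x = 0 by apply/eqP; rewrite eq_le hx hsq_ge0.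
  by rewrite x0 mulr0; have := TM x; rewrite x0 mulr0.
pose s := Num.sqrt (hsq x).
have s0 : 0 < s by rewrite sqrtr_gt0.
have sE : s ^+ 2 = hsq x by rewrite sqr_sqrtr // ltW.
have : hnormk (bopmx_app T (map_mx ( *:%R s^-1%:C) x)) <= bop_norm H k T.
  apply: ub_le_sup; first exact: has_ubound_bop.
  exists (map_mx ( *:%R s^-1%:C) x) => //=; rewrite hnormk_le // hsqZ normc_real_sq.
  by rewrite expr1n exprVn sE mulVf // gt_eqF.
rewrite hnormk_le ?bop_norm_ge0 // bopmx_appZ hsqZ normc_real_sq exprVn sE.
by rewrite ler_pdivrMl // mulrC.
Qed.

Lemma bop_norm_ge_form T x y :
  2 * Re (hdotk (bopmx_app T x) y) <= bop_norm H k T * (hsq x + hsq y).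
Proof.
by apply: Re_hdotk_le; [exact: bop_norm_ge0|exact: hsq_ge0|exact: hsq_bopmx_app_le].
Qed.

Lemma bop_norm_le T c : 0 <= c ->
  (forall x y, 2 * Re (hdotk (bopmx_app T x) y) <= c * (hsq x + hsq y)) ->
  bop_norm H k T <= c.
Proof.
move=> c0 TH; apply: ge_sup.
  by exists (hnormk (bopmx_app T 0)), 0 => //=; rewrite hnormk_le // hsq0.
move=> _ [x /= x1 <-]; set u := bopmx_app T x.
have [|n0] := leP (hnormk u) 0; first by move/le_trans; exact.
have uE : hsq u = hnormk u ^+ 2 by rewrite hnormkE sqr_sqrtr ?hsq_ge0.
have := TH x (map_mx ( *:%R (hnormk u)^-1%:C) u).
rewrite -/u hdotkZr hdotk_self conj_real ReMr /= hsqZ normc_real_sq uE.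
have -> : (hnormk u)^-1 * hnormk u ^+ 2 = hnormk u.
  by rewrite expr2 mulrA mulVf ?gt_eqF // mul1r.
rewrite exprVn mulVf ?sqrf_eq0 ?gt_eqF // => le.
have : hsq x <= 1 by move: x1; rewrite hnormk_le // expr1n.
have := ler_wpM2l c0; move=> /(_ (hsq x) 1) H1 /H1.
by move: le; rewrite mulrDr !mulr1; move: (hnormk u) (c * hsq x) => a b; lra.
Qed.

End Powers.

Lemma bop_norm_block m n (S : 'M[bop H]_m) (T : 'M[bop H]_n) :
  bop_norm H (m + n) (block_mx S 0 0 T) = Num.max (bop_norm H m S) (bop_norm H n T).
Proof.
have app x1 x2 : bopmx_app (block_mx S 0 0 T) (col_mx x1 x2) =
    col_mx (bopmx_app S x1) (bopmx_app T x2).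
  apply/matrixP => i j; rewrite ord1 mxE big_split_ord /=.
  case: (split_ordP i) => i' ->.
    rewrite col_mxEu [RHS]mxE [X in _ + X]big1 ?addr0 => [|l _].
      by apply: eq_bigr => l _; rewrite block_mxEul col_mxEu.
    by rewrite block_mxEur mxE.
  rewrite col_mxEd [RHS]mxE [X in X + _]big1 ?add0r => [|l _].
    by apply: eq_bigr => l _; rewrite block_mxEdr col_mxEd.
  by rewrite block_mxEdl mxE.
have hsq_col (x1 : 'cV[H]_m) (x2 : 'cV[H]_n) : hsq (col_mx x1 x2) = hsq x1 + hsq x2.
  rewrite /hsq big_split_ord; congr (_ + _); apply: eq_bigr => i _.
    by rewrite col_mxEu.
  by rewrite col_mxEd.
have hdot_col (x1 y1 : 'cV[H]_m) (x2 y2 : 'cV[H]_n) :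
    hdotk (col_mx x1 x2) (col_mx y1 y2) = hdotk x1 y1 + hdotk x2 y2.
  rewrite /hdotk big_split_ord; congr (_ + _); apply: eq_bigr => i _.
    by rewrite !col_mxEu.
  by rewrite !col_mxEd.
have S0 := bop_norm_ge0 S; have T0 := bop_norm_ge0 T.
apply/eqP; rewrite eq_le ge_max; apply/and3P; split.
- apply: bop_norm_le; first by rewrite le_max S0.
  move=> x y; rewrite -[x]vsubmxK -[y]vsubmxK app !hdot_col !hsq_col ReD mulrDr.
  move: (usubmx x) (dsubmx x) (usubmx y) (dsubmx y) => x1 x2 y1 y2.
  rewrite addrACA mulrDr; apply: lerD.
    apply: le_trans (bop_norm_ge_form _ _ _) _.
    by rewrite ler_wpM2r ?addr_ge0 ?hsq_ge0 // le_max lexx.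
  apply: le_trans (bop_norm_ge_form _ _ _) _.
  by rewrite ler_wpM2r ?addr_ge0 ?hsq_ge0 // le_max lexx orbT.
- apply: bop_norm_le => [|x y]; first exact: bop_norm_ge0.
  have := bop_norm_ge_form (block_mx S 0 0 T) (col_mx x 0) (col_mx y 0).
  by rewrite app hdot_col !hsq_col !hsq0 !addr0 bopmx_app0 hdotk_self hsq0 addr0.
- apply: bop_norm_le => [|x y]; first exact: bop_norm_ge0.
  have := bop_norm_ge_form (block_mx S 0 0 T) (col_mx 0 x) (col_mx 0 y).
  by rewrite app hdot_col !hsq_col !hsq0 !add0r bopmx_app0 hdotk_self hsq0 add0r.
Qed.

End OperatorNorm.

(** * The numerical index of an operator system at its order unit *)

Section OperatorSystem.
Variables (R : realType) (V : lmodType R[i]) (nV : mxnorm V) (e : V).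
Arguments nV : clear implicits.
Local Notation C := R[i].
Hypothesis mV : matricially_normed nV.
Hypothesis V0 : exists v : V, v != 0.
Variables (K : hilbertSpace R) (Phi : {linear V -> bop K}).
Hypothesis iso : complete_isometry nV (bop_norm K) Phi.
Hypothesis Phi1 : forall x, Phi e x = x.

Lemma system_operator_space : operator_space nV.
Proof.
split=> // m n x y; rewrite -!iso -bop_norm_block; congr bop_norm.
by rewrite map_block_mx !map_mx0.
Qed.

(** The lower bound needs a nonzero vector of [K]; if there were none, all operator norms would be 0
    and [V] would be zero. *)
Lemma system_vnorm1 : vnorm nV e = 1.
Proof.
have app1 (x : 'cV[K]_1) : bopmx_app (map_mx Phi (const_mx e)) x = x.
  by apply/matrixP => i j; rewrite !mxE big_ord1 !mxE Phi1 !ord1.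
rewrite /vnorm -iso; apply/eqP; rewrite eq_le; apply/andP; split.
  by apply: bop_norm_le => // x y; rewrite app1 mul1r Re_hdotk_le_hsq.
have [v v0] := V0.
have : ~ (forall x : 'cV[K]_1, hsq x = 0).
  move=> K0; move/eqP: v0; apply.
  have [_ _ nV0 _] := mV.
  have /nV0/matrixP/(_ 0 0) : nV 1%N (const_mx v) = 0.
    apply/eqP; rewrite eq_le matricial_norm_ge0 // andbT -iso.
    apply: bop_norm_le => // x y; apply: le_trans (Re_hdotk_le_hsq _ _) _.
    by rewrite !K0 addr0 mul0r.
  by rewrite !mxE.
move=> /existsNP[x /eqP x0].
have q0 : 0 < hsq x by rewrite lt_def x0 hsq_ge0.
have := bop_norm_ge_form (map_mx Phi (const_mx e)) x x.
rewrite app1 hdotk_self /=; move: (bop_norm _ _ _) (hsq x) q0 => p q q0; nra.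
Qed.

Let cV := matricially_normed_compressible mV.

Let e1 : unital_norm nV e.
Proof.
by apply: operator_space_unital; [exact: system_operator_space|rewrite system_vnorm1].
Qed.

Section Compression.
Variables (N : nat) (z : 'cV[K]_N).

(** The vectors in [z] are arbitrary, so the value at [e] is their Gram matrix; domination, unlike
    being a matrix state, allows this. *)
Definition compression (u : V) : 'M[C]_N :=
  \matrix_(a, b) hdot K (Phi u (z b 0)) (z a 0).

Lemma compression_linear : linear compression.
Proof.
move=> c u w; apply/matrixP => a b; rewrite !mxE linearP.
by rewrite -hdotZl -hdotDl.
Qed.

HB.instance Definition _ :=
  GRing.isLinear.Build C V 'M[C]_N *:%R compression compression_linear.

Definition combine j (al : 'M[C]_(j, N)) : 'cV[K]_j :=
  \col_i \sum_b al i b *: z b 0.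

Lemma form_compression j (x : 'M[V]_j) al be :
  form (map_mx compression x) al be =
  hdotk (bopmx_app (map_mx Phi x) (combine al)) (combine be).
Proof.
rewrite formE /hdotk; apply: eq_bigr => i _; rewrite !mxE hdot_suml.
apply: eq_bigr => l _; rewrite !mxE hdot_sumr.
apply: eq_bigr => a _; rewrite hdotZr linear_sum hdot_suml mulr_sumr.
apply: eq_bigr => b _; rewrite linearZ hdotZl !mxE.
by rewrite -mulrA [_ * al l b]mulrC.
Qed.

Lemma qform_compression j (al : 'M[C]_(j, N)) :
  qform (compression e) al = hsq (combine al).
Proof.
rewrite /qform -(map_unit_mx compression) form_compression.
have -> : bopmx_app (map_mx Phi (unit_mx e j)) (combine al) = combine al.
  apply/matrixP => i l; rewrite mxE (bigD1 i) //= big1 => [|i' ni].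
    by rewrite !mxE eqxx mulr1n Phi1 addr0.
  by rewrite mxE [unit_mx _ _ _ _]mxE eq_sym (negPf ni) mulr0n linear0.
by rewrite hdotk_self.
Qed.

Lemma compression_dominated : dominated nV e compression.
Proof.
move=> j x al be; rewrite form_compression !qform_compression -iso.
exact: bop_norm_ge_form.
Qed.

End Compression.

(** It is enough to reach every level [r < 1]. Vectors [xi] and [eta] of K^k at which the form of
    [x] exceeds [r] are scaled to total square norm 2 and stacked into [z], from which the corners
    read them back. *)
Lemma system_n_cb : (1%:E <= n_cb nV e)%E.
Proof.
apply: le_ereal_inf_tmp => _ [k [x [x1 ->]]].
suff H (r : R) : 0 < r -> r < 1 -> (r%:E <= mxstate_norm nV e x)%E.
  apply/lee_subgt0Pr => d d0; have [d1|d1] := ltP d 1.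
    by rewrite -EFinB; apply: H; rewrite ?subr_gt0 // gtrBl.
  apply: (@le_trans _ _ (2^-1)%:E); last by apply: H; lra.
  by rewrite -EFinB lee_fin; lra.
move=> r0 r1.
have [xi [eta lt]] : exists xi eta : 'cV[K]_k, r * (hsq xi + hsq eta) <
    2 * Re (hdotk (bopmx_app (map_mx Phi x) xi) eta).
  apply: contrapT => /forallNP nex.
  have : bop_norm K k (map_mx Phi x) <= r.
    apply: bop_norm_le; first exact: ltW.
    move=> xi eta; rewrite leNgt; apply/negP => lt.
    by apply: (nex xi); exists eta.
  by rewrite iso x1 leNgt r1.
set s := hsq xi + hsq eta in lt.
have s_ge0 : 0 <= s by rewrite addr_ge0 ?hsq_ge0.
have s0 : 0 < s.
  rewrite lt_def s_ge0 andbT; apply/eqP => s0.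
  have q1 := hsq_ge0 xi; have q2 := hsq_ge0 eta.
  have := Re_hdotk_le (x := bopmx_app (map_mx Phi x) xi) eta
    (bop_norm_ge0 (map_mx Phi x)) q1 (hsq_bopmx_app_le _ _).
  rewrite -/s s0 mulr0 => le0; have := lt_le_trans lt le0.
  by rewrite s0 mulr0 ltxx.
pose t := Num.sqrt (2 / s).
have tE : t ^+ 2 = 2 / s by rewrite sqr_sqrtr // divr_ge0.
pose z := map_mx ( *:%R t%:C) (col_mx eta xi).
have zr : combine z (corner_r R k) = map_mx ( *:%R t%:C) xi.
  apply/matrixP => i l; rewrite ord1 [LHS]mxE big_split_ord /=.
  rewrite big1 ?add0r => [|b _]; last by rewrite row_mxEl mxE scale0r.
  rewrite (bigD1 i) //= big1 => [|b nb].
    by rewrite row_mxEr mxE eqxx scale1r addr0 mxE col_mxEd mxE.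
  by rewrite row_mxEr mxE eq_sym (negPf nb) scale0r.
have zl : combine z (corner_l R k) = map_mx ( *:%R t%:C) eta.
  apply/matrixP => i l; rewrite ord1 [LHS]mxE big_split_ord /=.
  rewrite [X in _ + X]big1 ?addr0 => [|b _]; last by rewrite row_mxEr mxE scale0r.
  rewrite (bigD1 i) //= big1 => [|b nb].
    by rewrite row_mxEl mxE eqxx scale1r addr0 mxE col_mxEu mxE.
  by rewrite row_mxEl mxE eq_sym (negPf nb) scale0r.
have nz : norming_map nV e (compression z).
  split; first exact: compression_dominated.
  rewrite !qform_compression zr zl !hsqZ normc_real_sq -mulrDr -/s tE.
  by rewrite divfK // gt_eqF.
have rle : r <= corner_value (compression z) x.
  rewrite corner_valueE form_compression zr zl bopmx_appZ hdotkZl hdotkZr.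
  rewrite conj_real mulrA -rmorphM ReMr -expr2 tE mulrAC ler_pdivlMr //.
  exact: ltW.
have [n [f [n0 fst le]]] := norming_mxstate cV e1 nz r0 rle.
apply: (@le_trans _ _ (Mn_norm n k (map_mx f x))%:E); first by rewrite lee_fin.
by apply: ereal_sup_ubound; exists n, f.
Qed.

End OperatorSystem.

(** * Positive functionals respect adjoints *)

Lemma cross_term_zero (R : realType) (b M m : R) :
  (forall t, (b + t * M) ^+ 2 <= M ^+ 2 * (m ^+ 2 + t ^+ 2)) -> b = 0.
Proof.
move=> H; apply/eqP; apply: contraT => b0.
have [M0|M0] := eqVneq M 0.
  have := H 0; rewrite M0 !mul0r expr0n mul0r addr0 => le.
  by move: b0; rewrite -sqrf_eq0 eq_le le sqr_ge0.
have bM : b * M != 0 by rewrite mulf_neq0.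
(* Once the [t^2] terms cancel, the inequality is affine in [t] with slope [2 b M]; at this [t] it
   would read [b^2 + 1 <= 0]. *)
pose t := (M ^+ 2 * m ^+ 2 + 1) / (2 * (b * M)).
have tE : 2 * (b * M) * t = M ^+ 2 * m ^+ 2 + 1.
  by rewrite mulrC divfK // mulf_neq0 // pnatr_eq0.
have := H t; have := sqr_ge0 b; rewrite !expr2 in tE *; nra.
Qed.

Section FormDiagonal.
Variables (R : realType) (N : nat).
Local Notation C := R[i].

Lemma form_diag0 j (X : 'M['M[C]_N]_j) : (forall al, form X al al = 0) ->
  forall al be, form X al be = 0.
Proof.
move=> H al be; have := H (al + be); have := H (al + 'i *: be).
rewrite !formDl !formDr !formZl !formZr !H.
case: (form X al be) => a b; case: (form X be al) => c d.
rewrite /Num.conj /= => -[h1 h2] [h3 h4].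
by congr (_ +i* _); lra.
Qed.

Lemma form_adj (M : 'M[C]_N) (al be : 'rV[C]_N) :
  form (const_mx (mxconj M)^T : 'M_1) al be =
  Num.conj (form (const_mx M : 'M_1) be al).
Proof.
rewrite !formE !big_ord1 exchange_big rmorph_sum; apply: eq_bigr => b _.
rewrite rmorph_sum; apply: eq_bigr => a _; rewrite !mxE !rmorphM /= conjCK.
by rewrite mulrC -[RHS]mulrA; congr (_ * _); rewrite mulrC.
Qed.

End FormDiagonal.

Section Adjoint.
Variables (R : realType) (V : lmodType R[i]) (nV : mxnorm V) (e : V).
Arguments nV : clear implicits.
Local Notation C := R[i].
Variables (K : hilbertSpace R) (Phi : {linear V -> bop K}).
Hypothesis iso : complete_isometry nV (bop_norm K) Phi.
Hypothesis Phi1 : forall x, Phi e x = x.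

Let nV_ge0 u : 0 <= vnorm nV u.
Proof. by rewrite /vnorm -iso bop_norm_ge0. Qed.

(** In the square norm of [h x + i t x] the cross terms cancel, because the inner product of [h x]
    and [x] is real. *)
Lemma selfadjoint_vnorm h (t : R) : is_adjoint (Phi h) (Phi h) ->
  vnorm nV (h + (0 +i* t) *: e) ^+ 2 <= vnorm nV h ^+ 2 + t ^+ 2.
Proof.
move=> hadj; set m := vnorm nV h; set s := Num.sqrt (m ^+ 2 + t ^+ 2).
have sE : s ^+ 2 = m ^+ 2 + t ^+ 2 by rewrite sqr_sqrtr // addr_ge0 ?sqr_ge0.
rewrite -sE ler_pXn2r ?nnegrE ?sqrtr_ge0 // /vnorm -iso.
apply: bop_norm_le; first exact: sqrtr_ge0.
move=> x y; apply: Re_hdotk_le; rewrite ?sqrtr_ge0 ?hsq_ge0 // sE.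
have hh : hsq (bopmx_app (map_mx Phi (const_mx h)) x) <= m ^+ 2 * hsq x.
  by have := hsq_bopmx_app_le (map_mx Phi (const_mx h)) x; rewrite iso.
pose a := Phi h (x 0 0).
have h1 : hsq (bopmx_app (map_mx Phi (const_mx h)) x) = hnorm a ^+ 2.
  by rewrite /hsq big_ord1 !mxE big_ord1 !mxE.
have h2 : hsq x = hnorm (x 0 0) ^+ 2 by rewrite /hsq big_ord1.
have -> : hsq (bopmx_app (map_mx Phi (const_mx (h + (0 +i* t) *: e))) x) =
    hnorm (a + (0 +i* t) *: x 0 0) ^+ 2.
  rewrite /hsq big_ord1 !mxE big_ord1 !mxE linearD linearZ /=.
  by rewrite -[in RHS](Phi1 (x 0 0)).
rewrite h1 h2 in hh; rewrite h2.
have areal : hdot K a (x 0 0) = Num.conj (hdot K a (x 0 0)).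
  by rewrite -hdotC /a hadj.
have -> : hnorm (a + (0 +i* t) *: x 0 0) ^+ 2 = hnorm a ^+ 2 + t ^+ 2 * hnorm (x 0 0) ^+ 2.
  rewrite hnorm_sq hdotDl !hdotDr !hdotZl !hdotZr (hdotC a (x 0 0)) -areal !hdot_self.
  move: areal; case: (hdot K a (x 0 0)) => p q; rewrite /Num.conj /= => -[hq].
  have -> : q = 0 by apply/eqP; rewrite -eqNr -hq.
  by ring.
by rewrite mulrDl lerD2r.
Qed.

Variable s : {linear V -> C^o}.
Variable M : R.
Hypothesis sM : forall u, Normc.normc (s u) <= M * vnorm nV u.
Hypothesis se : s e = M%:C.

(** Adding [i t e] to [h] moves [Im (s h)] by [t M], while the squared norm grows by at most [t^2];
    for large [t] of suitable sign this is incompatible with a nonzero [Im (s h)]. *)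
Lemma selfadjoint_real h : is_adjoint (Phi h) (Phi h) -> Im (s h) = 0.
Proof.
move=> hadj; apply: (@cross_term_zero _ _ M (vnorm nV h)) => t.
pose u := h + (0 +i* t) *: e.
have -> : (Im (s h) + t * M) ^+ 2 = Im (s u) ^+ 2.
  rewrite /u linearD linearZ se; case: (s h) => a b /=.
  by congr (_ ^+ 2); rewrite /GRing.scale /=; ring.
apply: (@le_trans _ _ (Normc.normc (s u) ^+ 2)).
  rewrite normc_sq; case: (s u) => a b; rewrite /Num.conj /=.
  by rewrite -subr_ge0 (_ : _ - _ = a ^+ 2) ?sqr_ge0 //; ring.
apply: (@le_trans _ _ ((M * vnorm nV u) ^+ 2)).
  have := sM u; have := normc_ge0 (s u) => n0 le.
  by rewrite ler_pXn2r ?nnegrE // (le_trans n0 le).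
by rewrite exprMn ler_wpM2l ?sqr_ge0 // selfadjoint_vnorm.
Qed.

(** Both [u + w] and [i (u - w)] are selfadjoint; that [s] is real on them gives the two coordinates
    of the identity. *)
Lemma adjoint_conj u w : is_adjoint (Phi w) (Phi u) -> s w = Num.conj (s u).
Proof.
move=> adj.
have adj' x y : hdot K (Phi w x) y = hdot K x (Phi u y).
  by rewrite hdotC -adj -hdotC.
have r1 : Im (s (u + w)) = 0.
  apply: selfadjoint_real => x y; rewrite linearD.
  rewrite -[(Phi u + Phi w) x]/(Phi u x + Phi w x).
  rewrite -[(Phi u + Phi w) y]/(Phi u y + Phi w y).
  by rewrite hdotDl hdotDr adj adj' addrC.
have r2 : Im (s ('i *: u + (- 'i) *: w)) = 0.
  have E z : Phi ('i *: u + (- 'i) *: w) z = 'i *: Phi u z + (- 'i) *: Phi w z.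
    have -> : Phi ('i *: u + (- 'i) *: w) = 'i *: Phi u + (- 'i) *: Phi w.
      by rewrite linearD !linearZ.
    by [].
  apply: selfadjoint_real => x y; rewrite !E.
  have ci : Num.conj ('i : C) = - 'i by apply/eqP; rewrite eq_complex /= oppr0 !eqxx.
  by rewrite hdotDl hdotDr !hdotZl !hdotZr adj adj' rmorphN /= ci opprK addrC.
move: r1 r2; rewrite !linearD !linearZ /=.
case: (s u) => a b; case: (s w) => c d; rewrite /GRing.scale /Num.conj /= => r1 r2.
by congr (_ +i* _); lra.
Qed.

End Adjoint.

(** * Generalized limits along finite sets and along sequences *)

Lemma sum_subset_le (R : realType) (I : eqType) (s s' : seq I) (F : I -> R) :
  (forall i, 0 <= F i) -> uniq s -> uniq s' -> {subset s <= s'} ->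
  \sum_(i <- s) F i <= \sum_(i <- s') F i.
Proof.
move=> F0 us us' ss'; rewrite [leRHS](bigID (mem s)) /=.
have -> : \sum_(i <- s' | i \in s) F i = \sum_(i <- s) F i.
  rewrite -big_filter; apply/perm_big/uniq_perm => // [|i]; first exact: filter_uniq.
  by rewrite mem_filter andbC; case: (boolP (i \in s)) => [/ss' ->|]; rewrite ?andbF.
by rewrite lerDl sumr_ge0.
Qed.

Section FiniteSets.
Variable T : choiceType.

(** Finite subsets as duplicate-free sequences. A subset occurs once for each ordering, which is
    harmless as only inclusions are compared. *)
Definition finseq := {A : seq T | uniq A}.

Definition eventually_nonneg (R : realType) : set (finseq -> R) :=
  [set g | bounded_fun g /\
    exists A : finseq, forall B : finseq, {subset sval A <= sval B} -> 0 <= g B].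

(** Finite subsets are directed, so the eventually nonnegative functions form a cone, and each of
    them is nonnegative somewhere. The resulting mean extends the limit along finite subsets. *)
Lemma finite_mean_exists (R : realType) :
  exists2 L : (finseq -> R) -> R, mean L &
    forall g, eventually_nonneg g -> 0 <= L g.
Proof.
apply: mean_exists => [g []|||c g c0 [gb [A gA]]|g e [gb [A gA]] e0] //.
- split; first by exists 0 => A; rewrite normr0.
  by exists (exist _ [::] isT).
- move=> g h [gb [A gA]] [hb [B hB]]; split; first exact: bounded_funD.
  pose D : finseq := exist _ (undup (sval A ++ sval B)) (undup_uniq _).
  have AD : {subset sval A <= sval D} by move=> x xA; rewrite mem_undup mem_cat xA.
  have BD : {subset sval B <= sval D}.
    by move=> x xB; rewrite mem_undup mem_cat xB orbT.
  exists D => E DE; apply: addr_ge0; first by apply: gA => x /AD/DE.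
  by apply: hB => x /BD/DE.
- split; first exact: bounded_funZ.
  by exists A => B AB; rewrite mulr_ge0 ?gA // ltW.
- by exists A; apply: lt_le_trans (gA A _); rewrite ?oppr_lt0.
Qed.

Definition finite_mean (R : realType) : (finseq -> R) -> R :=
  sval (cid2 (finite_mean_exists R)).

Lemma finite_meanP (R : realType) : mean (@finite_mean R).
Proof. by rewrite /finite_mean; case: cid2. Qed.

Lemma finite_mean_ge0 (R : realType) (g : finseq -> R) :
  eventually_nonneg g -> 0 <= finite_mean g.
Proof. by rewrite /finite_mean; case: cid2 => L mL LG; exact: LG. Qed.

End FiniteSets.

Section SequenceMean.
Variable R : realType.

(** A generalized limit of bounded sequences: it depends only on tails and extends the ordinary
    limit. *)
Lemma sequence_mean_exists :
  exists2 L : (nat -> R) -> R, mean L &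
    forall g, bounded_fun g -> (exists N, forall m, (N <= m)%N -> 0 <= g m) -> 0 <= L g.
Proof.
pose G := [set g : nat -> R | bounded_fun g /\
  exists N, forall m, (N <= m)%N -> 0 <= g m].
have [g []|||c g c0 [gb [N gN]]|g e [gb [N gN]] e0|L mL LG] // := @mean_exists R nat G.
- split; first by exists 0 => n; rewrite normr0.
  by exists 0%N.
- move=> g h [gb [N gN]] [hb [M hM]]; split; first exact: bounded_funD.
  exists (maxn N M) => m; rewrite geq_max => /andP[Nm Mm].
  by rewrite addr_ge0 ?gN ?hM.
- split; first exact: bounded_funZ.
  by exists N => m Nm; rewrite mulr_ge0 ?gN // ltW.
- by exists N; apply: lt_le_trans (gN N _); rewrite ?oppr_lt0.
by exists L => // g gb gN; apply: LG.
Qed.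

End SequenceMean.

(** * The l2 sum of finite-dimensional Hilbert spaces *)

Section HilbertSum.
Variables (R : realType) (T : choiceType) (n : T -> nat).
Local Notation C := R[i].
Local Notation fam := (forall t, 'cV[C]_(n t)).

Definition partial_hs (z : fam) (A : finseq T) : R := \sum_(t <- sval A) hs (z t).

Definition square_summable (z : fam) := exists M, forall A, partial_hs z A <= M.

Lemma partial_hs_ge0 z A : 0 <= partial_hs z A.
Proof. by apply: sumr_ge0 => t _; exact: hs_ge0. Qed.

Lemma hs_addr_le m k (x y : 'M[C]_(m, k)) : hs (x + y) <= 2 * (hs x + hs y).
Proof.
have := Re_mxip_le_hs x y.
rewrite [hs (x + y)]hsE mxipDl (mxipDr x y x) (mxipDr x y y) !mxip_hs (mxip_conj x y).
move: (mxip x y) (hs x) (hs y) => c p q; rewrite /Num.conj /=.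
by case: c => a b /=; lra.
Qed.

(** Summability is a boolean field, so its proofs are irrelevant and equality is that of
    families. *)
Record hsum := HSum { hsum_fun :> fam; _ : `[< square_summable hsum_fun >] }.

Lemma hsumP (z : hsum) : square_summable z.
Proof. by case: z => z zP; apply/asboolP. Qed.

Lemma hsum_eq (z w : hsum) : (forall t, z t = w t) -> z = w.
Proof.
case: z w => z zP [w wP] /= zw.
have E : z = w by apply: functional_extensionality_dep.
by subst w; rewrite (bool_irrelevance zP wP).
Qed.

HB.instance Definition _ := gen_eqMixin hsum.
HB.instance Definition _ := gen_choiceMixin hsum.

Lemma square_summable0 : square_summable (fun t => 0).
Proof. by exists 0 => A; rewrite /partial_hs big1 // => t _; rewrite hs0. Qed.

Lemma square_summableD (z w : hsum) : square_summable (fun t => z t + w t).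
Proof.
have [M zM] := hsumP z; have [M' wM] := hsumP w; exists (2 * (M + M')) => A.
apply: (@le_trans _ _ (2 * (partial_hs z A + partial_hs w A))).
  rewrite /partial_hs -big_split mulr_sumr; apply: ler_sum => t _.
  exact: hs_addr_le.
by rewrite ler_pM2l // lerD.
Qed.

Lemma square_summableZ c (z : hsum) : square_summable (fun t => c *: z t).
Proof.
have [M zM] := hsumP z; exists (Normc.normc c ^+ 2 * M) => A.
rewrite /partial_hs; under eq_bigr do rewrite hsZ.
by rewrite -mulr_sumr; apply: ler_wpM2l (zM A); exact: sqr_ge0.
Qed.

Lemma square_summableN (z : hsum) : square_summable (fun t => - z t).
Proof.
have [M zM] := square_summableZ (-1) z; exists M => A.
rewrite (_ : partial_hs _ A = partial_hs (fun t => -1 *: z t) A) //.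
by apply: eq_bigr => t _; rewrite scaleN1r.
Qed.

Definition hsum_zero := HSum (asboolT square_summable0).
Definition hsum_add z w := HSum (asboolT (square_summableD z w)).
Definition hsum_opp z := HSum (asboolT (square_summableN z)).
Definition hsum_scale c z := HSum (asboolT (square_summableZ c z)).

Lemma hsum_addA : associative hsum_add.
Proof. by move=> x y z; apply: hsum_eq => t /=; rewrite addrA. Qed.
Lemma hsum_addC : commutative hsum_add.
Proof. by move=> x y; apply: hsum_eq => t /=; rewrite addrC. Qed.
Lemma hsum_add0 : left_id hsum_zero hsum_add.
Proof. by move=> x; apply: hsum_eq => t /=; rewrite add0r. Qed.
Lemma hsum_addN : left_inverse hsum_zero hsum_opp hsum_add.
Proof. by move=> x; apply: hsum_eq => t /=; rewrite addNr. Qed.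

HB.instance Definition _ := GRing.isZmodule.Build hsum
  hsum_addA hsum_addC hsum_add0 hsum_addN.

Lemma hsum_scaleA a b z : hsum_scale a (hsum_scale b z) = hsum_scale (a * b) z.
Proof. by apply: hsum_eq => t /=; rewrite scalerA. Qed.
Lemma hsum_scale1 : left_id 1 hsum_scale.
Proof. by move=> z; apply: hsum_eq => t /=; rewrite scale1r. Qed.
Lemma hsum_scaleDr : right_distributive hsum_scale +%R.
Proof. by move=> c z w; apply: hsum_eq => t /=; rewrite scalerDr. Qed.
Lemma hsum_scaleDl z : {morph hsum_scale^~ z : a b / a + b}.
Proof. by move=> a b; apply: hsum_eq => t /=; rewrite scalerDl. Qed.

HB.instance Definition _ := GRing.Zmodule_isLmodule.Build C hsum
  hsum_scaleA hsum_scale1 hsum_scaleDr hsum_scaleDl.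

Definition partial_ip (z w : fam) (A : finseq T) : C :=
  \sum_(t <- sval A) mxip (z t) (w t).

Lemma normc_mxip_le m k (x y : 'M[C]_(m, k)) : Normc.normc (mxip x y) <= hs x + hs y.
Proof.
have [u u1 uE] := exists_phase (mxip x y).
have := Re_mxip_le_hs (u *: x) y; rewrite mxipZl uE hsZ u1 expr1n mul1r /=.
have := normc_ge0 (mxip x y); move: (Normc.normc _) (hs x) (hs y) => p q r; lra.
Qed.

Lemma partial_ip_bounded (z w : hsum) : cbounded (partial_ip z w).
Proof.
have [M zM] := hsumP z; have [M' wM] := hsumP w; exists (M + M') => A.
apply: le_trans (normc_sum _ _) _.
apply: (@le_trans _ _ (partial_hs z A + partial_hs w A)); last exact: lerD.
rewrite /partial_hs -big_split; apply: ler_sum => t _; exact: normc_mxip_le.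
Qed.

(* The mean over the finite subsets stands for the sum of the unconditionally
   convergent series. *)
Definition hsum_ip (z w : hsum) : C := cmean (@finite_mean T R) (partial_ip z w).

Let mL := finite_meanP T R.

Lemma hsum_ipDl x y z : hsum_ip (x + y) z = hsum_ip x z + hsum_ip y z.
Proof.
rewrite /hsum_ip -(cmeanD mL); try exact: partial_ip_bounded.
congr cmean; apply/funext => A; rewrite /partial_ip -big_split.
by apply: eq_bigr => t _; rewrite mxipDl.
Qed.

Lemma hsum_ipZl c x z : hsum_ip (c *: x) z = c * hsum_ip x z.
Proof.
rewrite /hsum_ip -(cmeanM mL); last exact: partial_ip_bounded.
congr cmean; apply/funext => A; rewrite /partial_ip mulr_sumr.
by apply: eq_bigr => t _; rewrite mxipZl.
Qed.

Lemma hsum_ipC x y : hsum_ip x y = Num.conj (hsum_ip y x).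
Proof.
rewrite /hsum_ip /cmean.
have E A : partial_ip x y A = Num.conj (partial_ip y x A).
  by rewrite /partial_ip rmorph_sum; apply: eq_bigr => t _; rewrite mxip_conj.
rewrite (funext E); set h := partial_ip y x.
have hb : bounded_fun (fun A => Im (h A)).
  by apply: bounded_Im; exact: partial_ip_bounded.
rewrite -[RHS]/(_ +i* (- _)); congr (_ +i* _).
  by congr (finite_mean _); apply/funext => A; case: (h A).
rewrite -mulN1r -(meanZ mL) //; congr (finite_mean _); apply/funext => A.
by rewrite mulN1r; case: (h A).
Qed.

Lemma hsum_ipDr x y z : hsum_ip z (x + y) = hsum_ip z x + hsum_ip z y.
Proof.
by rewrite hsum_ipC hsum_ipDl rmorphD /= -!hsum_ipC.
Qed.

Lemma hsum_ipZr c x z : hsum_ip z (c *: x) = Num.conj c * hsum_ip z x.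
Proof. by rewrite hsum_ipC hsum_ipZl rmorphM /= -(hsum_ipC z x). Qed.

Definition hsum_sq (z : hsum) : R := finite_mean (partial_hs z).

Lemma partial_hs_bounded (z : hsum) : bounded_fun (partial_hs z).
Proof.
by have [M zM] := hsumP z; exists M => A; rewrite ger0_norm ?partial_hs_ge0.
Qed.

Lemma hsum_ip_self z : hsum_ip z z = (hsum_sq z)%:C.
Proof.
have E A : partial_ip z z A = (partial_hs z A)%:C.
  by rewrite /partial_ip rmorph_sum; apply: eq_bigr => t _; rewrite mxip_hs.
by rewrite /hsum_ip /cmean (funext E) /= (mean_cst mL).
Qed.

(** Partial sums increase with the finite set, so from [A] on they exceed the constant
    [partial_hs z A], and the mean respects this. With [hsum_sq_le], [hsum_sq] is the supremum of
    the partial sums. *)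
Lemma partial_hs_le_sq (z : hsum) A : partial_hs z A <= hsum_sq z.
Proof.
rewrite -subr_ge0 -[X in _ - X](mean_cst mL) -[X in _ + X]mulN1r -(meanZ mL); last first.
  by exists `|partial_hs z A|.
rewrite -(meanD mL); first last.
- by exists `|-1 * partial_hs z A|.
- exact: partial_hs_bounded.
apply: finite_mean_ge0; split.
  apply: bounded_funD; first exact: partial_hs_bounded.
  by exists `|-1 * partial_hs z A|.
exists A => B AB; rewrite mulN1r subr_ge0 /partial_hs.
apply: (sum_subset_le _ (proj2_sig A) (proj2_sig B) AB) => t.
exact: hs_ge0.
Qed.

Lemma hsum_sq_le (z : hsum) M : (forall A, partial_hs z A <= M) -> hsum_sq z <= M.
Proof.
move=> zM; rewrite -[leRHS](mean_cst mL); apply: (mean_le mL) => //.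
  exact: partial_hs_bounded.
by exists `|M|.
Qed.

End HilbertSum.

Section HilbertSumSpace.
Variables (R : realType) (T : choiceType) (n : T -> nat).
Local Notation C := R[i].
Local Notation hsum := (hsum R n).

Lemma hsum_ip_bilinear : bilinear_for
  (GRing.Scale.Law.clone _ _ *%R _) (GRing.Scale.Law.clone _ _ (Num.conj \; *%R) _)
  (@hsum_ip R T n).
Proof.
split=> u c x y /=.
  by rewrite hsum_ipDl hsum_ipZl.
by rewrite hsum_ipDr hsum_ipZr.
Qed.

HB.instance Definition _ := bilinear_isBilinear.Build C hsum hsum C
  _ _ (@hsum_ip R T n) hsum_ip_bilinear.

Lemma hsum_ip_herm (x y : hsum) :
  hsum_ip x y = (-1) ^+ false * Num.conj (hsum_ip y x) :> C.
Proof. by rewrite expr0 mul1r hsum_ipC. Qed.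

HB.instance Definition _ := isHermitianSesquilinear.Build C hsum false Num.conj
  (@hsum_ip R T n) hsum_ip_herm.

Lemma hsum_ip_pos (z : hsum) : z != 0 -> 0 < hsum_ip z z.
Proof.
move=> z0; rewrite hsum_ip_self ltcR lt_def; apply/andP; split; last first.
  by apply: le_trans (partial_hs_le_sq z (exist _ [::] isT)); exact: partial_hs_ge0.
apply: contraNN z0 => /eqP zz; apply/eqP/hsum_eq => t.
apply: hs_eq0; apply/eqP; rewrite eq_le hs_ge0 andbT.
have := partial_hs_le_sq z (exist _ [:: t] isT).
by rewrite zz /partial_hs big_seq1.
Qed.

HB.instance Definition _ := isDotProduct.Build C hsum (@hsum_ip R T n) hsum_ip_pos.

Definition hsum_dot : {dot hsum for Num.conj} := @hsum_ip R T n.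

Lemma hsum_dot_norm z : dot_norm hsum_dot z = Num.sqrt (hsum_sq z).
Proof.
rewrite /dot_norm; have -> : hsum_dot z z = (hsum_sq z)%:C by exact: hsum_ip_self.
by [].
Qed.

Lemma hsum_sq_ge0 (z : hsum) : 0 <= hsum_sq z.
Proof.
apply: le_trans (partial_hs_le_sq z (exist _ [::] isT)).
exact: partial_hs_ge0.
Qed.

Lemma hsum_sq_lt (z : hsum) e : 0 < e -> dot_norm hsum_dot z < e -> hsum_sq z <= e ^+ 2.
Proof.
move=> e0; rewrite hsum_dot_norm => /ltW.
by rewrite -(@ler_pXn2r _ 2) ?nnegrE ?sqrtr_ge0 ?(ltW e0) // sqr_sqrtr ?hsum_sq_ge0.
Qed.

(* The limit is the entrywise mean of the sequence; since
   hs u = sup_w (2 Re <u, w> - hs w), the partial sums of squares are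
   semicontinuous for it. *)
Lemma hsum_complete (x : nat -> hsum) :
  (forall e, 0 < e -> exists N, forall m k, (N <= m)%N -> (N <= k)%N ->
     dot_norm hsum_dot (x m - x k) < e) ->
  exists l, forall e, 0 < e -> exists N, forall m, (N <= m)%N ->
     dot_norm hsum_dot (x m - l) < e.
Proof.
move=> cauchy; have [N1 cN1] := cauchy 1 ltr01.
have [L mL LG] := sequence_mean_exists R.
(* The tail lies within distance 1 of [x N1], which bounds its entries at every index, as the mean
   requires. *)
pose y m := x (N1 + m)%N.
have yb t i : cbounded (fun m => y m t i 0).
  exists (2 * (1 + hs (x N1 t)) + 1) => m.
  have q1 : hs (y m t - x N1 t) <= 1.
    have := hsum_sq_lt ltr01 (cN1 (N1 + m)%N N1 (leq_addr _ _) (leqnn _)).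
    rewrite expr1n; apply: le_trans.
    have := partial_hs_le_sq (y m - x N1) (exist _ [:: t] isT).
    by rewrite /partial_hs big_seq1.
  have q2 : hs (y m t) <= 2 * (1 + hs (x N1 t)).
    rewrite -[y m t](subrK (x N1 t)); apply: le_trans (hs_addr_le _ _) _.
    by rewrite ler_pM2l // lerD2r.
  have q3 : Normc.normc (y m t i 0) ^+ 2 <= hs (y m t).
    rewrite /hs (bigD1 i) //= big_ord1 lerDl.
    by apply: sumr_ge0 => ? _; rewrite big_ord1 sqr_ge0.
  have := le_trans q3 q2; have := normc_ge0 (y m t i 0).
  move: (Normc.normc _) (2 * _) => p q p0 pq.
  have : 0 <= (p - 1) ^+ 2 by exact: sqr_ge0.
  by rewrite expr2 in pq *; nra.
pose l t : 'cV[C]_(n t) := \col_i cmean L (fun m => y m t i 0).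
have mxipE t (u : 'cV[C]_(n t)) (m0 : nat) :
    cbounded (fun m => mxip (x m0 t - y m t) u) /\
    mxip (x m0 t - l t) u = cmean L (fun m => mxip (x m0 t - y m t) u).
  have sumE (v : 'cV[C]_(n t)) : mxip v u = \sum_i Num.conj (u i 0) * v i 0.
    by rewrite mxip_colE mxE; apply: eq_bigr => i _; rewrite !mxE.
  have bb i : cbounded (fun m => Num.conj (u i 0) * (x m0 t i 0 + (-1) * y m t i 0)).
    apply: cboundedM; apply: cboundedD; last exact: cboundedM.
    by exists (Normc.normc (x m0 t i 0)).
  have E : (fun m => mxip (x m0 t - y m t) u) =
      (fun m => \sum_i Num.conj (u i 0) * (x m0 t i 0 + (-1) * y m t i 0)).
    apply/funext => m; rewrite sumE; apply: eq_bigr => i _.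
    by rewrite !mxE mulN1r.
  rewrite E; split; first exact: cbounded_sum.
  rewrite (cmean_sum mL) // sumE; apply: eq_bigr => i _.
  rewrite (cmeanM mL); last first.
    apply: cboundedD; last exact: cboundedM.
    by exists (Normc.normc (x m0 t i 0)).
  congr (_ * _); rewrite (cmeanD mL); first last.
  - exact: cboundedM.
  - by exists (Normc.normc (x m0 t i 0)).
  rewrite (cmeanM mL) // !mxE mulN1r; congr (_ - _).
  rewrite /cmean !(mean_cst mL).
  by case: (x m0 t i 0).
(* With [u = x_m - l] and [S] the partial sum of [|u|^2], averaging [2 Re <x_m - y_k, u> <= |x_m -
   y_k|^2 + |u|^2] over [k] gives [2 S <= e^2 + S]. *)
have close e N : 0 < e -> (forall m k, (N <= m)%N -> (N <= k)%N ->
    dot_norm hsum_dot (x m - x k) < e) -> forall m (A : finseq T), (N <= m)%N ->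
    \sum_(t <- sval A) hs (x m t - l t) <= e ^+ 2.
  move=> e0 cN m A Nm; pose u t := x m t - l t.
  pose h k := \sum_(t <- sval A) mxip (x m t - y k t) (u t).
  have hb : cbounded h by apply: cbounded_sum => t; case: (mxipE t (u t) m).
  have hE : (\sum_(t <- sval A) hs (u t))%:C = cmean L h.
    rewrite /h (cmean_sum mL); last by move=> t; case: (mxipE t (u t) m).
    rewrite rmorph_sum; apply: eq_bigr => t _.
    by case: (mxipE t (u t) m) => _ <-; rewrite mxip_hs.
  set S := \sum_(t <- _) _; have SE : S = L (fun k => Re (h k)).
    by have := congr1 (@complex.Re R) hE.
  have bS : bounded_fun (fun k => 2 * Re (h k)).
    by apply: bounded_funZ; exact: bounded_Re.
  have bc (r : R) : bounded_fun (fun _ : nat => r) by exists `|r|.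
  have le : 2 * S <= e ^+ 2 + S.
    rewrite {1}SE -(meanZ mL _ (bounded_Re hb)) -subr_ge0.
    have := LG (fun k => (e ^+ 2 + S) + -1 * (2 * Re (h k))).
    rewrite (meanD mL (bc _) (bounded_funZ _ bS)) (mean_cst mL) (meanZ mL _ bS) mulN1r.
    apply.
      by apply: bounded_funD; [exact: bc|exact: bounded_funZ].
    exists N => k Nk; rewrite mulN1r subr_ge0.
    apply: (@le_trans _ _ (\sum_(t <- sval A) hs (x m t - y k t) + S)).
      rewrite /h raddf_sum mulr_sumr /S -big_split; apply: ler_sum => t _.
      exact: Re_mxip_le_hs.
    rewrite lerD2r.
    have := hsum_sq_lt e0 (cN m (N1 + k)%N Nm (leq_trans Nk (leq_addl _ _))).
    by apply: le_trans; exact: partial_hs_le_sq (x m - y k) A.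
  by move: le; rewrite mulr_natl mulr2n lerD2r.
have lsq : square_summable l.
  exists (2 * (1 + hsum_sq (x N1))) => A.
  apply: (@le_trans _ _ (2 * (\sum_(t <- sval A) hs (x N1 t - l t) + partial_hs (x N1) A))).
    rewrite /partial_hs -big_split mulr_sumr; apply: ler_sum => t _.
    rewrite -{1}[l t](subKr (x N1 t)) [_ - (_ - _)]addrC.
    apply: le_trans (hs_addr_le _ _) _.
    by rewrite -scaleN1r hsZ -(rmorphN1 (real_complex R)) normc_real_sq sqrrN expr1n mul1r.
  rewrite ler_pM2l // lerD //; last exact: partial_hs_le_sq.
  by have := close 1 N1 ltr01 cN1 N1 A (leqnn _); rewrite expr1n.
exists (HSum (asboolT lsq)) => e e0.
have [|N cN] := cauchy (e / 2); first by rewrite divr_gt0.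
exists N => m Nm; rewrite hsum_dot_norm.
apply: (@le_lt_trans _ _ (e / 2)); last by rewrite ltr_pdivrMr // ltr_pMr // ltr1n.
rewrite -[leRHS]ger0_norm ?divr_ge0 ?(ltW e0) // -sqrtr_sqr ler_sqrt ?sqr_ge0 //.
apply: hsum_sq_le => A; apply: (close _ N) => //.
by rewrite divr_gt0.
Qed.

Definition hsum_space : hilbertSpace R := HilbertSpace hsum_complete.

End HilbertSumSpace.

(** * The representation by all matrix states *)

Section SumLemmas.

Lemma sum_single (M : nmodType) (I : eqType) (A : seq I) (F : I -> M) i0 :
  uniq A -> (forall i, i != i0 -> F i = 0) ->
  \sum_(i <- A) F i = if i0 \in A then F i0 else 0.
Proof.
move=> uA F0; case: ifP => iA.
  by rewrite (bigD1_seq i0) //= big1 ?addr0.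
rewrite big_seq big1 // => i iA'; apply: F0.
by apply: contraFneq iA => <-.
Qed.

Lemma finite_mean_eventually (R : realType) (T : choiceType) (g : finseq T -> R) c
    (A : finseq T) : bounded_fun g ->
  (forall B : finseq T, {subset sval A <= sval B} -> g B = c) -> finite_mean g = c.
Proof.
have mL := finite_meanP T R => gb gc.
have bc (r : R) : bounded_fun (fun _ : finseq T => r) by exists `|r|.
have ge (s r : R) : s * c = r -> r <= s * finite_mean g.
  move=> sc; rewrite -(meanZ mL) // -subr_ge0 -[X in _ - X](mean_cst mL) -mulN1r.
  rewrite -(meanZ mL) // -(meanD mL); first last.
  - by apply: bounded_funZ.
  - by apply: bounded_funZ.
  apply: finite_mean_ge0; split.
    by apply: bounded_funD; apply: bounded_funZ.
  by exists A => B AB; rewrite gc // sc mulN1r subrr.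
apply/eqP; rewrite eq_le; apply/andP; split.
  by have := ge (-1) (- c) (mulN1r _); rewrite mulN1r lerN2.
by have := ge 1 c (mul1r _); rewrite mul1r.
Qed.

End SumLemmas.

Section Representation.
Variables (R : realType) (X : lmodType R[i]) (nX : mxnorm X) (u : X).
Arguments nX : clear implicits.
Local Notation C := R[i].
Hypothesis mX : matricially_normed nX.
Let cX := matricially_normed_compressible mX.

(** States of every size index the direct sum; those of size 0 contribute zero summands. *)
Record state := State {
  state_dim : nat;
  state_map :> {linear X -> 'M[C]_state_dim};
  stateP : mxstate nX u state_map }.

HB.instance Definition _ := gen_eqMixin state.
HB.instance Definition _ := gen_choiceMixin state.

Local Notation K := (hsum_space R state_dim).

Lemma state_bound (t : state) : cb_bound nX t 1.
Proof. by have [] := proj1 (mxstate_bound cX u t) (stateP t). Qed.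

Lemma state_unit (t : state) : t u = 1%:M.
Proof. by have [] := proj1 (mxstate_bound cX u t) (stateP t). Qed.

Lemma form_const_mx N (A : 'M[C]_N) (al be : 'rV[C]_N) :
  form (const_mx A : 'M_1) al be = mxip (A *m al^T) be^T.
Proof.
rewrite formE !big_ord1 mxip_colE mulmxA [RHS]mxE exchange_big.
apply: eq_bigr => b _; rewrite !mxE mulr_suml; apply: eq_bigr => a _.
by rewrite !mxE.
Qed.

Lemma state_opnorm_le (t : state) y : opnorm (t y) <= vnorm nX y.
Proof.
apply: opnorm_le => [|x z]; first exact: compressible_ge0 cX _ _.
have := @state_bound t 1%N (const_mx y) x^T z^T.
by rewrite map_const_mx form_const_mx !trmxK !hsT mul1r.
Qed.

Definition rep_fam y (z : K) t : 'cV[C]_(state_dim t) := t y *m (z : hsum R state_dim) t.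

Lemma rep_fam_le y (z : K) A :
  partial_hs (rep_fam y z) A <= vnorm nX y ^+ 2 * partial_hs (z : hsum R state_dim) A.
Proof.
rewrite /partial_hs mulr_sumr; apply: ler_sum => t _.
apply: le_trans (hs_mulmx_le _ _) _; rewrite ler_wpM2r ?hs_ge0 //.
by rewrite ler_pXn2r ?nnegrE ?opnorm_ge0 ?state_opnorm_le // (compressible_ge0 cX).
Qed.

Lemma rep_square_summable y (z : K) : square_summable (rep_fam y z).
Proof.
have [M zM] := hsumP (z : hsum R state_dim).
exists (vnorm nX y ^+ 2 * M) => A; apply: le_trans (rep_fam_le _ _ _) _.
by rewrite ler_wpM2l ?sqr_ge0.
Qed.

Definition rep_fun y (z : K) : K := HSum (asboolT (rep_square_summable y z)).

Lemma rep_bounded y : rep_fun y \in @bounded_operator R K.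
Proof.
rewrite inE; split.
  by move=> c z w; apply: hsum_eq => t /=; rewrite /rep_fam mulmxDr -scalemxAr.
exists (vnorm nX y) => z.
have v0 : 0 <= vnorm nX y by exact: compressible_ge0 cX _ _.
rewrite /hnorm !hsum_dot_norm -{1}[vnorm nX y]ger0_norm // -sqrtr_sqr -sqrtrM ?sqr_ge0 //.
rewrite ler_sqrt; last by rewrite mulr_ge0 ?sqr_ge0 ?hsum_sq_ge0.
apply: hsum_sq_le => A; apply: le_trans (rep_fam_le _ _ _) _.
by rewrite ler_wpM2l ?sqr_ge0 // partial_hs_le_sq.
Qed.

Definition rep y : bop K := Bop (rep_bounded y).

Lemma rep_linear : linear rep.
Proof.
move=> c y w; apply: val_inj; apply/funext => z /=; apply: hsum_eq => t /=.
by rewrite /rep_fam linearP mulmxDl -scalemxAl.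
Qed.

HB.instance Definition _ := GRing.isLinear.Build C X (bop K) *:%R rep rep_linear.

Lemma rep_unit (z : K) : rep u z = z.
Proof. by apply: hsum_eq => t /=; rewrite /rep_fam state_unit mul1mx. Qed.

Section Fibers.
Variable k : nat.
Implicit Types (x z : 'cV[K]_k) (y : 'M[X]_k).

(** The components of [x] in the summand [t], one row per coordinate, in the shape that [form]
    takes. *)
Definition fiber x (t : state) : 'M[C]_(k, state_dim t) :=
  \matrix_(i, a) (x i 0 : hsum R state_dim) t a 0.

Lemma hsum_sum_fun (I : Type) (r : seq I) (F : I -> hsum R state_dim) t :
  (\sum_(i <- r) F i) t = \sum_(i <- r) F i t.
Proof.
elim: r => [|i r IH]; first by rewrite !big_nil.
by rewrite !big_cons -IH.
Qed.

Let mL := finite_meanP state R.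

Lemma hsq_fiber x : bounded_fun (fun A : finseq state => \sum_(t <- sval A) hs (fiber x t)) /\
  hsq x = finite_mean (fun A : finseq state => \sum_(t <- sval A) hs (fiber x t)).
Proof.
have E : (fun A : finseq state => \sum_(t <- sval A) hs (fiber x t)) =
    (fun A => \sum_i partial_hs (x i 0 : hsum R state_dim) A).
  apply/funext => A; rewrite /partial_hs [RHS]exchange_big; apply: eq_bigr => t _.
  rewrite /hs; apply: eq_bigr => i _; apply: eq_bigr => a _.
  by rewrite big_ord1 mxE.
have sqE : hsq x = \sum_i finite_mean (partial_hs (x i 0 : hsum R state_dim)).
  apply: eq_bigr => i _; rewrite /hnorm hsum_dot_norm sqr_sqrtr //.
  exact: hsum_sq_ge0.
rewrite E sqE; elim: (index_enum _) => [|i r [bIH IH]].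
  rewrite big_nil; split; first by exists 0 => A; rewrite big_nil normr0.
  by rewrite -[LHS](mean_cst mL); congr finite_mean; apply/funext => A; rewrite big_nil.
have -> : (fun A : finseq state => \sum_(i <- i :: r) partial_hs (x i 0 : hsum R state_dim) A) =
    (fun A => partial_hs (x i 0 : hsum R state_dim) A +
      \sum_(i <- r) partial_hs (x i 0 : hsum R state_dim) A).
  by apply/funext => A; rewrite big_cons.
have bi := partial_hs_bounded (x i 0 : hsum R state_dim).
split; first exact: bounded_funD.
by rewrite big_cons (meanD mL) // IH.
Qed.

(** The operators act diagonally, so a form on K^k is the mean of finite sums of forms of the
    states; with [hsq_fiber], inequalities valid for each state pass to the direct sum. *)
Lemma hdotk_fiber y x z :
  cbounded (fun A : finseq state => \sum_(t <- sval A) form (map_mx t y) (fiber x t) (fiber z t)) /\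
  hdotk (bopmx_app (map_mx rep y) x) z = cmean (@finite_mean state R)
    (fun A : finseq state => \sum_(t <- sval A) form (map_mx t y) (fiber x t) (fiber z t)).
Proof.
pose p i := bopmx_app (map_mx rep y) x i 0 : hsum R state_dim.
have E : (fun A : finseq state => \sum_(t <- sval A)
      form (map_mx t y) (fiber x t) (fiber z t)) =
    (fun A => \sum_i partial_ip (p i) (z i 0 : hsum R state_dim) A).
  apply/funext => A; rewrite /partial_ip [RHS]exchange_big; apply: eq_bigr => t _.
  rewrite formE; apply: eq_bigr => i _.
  have pE : p i t = \sum_l t (y i l) *m (x l 0 : hsum R state_dim) t.
    rewrite /p mxE hsum_sum_fun; apply: eq_bigr => l _.
    by rewrite mxE.
  rewrite mxip_colE pE mulmx_sumr summxE.
  apply: eq_bigr => l _; rewrite mulmxA [RHS]mxE exchange_big.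
  apply: eq_bigr => b _; rewrite !mxE mulr_suml; apply: eq_bigr => a _.
  by rewrite !mxE.
have bp i : cbounded (partial_ip (p i) (z i 0 : hsum R state_dim)).
  exact: partial_ip_bounded.
rewrite E; split; first exact: cbounded_sum.
by rewrite (cmean_sum mL).
Qed.

Lemma rep_norm_le y : bop_norm K k (map_mx rep y) <= nX k y.
Proof.
have y0 := matricial_norm_ge0 mX y.
apply: bop_norm_le => // x z.
have [bf ->] := hdotk_fiber y x z.
have [bx ->] := hsq_fiber x; have [bz ->] := hsq_fiber z.
rewrite /cmean /= -(meanZ mL _ (bounded_Re bf)) -(meanD mL bx bz).
rewrite -(meanZ mL _ (bounded_funD bx bz)); apply: (mean_le mL).
- by apply: bounded_funZ; exact: bounded_Re.
- by apply: bounded_funZ; exact: bounded_funD.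
move=> A; rewrite raddf_sum mulr_sumr -big_split mulr_sumr.
apply: ler_sum => t _; rewrite -[nX k y]mul1r; exact: state_bound.
Qed.

Lemma delta_square_summable (t0 : state) (w : 'cV[C]_(state_dim t0)) :
  square_summable (dfwith (fun t : state => 0 : 'cV[C]_(state_dim t)) w).
Proof.
exists (hs w) => A; rewrite /partial_hs (sum_single (i0 := t0) (proj2_sig A)).
  by case: ifP => _; rewrite ?dfwith_in ?hs_ge0.
by move=> t tt0; rewrite dfwith_out ?hs0 // eq_sym.
Qed.

Definition delta_vector (t0 : state) (al : 'M[C]_(k, state_dim t0)) : 'cV[K]_k :=
  \col_i HSum (asboolT (delta_square_summable (row i al)^T)).

Lemma fiber_delta_in t0 (al : 'M[C]_(k, state_dim t0)) :
  fiber (delta_vector al) t0 = al.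
Proof. by apply/matrixP => i a; rewrite !mxE /= dfwith_in !mxE. Qed.

Lemma fiber_delta_out t0 (al : 'M[C]_(k, state_dim t0)) t : t != t0 ->
  fiber (delta_vector al) t = 0.
Proof.
by move=> tt0; apply/matrixP => i a; rewrite !mxE /= dfwith_out 1?eq_sym // mxE.
Qed.

(** Vectors supported on the summand [t0] see only that state: all the means involved are constant
    once the finite set contains [t0]. *)
Lemma state_norm_le_rep y (t0 : state) :
  Mn_norm (state_dim t0) k (map_mx t0 y) <= bop_norm K k (map_mx rep y).
Proof.
apply: Mn_norm_le => [|al be]; first exact: bop_norm_ge0.
pose A0 : finseq state := exist _ [:: t0] isT.
have sub (B : finseq state) : {subset sval A0 <= sval B} -> t0 \in sval B.
  by apply; rewrite inE.
have hsqE (ga : 'M[C]_(k, state_dim t0)) : hsq (delta_vector ga) = hs ga.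
  have [b ->] := hsq_fiber (delta_vector ga).
  apply: (finite_mean_eventually (A := A0)) => // B /sub tB.
  rewrite (sum_single (i0 := t0) (proj2_sig B)); first by rewrite tB fiber_delta_in.
  by move=> t tt0; rewrite fiber_delta_out ?hs0.
have := bop_norm_ge_form (map_mx rep y) (delta_vector al) (delta_vector be).
rewrite !hsqE; have [b ->] := hdotk_fiber y (delta_vector al) (delta_vector be).
rewrite /cmean /= (finite_mean_eventually (A := A0) (c := Re (form (map_mx t0 y) al be))) //.
  exact: bounded_Re.
move=> B /sub tB; congr Re.
rewrite (sum_single (i0 := t0) (proj2_sig B)); first by rewrite tB !fiber_delta_in.
by move=> t tt0; rewrite fiber_delta_out // form0l.
Qed.

End Fibers.

Hypothesis norming : forall k (y : 'M[X]_k), nX k y = 1 ->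
  exists t : state, 1 <= Mn_norm (state_dim t) k (map_mx t y).

Lemma rep_isometry : complete_isometry nX (bop_norm K) rep.
Proof.
move=> k y; apply/eqP; rewrite eq_le rep_norm_le /=.
have [->|yn] := eqVneq (nX k y) 0; first exact: bop_norm_ge0.
have y0 : 0 < nX k y by rewrite lt_def yn matricial_norm_ge0.
pose w := map_mx ( *:%R (nX k y)^-1%:C) y.
have w1 : nX k w = 1 by rewrite (compressibleZ cX) ?invr_gt0 // mulVf ?gt_eqF.
have [t le] := norming w1.
have le1 : 1 <= bop_norm K k (map_mx rep w) := le_trans le (state_norm_le_rep w t).
have le2 : bop_norm K k (map_mx rep w) <= (nX k y)^-1 * bop_norm K k (map_mx rep y).
  apply: bop_norm_le => [|x z].
    by rewrite mulr_ge0 ?bop_norm_ge0 // invr_ge0 ltW.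
  have -> : bopmx_app (map_mx rep w) x =
      map_mx ( *:%R (nX k y)^-1%:C) (bopmx_app (map_mx rep y) x).
    apply/matrixP => i l; rewrite !mxE scaler_sumr; apply: eq_bigr => j _.
    by rewrite !mxE linearZ.
  rewrite hdotkZl ReMr mulrCA -mulrA ler_pM2l ?invr_gt0 //.
  exact: bop_norm_ge_form.
have := le_trans le1 le2; rewrite (ler_pdivlMl _ _ y0) mulr1.
exact.
Qed.

Lemma rep_adjoint y w : (forall t : state, t w = (mxconj (t y))^T) ->
  is_adjoint (rep w) (rep y).
Proof.
move=> adj x z; rewrite -[LHS]/(hsum_ip _ _) -[RHS]/(hsum_ip _ _).
congr cmean; apply/funext => A; apply: eq_bigr => t _.
by rewrite /= /rep_fam mxip_mulmx adj.
Qed.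

End Representation.

(** * The quotient of an operator system *)

Section QuotientSystem.
Variables (R : realType) (V : lmodType R[i]) (nV : mxnorm V) (W : submodClosed V).
Arguments nV : clear implicits.
Local Notation C := R[i].
Local Notation Q := (quot_map W).
Local Notation nQ := (quot_norm W nV).
Variable e : V.
Variables (K : hilbertSpace R) (Phi : {linear V -> bop K}).
Hypothesis mV : matricially_normed nV.
Hypothesis iso : complete_isometry nV (bop_norm K) Phi.
Hypothesis Phi1 : forall x, Phi e x = x.
Hypothesis mQ : matricially_normed nQ.

Variable t : state nQ (Q e).
Variable z : 'rV[C]_(state_dim t).

(** The vector functional of the state [t] at [z] is pulled back to [V], where the adjoints are
    given; its bound [hs z] is its value at [e]. *)
Definition vector_functional (v : V) : C^o := form (const_mx (t (Q v)) : 'M_1) z z.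

Lemma vector_functional_linear : linear vector_functional.
Proof.
move=> c v w; rewrite /vector_functional -[X in _ = X + _]/(c * form _ _ _).
rewrite -formZ -formD; congr (form _ z z).
by apply/matrixP => i j; rewrite (linearP (quot_map W)) (linearP t) !mxE.
Qed.

HB.instance Definition _ :=
  GRing.isLinear.Build C V C^o *:%R vector_functional vector_functional_linear.

Lemma vector_functional_le v :
  Normc.normc (vector_functional v) <= hs z * vnorm nV v.
Proof.
have [c c1 cE] := exists_phase (vector_functional v).
have := @state_bound _ _ _ _ mQ t 1%N (const_mx (Q v)) (c *: z) z.
rewrite map_const_mx formZl [c * _]cE hsZ c1 expr1n !mul1r /= => le.
have q : vnorm nQ (Q v) <= vnorm nV v.
  by rewrite /vnorm -(map_const_mx Q); exact: quot_norm_le.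
have := ler_wpM2l (hs_ge0 z) q; move: le; rewrite -/(vnorm nQ (Q v)).
by move: (Normc.normc _) (vnorm nQ _) (hs z) (vnorm nV v) => a b c' d; nra.
Qed.

Lemma vector_functional_unit : vector_functional e = (hs z)%:C.
Proof. by rewrite /vector_functional (state_unit mQ) form_const_mx mul1mx mxip_hs hsT. Qed.

Lemma vector_functional_adj v w : is_adjoint (Phi w) (Phi v) ->
  vector_functional w = Num.conj (vector_functional v).
Proof.
exact: (adjoint_conj iso Phi1 (s := vector_functional)
  vector_functional_le vector_functional_unit).
Qed.

End QuotientSystem.

(** The difference of the two sides has zero quadratic form by [vector_functional_adj], and a
    complex matrix with zero quadratic form is 0 by polarization. *)
Lemma state_adjoint (R : realType) (V : lmodType R[i]) (nV : mxnorm V)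
    (W : submodClosed V) (e : V) (K : hilbertSpace R) (Phi : {linear V -> bop K})
    (t : state (quot_norm W nV) (quot_map W e)) v w :
  matricially_normed nV -> complete_isometry nV (bop_norm K) Phi ->
  (forall x, Phi e x = x) -> matricially_normed (quot_norm W nV) ->
  is_adjoint (Phi w) (Phi v) ->
  t (quot_map W w) = (mxconj (t (quot_map W v)))^T.
Proof.
move=> mV iso Phi1 mQ adj; apply/eqP; rewrite -subr_eq0; apply/eqP.
set D := _ - _.
have D0 (z : 'rV_(state_dim t)) : form (const_mx D : 'M_1) z z = 0.
  have -> : const_mx D = const_mx (t (quot_map W w)) +
      map_mx ( *:%R (-1)) (const_mx (mxconj (t (quot_map W v)))^T) :> 'M_1.
    by apply/matrixP => i j; rewrite !mxE scaleN1r.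
  rewrite formD formZ form_adj mulN1r.
  have := vector_functional_adj mV iso Phi1 mQ z adj.
  by rewrite /vector_functional => ->; rewrite subrr.
apply/matrixP => a b; have := form_diag0 D0 (delta_mx 0 b) (delta_mx 0 a).
by rewrite form_delta [const_mx _ _ _]mxE => ->; rewrite mxE.
Qed.

Lemma quotient_operator_system (R : realType) (V : lmodType R[i]) (nV : mxnorm V)
    (cone : forall n, set 'M[V]_n) (e : V) (W : submodClosed V) :
  operator_system nV cone e -> complete_M_ideal nV W ->
  (exists x : V, x \notin W) ->
  exists cone' : forall n, set 'M[quot_space W]_n,
    operator_system (quot_norm W nV) cone' (quot_map W e).
Proof.
move=> [mV V0 [K [Phi [iso adj Phi1 _]]]] MW Wproper.
have oV := system_operator_space mV iso.
have e1 := system_vnorm1 mV V0 iso Phi1.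
have n1 := system_n_cb mV V0 iso Phi1.
have mQ : matricially_normed (quot_norm W nV).
  by apply: quot_matricially_normed => //; case: MW.
have ele : vnorm nV e <= 1 by rewrite e1.
have norming k (y : 'M[quot_space W]_k) : quot_norm W nV k y = 1 ->
    exists t : state (quot_norm W nV) (quot_map W e),
      1 <= Mn_norm (state_dim t) k (map_mx t y).
  move=> y1; have [n [f [_ fst le]]] := quot_mxstate_exists oV MW ele ltr01 n1 y1.
  by exists (State fst).
pose rho : {linear quot_space W -> bop (hsum_space R (@state_dim _ _ _ (quot_map W e)))} :=
  @rep _ _ _ (quot_map W e) mQ.
(* The cones are the preimages of the positive operators, the only choice compatible with the
   injective [rho]. *)
exists (fun n => [set y | bop_positive _ n (map_mx rho y)]); split=> //.
  have [x xW] := Wproper; exists (quot_map W x); apply/eqP => Qx0.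
  move/negP: xW; apply; rewrite -[x]subr0; apply/quot_mapP.
  by rewrite Qx0 linear0.
exists (hsum_space R (@state_dim _ _ _ (quot_map W e))), rho; split.
- exact: rep_isometry.
- move=> y; rewrite -[y]quot_map_repr.
  have [w wadj] := adj (repr y); exists (quot_map W w).
  apply: rep_adjoint => t; exact: state_adjoint wadj.
- exact: rep_unit.
- move=> n; apply/seteqP; split=> [_ [y yp <-]|_ [[y _ <-] yp]].
    by split=> //; exists y.
  by exists y.
Qed.

Theorem theorem3p5 (R : realType) :
  (forall (V : lmodType R[i]) (nV : mxnorm V) (W : submodClosed V),
     operator_space nV -> complete_M_ideal nV W -> (exists x : V, x \notin W) ->
     forall v : V, vnorm nV v = 1 -> (0 < n_cb nV v)%E ->
       vnorm (quot_norm W nV) (quot_map W v) = 1 /\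
       (n_cb nV v <= n_cb (quot_norm W nV) (quot_map W v))%E)
  /\
  (forall (V : lmodType R[i]) (nV : mxnorm V)
     (cone : forall n, set 'M[V]_n) (e : V) (W : submodClosed V),
     operator_system nV cone e -> complete_M_ideal nV W ->
     (exists x : V, x \notin W) ->
     exists (cone' : forall n, set 'M[quot_space W]_n) (e' : quot_space W),
       operator_system (quot_norm W nV) cone' e').
Proof.
split=> [V nV W oV MW Wp v v1 n0|V nV cone e W sV MW Wp].
  by split; [exact: vnorm_quot|exact: n_cb_quot_le].
have [cone' sQ] := quotient_operator_system sV MW Wp.
by exists cone', (quot_map W e).
Qed.
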